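(* Let $E=\mathbb R^2$ and $G=I_2(m)$ a dihedral group. The centraliser $\mathrm{Cent}_{H_c(G,E)\otimes\mathcal C}(\mathfrak u(2|1))$ is generated by the central element $Z_1-Z_2$ and $\rho\big((G^J)^{\widetilde{}}\,\big)$, where $G^J$ is abelian for $G$ dihedral.
   Context: $E=\mathbb R^2$ has orthonormal basis $\xi,\eta$ and dual basis $x,y$ of $E^*$. $G=I_2(m)$ is the dihedral group of order $2m$ generated by the reflections $s_1,\dots,s_m$, where $s_j$ is the reflection in the unit vector $\alpha_j=\sin(\pi j/m)\xi-\cos(\pi j/m)\eta$; put $a_j=\sin(\pi j/m)x-\cos(\pi j/m)y$. $c$ is a conjugation-invariant complex-valued function on the reflections. $H_c(G,E)$ is the quotient of $T(E_{\mathbb C}\oplus E_{\mathbb C}^* )\rtimes G$ (where $gX=(g\cdot X)g$) by the relations that elements of $E$ commute, elements of $E^*$ commute, and $[\xi',x']=\langle x',\xi'\rangle-2\sum_{j=1}^mc(s_j)\langle x',\alpha_j\rangle\langle a_j,\xi'\rangle s_j$. Put $z=x+iy$, $\bar z=x-iy$, $\zeta=\frac12(\xi-i\eta)$, $\bar\zeta=\frac12(\xi+i\eta)$, $\sigma=\sum_jc(s_j)s_j$, $E_+=\frac12z\bar z$, $E_-=-2\zeta\bar\zeta$, $H=z\zeta+\bar z\bar\zeta+1-\sigma$. $\mathcal C$ is the complex Clifford algebra with generators $e_1,e_2$ (corresponding to $\xi,\eta$ under the embedding $\iota:E_{\mathbb C}\to\mathcal C$), $\{e_j,e_k\}=2\delta_{jk}$;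 $f=\frac12(e_1-ie_2)$, $f^\dagger=\frac12(e_1+ie_2)$. In the ordinary tensor product algebra $H_c(G,E)\otimes\mathcal C$ (tensor symbols omitted), $\mathfrak u(2|1)$ is the Lie superalgebra with odd part spanned by $F_+=\bar zf^\dagger$, $\bar F_+=zf$, $F_-=2\zeta f^\dagger$, $\bar F_-=2\bar\zeta f$, and even part spanned by $E_\pm$, $H$, $Z_2=f^\dagger f-\frac12$ and $Z_1=\bar z\bar\zeta-z\zeta+2\sigma Z_2$; $Z_1-Z_2$ is central in it. Let $J\xi=-\eta$, $J\eta=\xi$, and $G^J$ the subgroup of $G$ of elements commuting with $J$. $\tilde G\subset\mathcal C$ is the double cover of $G$ in the Pin group: the group generated by the elements $\pm\iota(\alpha_j)$, with covering map $p:\tilde G\to G$, $p(\pm\iota(\alpha_j))=s_j$; $(G^J)^{\widetilde{}}=p^{-1}(G^J)$. $\rho:\tilde G\to H_c(G,E)\otimes\mathcal C$ is $\rho(\tilde g)=p(\tilde g)\otimes\tilde g$. *)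

(* Defs.v *)
From HB Require Import structures.
From mathcomp Require Import all_boot all_order all_algebra.
From mathcomp Require Import generic_quotient.
From mathcomp Require Import all_classical reals trigo.
From mathcomp Require Import complex.

Set Implicit Arguments.
Unset Strict Implicit.
Unset Printing Implicit Defensive.

Import Order.TTheory GRing.Theory Num.Theory.

Local Open Scope classical_set_scope.
Local Open Scope quotient_scope.
Local Open Scope ring_scope.

Definition lin_span (K : pzRingType) (V : lmodType K) (s : seq V) : set V :=
  [set v | exists k : 'I_(size s) -> K, v = \sum_i k i *: s`_i].

Definition centraliser (A : pzRingType) (S : set A) : set A :=
  [set a | forall b, S b -> a * b = b * a].

(* The unital associative K-algebra with generators X and relations rel:      *)
(* algebraic expressions in the generators modulo the least congruence that   *)
(* contains the algebra axioms and rel. It carries pzRingType and lmodType    *)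
(* structures rather than algType, which excludes the zero ring.              *)
Inductive expr (K : comPzRingType) (X : Type) : Type :=
  | Gen of X
  | Zero
  | One
  | Opp of expr K X
  | Add of expr K X & expr K X
  | Mul of expr K X & expr K X
  | Scale of K & expr K X.

Arguments Gen {K X}.
Arguments Zero {K X}.
Arguments One {K X}.

Declare Scope expr_scope.
Delimit Scope expr_scope with X.
Bind Scope expr_scope with expr.
Notation "0" := Zero : expr_scope.
Notation "1" := One : expr_scope.
Notation "- s" := (Opp s) : expr_scope.
Notation "s + t" := (Add s t) : expr_scope.
Notation "s - t" := (Add s (Opp t)) : expr_scope.
Notation "s * t" := (Mul s t) : expr_scope.
Notation "k *: s" := (Scale k s) : expr_scope.

HB.instance Definition _ (K : comPzRingType) (X : Type) :=
  gen_eqMixin (expr K X).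
HB.instance Definition _ (K : comPzRingType) (X : Type) :=
  gen_choiceMixin (expr K X).

Section PresentedAlgebra.
Variables (K : comPzRingType) (X : Type).
Variable (rel : expr K X -> expr K X -> Prop).

Inductive congr : expr K X -> expr K X -> Prop :=
  | congr_rel s t : rel s t -> congr s t
  | congr_refl s : congr s s
  | congr_sym s t : congr s t -> congr t s
  | congr_trans t s u : congr s t -> congr t u -> congr s u
  | congr_Opp s s' : congr s s' -> congr (- s) (- s')
  | congr_Add s s' t t' : congr s s' -> congr t t' -> congr (s + t) (s' + t')
  | congr_Mul s s' t t' : congr s s' -> congr t t' -> congr (s * t) (s' * t')
  | congr_Scale k s s' : congr s s' -> congr (k *: s) (k *: s')
  | congr_addA s t u : congr (s + (t + u)) (s + t + u)
  | congr_addC s t : congr (s + t) (t + s)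
  | congr_add0 s : congr (0 + s) s
  | congr_addN s : congr (- s + s) 0
  | congr_mulA s t u : congr (s * (t * u)) (s * t * u)
  | congr_mul1l s : congr (1 * s) s
  | congr_mul1r s : congr (s * 1) s
  | congr_mulDl s t u : congr ((s + t) * u) (s * u + t * u)
  | congr_mulDr s t u : congr (s * (t + u)) (s * t + s * u)
  | congr_scaleA k l s : congr (k *: (l *: s)) ((k * l)%R *: s)
  | congr_scale1 s : congr (1%R *: s) s
  | congr_scaleDr k s t : congr (k *: (s + t)) (k *: s + k *: t)
  | congr_scaleDl s k l : congr ((k + l)%R *: s) (k *: s + l *: s)
  | congr_scaleAl k s t : congr (k *: (s * t)) ((k *: s) * t)
  | congr_scaleAr k s t : congr (k *: (s * t)) (s * (k *: t)).

Definition congrb (s t : expr K X) : bool := `[< congr s t >].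

Lemma congrb_refl : reflexive congrb.
Proof. by move=> s; apply/asboolP/congr_refl. Qed.

Lemma congrb_sym : symmetric congrb.
Proof. by move=> s t; apply/asboolP/asboolP; apply: congr_sym. Qed.

Lemma congrb_trans : transitive congrb.
Proof.
by move=> t s u /asboolP st /asboolP tu; apply/asboolP/(congr_trans st tu).
Qed.

Canonical congrb_equiv := EquivRel congrb congrb_refl congrb_sym congrb_trans.

Definition presented : Type := {eq_quot congrb_equiv}.

HB.instance Definition _ := Choice.on presented.
HB.instance Definition _ := EqQuotient.on presented.

Definition pres (s : expr K X) : presented := \pi_presented s.

Lemma presP s t : pres s = pres t <-> congr s t.
Proof.
split=> [/eqmodP/asboolP//|st].
by apply/eqmodP/asboolP.
Qed.

Lemma presK a : pres (repr a) = a. Proof. exact: reprK. Qed.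

Lemma repr_pres s : congr (repr (pres s)) s.
Proof. by apply/presP; rewrite presK. Qed.

Definition pres_zero : presented := pres 0.
Definition pres_one : presented := pres 1.
Definition pres_opp (a : presented) : presented := pres (- repr a).
Definition pres_add (a b : presented) : presented := pres (repr a + repr b).
Definition pres_mul (a b : presented) : presented := pres (repr a * repr b).
Definition pres_scale (k : K) (a : presented) : presented := pres (k *: repr a).

Fact pres_oppE s : pres_opp (pres s) = pres (- s).
Proof. exact/presP/congr_Opp/repr_pres. Qed.
Fact pres_addE s t : pres_add (pres s) (pres t) = pres (s + t).
Proof. by apply/presP/congr_Add; apply: repr_pres. Qed.
Fact pres_mulE s t : pres_mul (pres s) (pres t) = pres (s * t).
Proof. by apply/presP/congr_Mul; apply: repr_pres. Qed.
Fact pres_scaleE k s : pres_scale k (pres s) = pres (k *: s).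
Proof. exact/presP/congr_Scale/repr_pres. Qed.

Fact pres_ind (P : presented -> Prop) : (forall s, P (pres s)) -> forall a, P a.
Proof. by move=> Ps a; rewrite -(presK a). Qed.

Fact pres_addrA : associative pres_add.
Proof.
elim/pres_ind=> s; elim/pres_ind=> t; elim/pres_ind=> u; rewrite !pres_addE.
exact/presP/congr_addA.
Qed.
Fact pres_addrC : commutative pres_add.
Proof.
elim/pres_ind=> s; elim/pres_ind=> t; rewrite !pres_addE.
exact/presP/congr_addC.
Qed.
Fact pres_add0r : left_id pres_zero pres_add.
Proof. elim/pres_ind=> s; rewrite pres_addE; exact/presP/congr_add0. Qed.
Fact pres_addNr : left_inverse pres_zero pres_opp pres_add.
Proof. elim/pres_ind=> s; rewrite pres_oppE pres_addE; exact/presP/congr_addN. Qed.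

HB.instance Definition _ :=
  GRing.isZmodule.Build presented pres_addrA pres_addrC pres_add0r pres_addNr.

Fact pres_mulrA : associative pres_mul.
Proof.
elim/pres_ind=> s; elim/pres_ind=> t; elim/pres_ind=> u; rewrite !pres_mulE.
exact/presP/congr_mulA.
Qed.
Fact pres_mul1r : left_id pres_one pres_mul.
Proof. elim/pres_ind=> s; rewrite pres_mulE; exact/presP/congr_mul1l. Qed.
Fact pres_mulr1 : right_id pres_one pres_mul.
Proof. elim/pres_ind=> s; rewrite pres_mulE; exact/presP/congr_mul1r. Qed.
Fact pres_mulrDl : left_distributive pres_mul pres_add.
Proof.
elim/pres_ind=> s; elim/pres_ind=> t; elim/pres_ind=> u.
rewrite !(pres_addE, pres_mulE).
exact/presP/congr_mulDl.
Qed.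
Fact pres_mulrDr : right_distributive pres_mul pres_add.
Proof.
elim/pres_ind=> s; elim/pres_ind=> t; elim/pres_ind=> u.
rewrite !(pres_addE, pres_mulE).
exact/presP/congr_mulDr.
Qed.

HB.instance Definition _ :=
  GRing.Zmodule_isPzRing.Build presented
    pres_mulrA pres_mul1r pres_mulr1 pres_mulrDl pres_mulrDr.

Fact pres_scalerA k l a : pres_scale k (pres_scale l a) = pres_scale (k * l) a.
Proof. elim/pres_ind: a => s; rewrite !pres_scaleE; exact/presP/congr_scaleA. Qed.
Fact pres_scale1r : left_id 1 pres_scale.
Proof. elim/pres_ind=> s; rewrite pres_scaleE; exact/presP/congr_scale1. Qed.
Fact pres_scalerDr : right_distributive pres_scale +%R.
Proof.
move=> k; elim/pres_ind=> s; elim/pres_ind=> t.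
rewrite /GRing.add /= !(pres_addE, pres_scaleE); exact/presP/congr_scaleDr.
Qed.
Fact pres_scalerDl a : {morph pres_scale^~ a : k l / k + l}.
Proof.
elim/pres_ind: a => s k l; rewrite [RHS]/GRing.add /= !(pres_addE, pres_scaleE).
exact/presP/congr_scaleDl.
Qed.

HB.instance Definition _ :=
  GRing.Zmodule_isLmodule.Build K presented
    pres_scalerA pres_scale1r pres_scalerDr pres_scalerDl.

Lemma pres_scalerAl k (a b : presented) : k *: (a * b) = (k *: a) * b.
Proof.
elim/pres_ind: a => s; elim/pres_ind: b => t.
rewrite /GRing.mul /GRing.scale /= !(pres_mulE, pres_scaleE).
exact/presP/congr_scaleAl.
Qed.
Lemma pres_scalerAr k (a b : presented) : k *: (a * b) = a * (k *: b).
Proof.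
elim/pres_ind: a => s; elim/pres_ind: b => t.
rewrite /GRing.mul /GRing.scale /= !(pres_mulE, pres_scaleE).
exact/presP/congr_scaleAr.
Qed.

End PresentedAlgebra.

Section Subalgebra.
Variables (K : comPzRingType) (X : Type) (rel : expr K X -> expr K X -> Prop).
Local Notation A := (presented rel).

Definition is_subalgebra (B : set A) : Prop :=
  [/\ B 1,
      forall (k : K) a b, B a -> B b -> B (k *: a + b)
    & forall a b, B a -> B b -> B (a * b)].

Definition generated_subalgebra (S : set A) : set A :=
  smallest is_subalgebra S.

End Subalgebra.

(* The tensor product algebra, spanned by the pure tensors (a, b) subject to  *)
(* bilinearity and (a, b)(a', b') = (aa', bb').                               *)
Section TensorProduct.
Variables (K : comPzRingType) (X Y : Type).
Variables (relA : expr K X -> expr K X -> Prop).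
Variables (relB : expr K Y -> expr K Y -> Prop).
Local Notation A := (presented relA).
Local Notation B := (presented relB).

Inductive tensor_rel : expr K (A * B) -> expr K (A * B) -> Prop :=
  | tensor_linl k a a' b :
      tensor_rel (Gen (k *: a + a', b)%R) (k *: Gen (a, b) + Gen (a', b))
  | tensor_linr k a b b' :
      tensor_rel (Gen (a, k *: b + b')%R) (k *: Gen (a, b) + Gen (a, b'))
  | tensor_one : tensor_rel (Gen (1, 1)%R) 1
  | tensor_mul a a' b b' :
      tensor_rel (Gen (a, b) * Gen (a', b')) (Gen (a * a', b * b')%R).

Definition tensor : Type := presented tensor_rel.
HB.instance Definition _ := GRing.PzRing.on tensor.
HB.instance Definition _ := GRing.Lmodule.on tensor.

Definition tens (a : A) (b : B) : tensor := pres tensor_rel (Gen (a, b)).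

End TensorProduct.

Notation "a ⊗ b" := (tens a b) (at level 40, left associativity) : ring_scope.

Section Plane.
Variable R : realType.
Local Notation C := R[i].

Definition xi : 'cV[R]_2 := delta_mx 0 0.
Definition eta : 'cV[R]_2 := delta_mx 1 0.
Definition x_ : 'rV[R]_2 := delta_mx 0 0.
Definition y_ : 'rV[R]_2 := delta_mx 0 1.

(* Complexification E -> E_C, E^* -> E_C^* and GL(E) -> GL(E_C). *)
Definition cplx p q (M : 'M[R]_(p, q)) : 'M[C]_(p, q) :=
  map_mx (fun r : R => r%:C%C) M.

Definition pairing (x' : 'rV[C]_2) (v : 'cV[C]_2) : C := (x' *m v) 0 0.

Definition J : 'M[R]_2 := eta *m (- x_) + xi *m y_.

Definition matrix_group (A : set 'M[R]_2) : Prop :=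
  [/\ A 1%:M,
      forall g h, A g -> A h -> A (g *m h)
    & forall g, A g -> A (invmx g)].

Section Dihedral.
Variable m : nat.

(* The indices 1, ..., m are represented by j : 'I_m, shifted by one. *)
Definition angle (j : 'I_m) : R := pi * j.+1%:R / m%:R.

Definition alpha_ (j : 'I_m) : 'cV[R]_2 :=
  sin (angle j) *: xi - cos (angle j) *: eta.

Definition a_ (j : 'I_m) : 'rV[R]_2 :=
  sin (angle j) *: x_ - cos (angle j) *: y_.

Definition reflection (j : 'I_m) : 'M[R]_2 :=
  1%:M - 2 *: (alpha_ j *m a_ j).

Definition reflections : set 'M[R]_2 := range reflection.

Definition dihedral : set 'M[R]_2 := smallest matrix_group reflections.

Lemma reflection_dihedral j : reflection j \in dihedral.
Proof. by apply/mem_set; apply: sub_gen_smallest; exists j. Qed.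

Definition s_ (j : 'I_m) : dihedral :=
  exist (fun g => g \in dihedral) (reflection j) (reflection_dihedral j).

Definition dihedralJ : set 'M[R]_2 :=
  [set g | dihedral g /\ g *m J = J *m g].

Definition conj_invariant (c : 'M[R]_2 -> C) : Prop :=
  forall g s, dihedral g -> reflections s -> c (g *m s *m invmx g) = c s.

Section Cherednik.
(* Only the values of c on reflections are used. *)
Variable c : 'M[R]_2 -> C.

Inductive cherednik_gen : Type :=
  | Vec of 'cV[C]_2
  | Cov of 'rV[C]_2
  | Grp of dihedral.

Local Notation vec v := (Gen (Vec v)).
Local Notation cov x' := (Gen (Cov x')).
Local Notation grp g := (Gen (Grp g)).

(* The first six relations present T(E_C (+) E_C^* ) ><| G; the action on E^* *)
(* is the contragredient one.                                                 *)
Inductive cherednik_rel :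
    expr C cherednik_gen -> expr C cherednik_gen -> Prop :=
  | cherednik_vec_lin k v w :
      cherednik_rel (vec (k *: v + w)%R) (k *: vec v + vec w)
  | cherednik_cov_lin k x' y' :
      cherednik_rel (cov (k *: x' + y')%R) (k *: cov x' + cov y')
  | cherednik_grp1 (g : dihedral) :
      val g = 1%:M -> cherednik_rel (grp g) 1
  | cherednik_grpM (g h k : dihedral) :
      val k = val g *m val h -> cherednik_rel (grp g * grp h) (grp k)
  | cherednik_grp_vec (g : dihedral) v :
      cherednik_rel (grp g * vec v) (vec (cplx (val g) *m v) * grp g)
  | cherednik_grp_cov (g : dihedral) x' :
      cherednik_rel (grp g * cov x')
                    (cov (x' *m cplx (invmx (val g))) * grp g)
  | cherednik_vecC v w :
      cherednik_rel (vec v * vec w) (vec w * vec v)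
  | cherednik_covC x' y' :
      cherednik_rel (cov x' * cov y') (cov y' * cov x')
  | cherednik_comm v x' :
      cherednik_rel (vec v * cov x' - cov x' * vec v)
        (pairing x' v *: 1 -
         2%R *: \big[@Add _ _/0%X]_(j < m)
           ((c (reflection j) * pairing x' (cplx (alpha_ j))
              * pairing (cplx (a_ j)) v)%R *: grp (s_ j))%X).

Definition cherednik : Type := presented cherednik_rel.
HB.instance Definition _ := GRing.PzRing.on cherednik.
HB.instance Definition _ := GRing.Lmodule.on cherednik.

Definition hvec (v : 'cV[C]_2) : cherednik := pres cherednik_rel (vec v).
Definition hcov (x' : 'rV[C]_2) : cherednik := pres cherednik_rel (cov x').
Definition hgrp (g : dihedral) : cherednik := pres cherednik_rel (grp g).

End Cherednik.
End Dihedral.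

(* 0 and 1 in 'I_2 stand for the indices of e_1 and e_2. *)
Inductive clifford_rel : expr C 'I_2 -> expr C 'I_2 -> Prop :=
  | clifford_anticomm j k :
      clifford_rel (Gen j * Gen k + Gen k * Gen j) ((2 * (j == k)%:R)%R *: 1).

Definition clifford : Type := presented clifford_rel.
HB.instance Definition _ := GRing.PzRing.on clifford.
HB.instance Definition _ := GRing.Lmodule.on clifford.

Definition e_ (j : 'I_2) : clifford := pres clifford_rel (Gen j).

Definition iota_cl (v : 'cV[C]_2) : clifford := \sum_j v j 0 *: e_ j.

Definition f_ : clifford := 2^-1 *: (e_ 0 - 'i%C *: e_ 1).
Definition fdag : clifford := 2^-1 *: (e_ 0 + 'i%C *: e_ 1).

(* The graph of p : \tilde G -> G, that is, the subgroup of C^* x G generated *)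
(* by the pairs (± iota(alpha_j), s_j); \tilde G is its first projection.     *)
Definition pin_group (A : set (clifford * 'M[R]_2)) : Prop :=
  [/\ A (1, 1%:M),
      forall a b g h, A (a, g) -> A (b, h) -> A (a * b, g *m h)
    & forall a b g, A (a, g) -> a * b = 1 -> b * a = 1 -> A (b, invmx g)].

Definition pin_graph (m : nat) : set (clifford * 'M[R]_2) :=
  smallest pin_group
    [set u | exists (b : bool) (j : 'I_m),
       u = ((-1) ^+ b * iota_cl (cplx (alpha_ j)), reflection j)].

Section U21.
Variables (m : nat) (c : 'M[R]_2 -> C).

Local Notation H_ := (cherednik m c).
Definition HC : Type := tensor (@cherednik_rel m c) clifford_rel.
HB.instance Definition _ := GRing.PzRing.on HC.
HB.instance Definition _ := GRing.Lmodule.on HC.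

Definition z_ : H_ := hcov m c (cplx x_ + 'i%C *: cplx y_).
Definition zbar : H_ := hcov m c (cplx x_ - 'i%C *: cplx y_).
Definition zeta : H_ := hvec m c (2^-1 *: (cplx xi - 'i%C *: cplx eta)).
Definition zetabar : H_ := hvec m c (2^-1 *: (cplx xi + 'i%C *: cplx eta)).
Definition sigma : H_ := \sum_(j < m) c (reflection j) *: hgrp c (s_ j).

Definition Fp : HC := zbar ⊗ fdag.
Definition Fbarp : HC := z_ ⊗ f_.
Definition Fm : HC := (2 *: zeta) ⊗ fdag.
Definition Fbarm : HC := (2 *: zetabar) ⊗ f_.

Definition Ep : HC := (2^-1 *: (z_ * zbar)) ⊗ 1.
Definition Em : HC := (- 2 *: (zeta * zetabar)) ⊗ 1.
Definition Hsl2 : HC := (z_ * zeta + zbar * zetabar + 1 - sigma) ⊗ 1.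
Definition Z2 : HC := 1 ⊗ (fdag * f_ - 2^-1 *: (1 : clifford)).
Definition Z1 : HC :=
  (zbar * zetabar - z_ * zeta) ⊗ 1 + 2 *: ((sigma ⊗ 1) * Z2).

Definition u21_odd : set HC := lin_span [:: Fp; Fbarp; Fm; Fbarm].
Definition u21_even : set HC := lin_span [:: Ep; Em; Hsl2; Z2; Z1].
Definition u21 : set HC := [set a + b | a in u21_even & b in u21_odd].

(* The image under rho of p^-1(G^J). *)
Definition rho_dihedralJ : set HC :=
  [set t | exists (g : dihedral m) (a : clifford),
     [/\ pin_graph m (a, val g), dihedralJ m (val g) & t = hgrp c g ⊗ a]].

End U21.
End Plane.

Arguments dihedralJ {R} m _.
Arguments u21 {R} m c _.
Arguments rho_dihedralJ {R} m c _.

(* Main.v *)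
From HB Require Import structures.
Require Import Defs.
From mathcomp Require Import all_boot all_order all_algebra.
From mathcomp Require Import boolp classical_sets functions reals trigo.
From mathcomp Require Import complex ring lra zify.

(** The algebra C is that of 2 x 2 matrices, with matrix units f^+ f, f f^+,
    f and f^+, so that an element of the tensor product is a 2 x 2 matrix
    over H = H_c(G, E). Commuting with Z_2 makes it diagonal, with entries a
    and b say, and commuting with the odd part of u(2|1) then amounts to

      a zbar = zbar b,  b z = z a,  a zeta = zeta b,  b zetabar = zetabar a

    (intertwine); such matrices commute with the even part too
    (intertwine_centraliser). The proof determines all pairs (a, b), in three
    steps.

    The entries a and b commute with z zbar and zeta zetabar, that is, they
    are invariant under sl(2). Lemma sl2_invariants shows that an invariant is
    a combination of the M^k g, for M = zbar zetabar - z zeta and g in G. This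
    is classical invariant theory for the associated graded algebra, but the
    argument here stays inside H, which is spanned by words in the four
    coordinates times group elements, where letters commute modulo shorter
    words. With the ad-action of the sl2-triple, images under f of words of
    weight two relate the words of weight zero and length 2q modulo shorter
    ones; together with M times a shorter word they show that every element of
    weight zero is the sum of a combination of the M^k g and of some f y with
    y of weight two (splits_weight0). If the sum is killed by e, so is f y,
    and then y = 0 because e is locally nilpotent (no_singular).

    Write a = M^n A + ..., b = M^n B + ... with A and B in the group algebra.
    Comparing top terms in a zbar = zbar b should give A zbar = zbar B, but
    this takes some linear independence in H. It comes from the Dunkl
    representation, on families of power series at the points of a regular
    orbit of G (op_rel); commuting n times with multiplication by a fixed
    power series extracts the principal symbols of order n, and that of M is
    invertible (top_coefficients). Only rotations can then occur in A and B,
    and the coefficient of a rotation g in B is a fixed multiple, a unit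
    complex number, of the one in A (top_rotation, top_reflection).

    On the other hand Z_1 - Z_2 is the diagonal matrix with entries M + s and
    M - s for s = sigma - 1/2 (Z1_Z2E), and rho of an element over a rotation
    g is a multiple of the diagonal matrix with entries g and that same unit
    complex number times g (pin_graph_spec, even_pin_diag). Hence the
    diagonal matrix with entries A and B is a combination of such elements,
    and the product of (Z_1 - Z_2)^n with it has the same top coefficients as
    the given element; the difference has lower degree in M, and induction on
    n concludes (intertwine_gen). That these elements do commute with u(2|1)
    is the computation Z_intertwine, and the fact that the coordinates are
    eigenvectors of the rotations (rotation_intertwine). *)

Set Implicit Arguments.
Unset Strict Implicit.
Unset Printing Implicit Defensive.

Import Order.TTheory GRing.Theory Num.Theory.

Local Open Scope classical_set_scope.
Local Open Scope ring_scope.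

(** * Identities between linear combinations *)

Section LinearIdentities.
Variables (K : comPzRingType) (V : lmodType K).

(** Linear expressions in numbered atoms, so that an identity in a module
    reduces to one ring identity per atom: the coefficients are recomputed
    by lcoef. *)
Inductive lexp : Type :=
  | LVar of nat
  | LZero
  | LOpp of lexp
  | LAdd of lexp & lexp
  | LScale of K & lexp.

Fixpoint leval (env : seq V) (e : lexp) : V :=
  match e with
  | LVar i => env`_i
  | LZero => 0
  | LOpp e => - leval env e
  | LAdd e1 e2 => leval env e1 + leval env e2
  | LScale k e => k *: leval env e
  end.

Fixpoint lcoef (e : lexp) (i : nat) : K :=
  match e with
  | LVar j => if eqn j i then 1 else 0
  | LZero => 0
  | LOpp e => - lcoef e i
  | LAdd e1 e2 => lcoef e1 i + lcoef e2 i
  | LScale k e => k * lcoef e i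
  end.

Fixpoint same_coefs (n : nat) (e1 e2 : lexp) : Prop :=
  match n with
  | 0%N => True
  | n.+1 => lcoef e1 n = lcoef e2 n /\ same_coefs n e1 e2
  end.

Lemma leval_lcoef env e :
  leval env e = \sum_(i < size env) lcoef e i *: env`_i.
Proof.
elim: e => [j||e IH|e1 IH1 e2 IH2|k e IH] /=.
- have [lt_j|ge_j] := ltnP j (size env); last first.
    rewrite nth_default // big1 // => i _; case: eqnP; last first.
      by rewrite scale0r.
    by move=> ji; move: (ltn_ord i); rewrite -ji ltnNge ge_j.
  rewrite (bigD1 (Ordinal lt_j)) //= eqnE eqxx scale1r.
  rewrite big1 ?addr0 // => i ij; case: eqP; last by rewrite scale0r.
  by move=> ji; move: ij; rewrite -val_eqE /= ji eqxx.
- by rewrite big1 // => i _; rewrite scale0r.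
- by rewrite IH -sumrN; apply: eq_bigr => i _; rewrite scaleNr.
- by rewrite IH1 IH2 -big_split; apply: eq_bigr => i _; rewrite scalerDl.
- by rewrite IH scaler_sumr; apply: eq_bigr => i _; rewrite scalerA.
Qed.

Lemma linear_identity env e1 e2 :
  same_coefs (size env) e1 e2 -> leval env e1 = leval env e2.
Proof.
move=> same; rewrite !leval_lcoef; apply: eq_bigr => i _; congr (_ *: _).
elim: (size env) (i : nat) (ltn_ord i) same => // n IH j lt_j /= [eq_n same].
by move: lt_j; rewrite ltnS leq_eqVlt => /orP[/eqP->|/IH]; [|exact].
Qed.

End LinearIdentities.

(** Products are compared factor by factor, since the same product may be
    built on different but convertible ring structures. *)
Ltac lin_same s t :=
  lazymatch s with
  | GRing.mul ?s1 ?s2 =>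
    lazymatch t with
    | GRing.mul ?t1 ?t2 => lin_same s1 t1; lin_same s2 t2
    end
  | GRing.exp ?s1 ?n =>
    lazymatch t with
    | GRing.exp ?t1 n => lin_same s1 t1
    end
  | GRing.one _ => lazymatch t with GRing.one _ => idtac end
  | _ => constr_eq s t
  end.

Ltac lin_find t env :=
  match env with
  | ?s :: _ => let _ := lazymatch goal with _ => lin_same s t end in
    constr:(Some 0%N)
  | _ :: ?env' =>
    lazymatch lin_find t env' with
    | Some ?n => constr:(Some (S n))
    | None => constr:(@None nat)
    end
  | _ => constr:(@None nat)
  end.

Ltac lin_atoms env t :=
  lazymatch t with
  | GRing.add ?a ?b => let env := lin_atoms env a in lin_atoms env b
  | GRing.opp ?a => lin_atoms env a
  | GRing.scale _ ?a => lin_atoms env a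
  | GRing.zero => env
  | _ =>
    lazymatch lin_find t env with
    | Some _ => env
    | None => constr:(t :: env)
    end
  end.

Ltac lin_reify K env t :=
  lazymatch t with
  | GRing.add ?a ?b =>
    let a := lin_reify K env a in
    let b := lin_reify K env b in constr:(@LAdd K a b)
  | GRing.opp ?a => let a := lin_reify K env a in constr:(@LOpp K a)
  | GRing.scale ?k ?a =>
    let a := lin_reify K env a in constr:(@LScale K k a)
  | GRing.zero => constr:(@LZero K)
  | _ =>
    lazymatch lin_find t env with
    | Some ?n => constr:(@LVar K n)
    end
  end.

(** The goal x = y in the K-module V is split into the identities between
    the coefficients of each atom, which ring decides; those that need more
    than the ring axioms are left to the user. *)
Tactic Notation "lin" constr(K) constr(V) :=
  let K := constr:([the comPzRingType of K]) in
  let V := constr:([the lmodType K of V]) in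
  lazymatch goal with
  | |- ?x = ?y =>
    let env := lin_atoms constr:(@nil V) x in
    let env := lin_atoms env y in
    let ex := lin_reify K env x in
    let ey := lin_reify K env y in
    let E := fresh in
    assert (E : @same_coefs K (size env) ex ey);
    [ cbn [same_coefs size lcoef eqn]; repeat split; try (by []); try ring
    | apply (@linear_identity K V env) in E; cbn [leval nth] in E; exact: E ]
  end.

(** * Modules over a presented algebra *)

Section Action.
Variables (K : comPzRingType) (X : Type) (rel : expr K X -> expr K X -> Prop).
Variables (U : lmodType K) (op : X -> U -> U).

Fixpoint ev (s : expr K X) (u : U) : U :=
  match s with
  | Gen x => op x u
  | Zero => 0
  | One => u
  | Opp s => - ev s u
  | Add s t => ev s u + ev t u
  | Mul s t => ev s (ev t u)
  | Scale k s => k *: ev s u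
  end.

(** The expression chosen to represent a is irrelevant once the relations
    hold for op, by ev_congr; defining the action on representatives avoids
    a universal property of the quotient. *)
Definition act (a : presented rel) (u : U) : U := ev (repr a) u.

Hypothesis op_linear : forall x, linear (op x).
Hypothesis op_rel : forall s t, rel s t -> forall u, ev s u = ev t u.

Lemma ev_linear s : linear (ev s).
Proof.
elim: s => [x||| s IH|s IHs t IHt|s IHs t IHt|l s IH] k u v //=.
- exact: op_linear.
- by rewrite scaler0 addr0.
- by rewrite IH opprD scalerN.
- by rewrite IHs IHt scalerDr addrACA.
- by rewrite IHt IHs.
- by rewrite IH scalerDr !scalerA mulrC.
Qed.

Lemma evD s u v : ev s (u + v) = ev s u + ev s v.
Proof. by have := ev_linear s 1 u v; rewrite !scale1r. Qed.

Lemma evZ s k u : ev s (k *: u) = k *: ev s u.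
Proof.
have ev0: ev s 0 = 0.
  by have := ev_linear s (-1) 0 0; rewrite !scaleN1r !addNr.
by have := ev_linear s k u 0; rewrite !addr0 ev0 addr0.
Qed.

Lemma ev_congr s t : congr rel s t -> forall u, ev s u = ev t u.
Proof.
elim=> {s t} [s t /op_rel //|//|s t _ IH u|s t r _ IH _ IH' u|s s' _ IH u|
  s s' t t' _ IH _ IH' u|s s' t t' _ IH _ IH' u|k s s' _ IH u
  |*|*|*|*|*|*|*|*|*|*|*|*|*|*|k s t u] /=.
all: rewrite ?IH ?IH' //.
- by rewrite addrA.
- by rewrite addrC.
- by rewrite add0r.
- by rewrite addNr.
- by rewrite evD.
- by rewrite scalerA.
- by rewrite scale1r.
- by rewrite scalerDr.
- by rewrite scalerDl.
- by rewrite evZ.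
Qed.

Lemma act_pres s u : act (pres rel s) u = ev s u.
Proof. exact/ev_congr/repr_pres. Qed.

Lemma act_addr a u v : act a (u + v) = act a u + act a v.
Proof. exact: evD. Qed.
Lemma act_scaler a k u : act a (k *: u) = k *: act a u.
Proof. exact: evZ. Qed.

Lemma act0 u : act 0 u = 0. Proof. exact: act_pres. Qed.
Lemma act1 u : act 1 u = u. Proof. exact: act_pres. Qed.
Lemma actD a b u : act (a + b) u = act a u + act b u.
Proof. exact: act_pres. Qed.
Lemma actM a b u : act (a * b) u = act a (act b u).
Proof. exact: act_pres. Qed.
Lemma actZ k a u : act (k *: a) u = k *: act a u.
Proof. exact: act_pres. Qed.

End Action.

(** * The dihedral group in coordinates *)

Section TwoByTwo.
Variable K : comPzRingType.

Definition mat2 (a b c d : K) : 'M[K]_2 :=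
  \matrix_(i, j) (nth [::] [:: [:: a; b]; [:: c; d]] i)`_j.
Definition row2 (a b : K) : 'rV[K]_2 := \row_j [:: a; b]`_j.
Definition col2 (a b : K) : 'cV[K]_2 := \col_i [:: a; b]`_i.

Lemma ord2_ind (P : 'I_2 -> Prop) : P 0 -> P 1 -> forall i, P i.
Proof.
move=> P0 P1 [[|[|//]] lt_i2]; first by rewrite (_ : Ordinal _ = 0) //; apply: val_inj.
by rewrite (_ : Ordinal _ = 1) //; apply: val_inj.
Qed.

Lemma row2P (u : 'rV[K]_2) : u = row2 (u 0 0) (u 0 1).
Proof.
by apply/matrixP=> i; rewrite (ord1 i); elim/ord2_ind; rewrite !mxE.
Qed.

Lemma col2P (u : 'cV[K]_2) : u = col2 (u 0 0) (u 1 0).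
Proof.
by apply/matrixP=> i j; rewrite (ord1 j); elim/ord2_ind: i; rewrite !mxE.
Qed.

Lemma mat2P (A : 'M[K]_2) : A = mat2 (A 0 0) (A 0 1) (A 1 0) (A 1 1).
Proof.
by apply/matrixP; elim/ord2_ind; elim/ord2_ind; rewrite !mxE.
Qed.

Lemma mul_mat2 a b c d a' b' c' d' :
  mat2 a b c d *m mat2 a' b' c' d' =
  mat2 (a * a' + b * c') (a * b' + b * d') (c * a' + d * c') (c * b' + d * d').
Proof.
by apply/matrixP; elim/ord2_ind; elim/ord2_ind;
  rewrite !mxE big_ord_recl big_ord1 !mxE.
Qed.

Lemma mul_row2_mat2 x y a b c d :
  row2 x y *m mat2 a b c d = row2 (x * a + y * c) (x * b + y * d).
Proof.
by apply/matrixP=> i; rewrite (ord1 i); elim/ord2_ind;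
  rewrite !mxE big_ord_recl big_ord1 !mxE.
Qed.

Lemma mul_mat2_col2 x y a b c d :
  mat2 a b c d *m col2 x y = col2 (a * x + b * y) (c * x + d * y).
Proof.
by apply/matrixP=> i j; rewrite (ord1 j); elim/ord2_ind: i;
  rewrite !mxE big_ord_recl big_ord1 !mxE.
Qed.

Lemma mul_row2_col2 a b x y : (row2 a b *m col2 x y) 0 0 = a * x + b * y.
Proof. by rewrite !mxE big_ord_recl big_ord1 !mxE. Qed.

Lemma mul_col2_row2 a b x y :
  col2 x y *m row2 a b = mat2 (x * a) (x * b) (y * a) (y * b).
Proof.
by apply/matrixP; elim/ord2_ind; elim/ord2_ind; rewrite !mxE big_ord1 !mxE.
Qed.

Lemma add_row2 a b a' b' : row2 a b + row2 a' b' = row2 (a + a') (b + b').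
Proof. by apply/matrixP=> i; rewrite (ord1 i); elim/ord2_ind; rewrite !mxE. Qed.
Lemma add_col2 a b a' b' : col2 a b + col2 a' b' = col2 (a + a') (b + b').
Proof.
by apply/matrixP=> i j; rewrite (ord1 j); elim/ord2_ind: i; rewrite !mxE.
Qed.
Lemma opp_row2 a b : - row2 a b = row2 (- a) (- b).
Proof. by apply/matrixP=> i; rewrite (ord1 i); elim/ord2_ind; rewrite !mxE. Qed.
Lemma opp_col2 a b : - col2 a b = col2 (- a) (- b).
Proof.
by apply/matrixP=> i j; rewrite (ord1 j); elim/ord2_ind: i; rewrite !mxE.
Qed.
Lemma scale_row2 k a b : k *: row2 a b = row2 (k * a) (k * b).
Proof. by apply/matrixP=> i; rewrite (ord1 i); elim/ord2_ind; rewrite !mxE. Qed.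
Lemma scale_col2 k a b : k *: col2 a b = col2 (k * a) (k * b).
Proof.
by apply/matrixP=> i j; rewrite (ord1 j); elim/ord2_ind: i; rewrite !mxE.
Qed.
Lemma scalar_mat2 a : a%:M = mat2 a 0 0 a :> 'M[K]_2.
Proof. by rewrite [LHS]mat2P !mxE /= !(mulr1n, mulr0n). Qed.
Lemma add_mat2 a b c d a' b' c' d' :
  mat2 a b c d + mat2 a' b' c' d' = mat2 (a + a') (b + b') (c + c') (d + d').
Proof. by apply/matrixP; elim/ord2_ind; elim/ord2_ind; rewrite !mxE. Qed.
Lemma opp_mat2 a b c d : - mat2 a b c d = mat2 (- a) (- b) (- c) (- d).
Proof. by apply/matrixP; elim/ord2_ind; elim/ord2_ind; rewrite !mxE. Qed.
Lemma scale_mat2 k a b c d :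
  k *: mat2 a b c d = mat2 (k * a) (k * b) (k * c) (k * d).
Proof. by apply/matrixP; elim/ord2_ind; elim/ord2_ind; rewrite !mxE. Qed.

End TwoByTwo.

Section PlaneMatrices.
Variable R : realType.
Local Notation C := R[i].

Lemma cplx_mat2 (a b c d : R) :
  cplx (mat2 a b c d) = mat2 a%:C%C b%:C%C c%:C%C d%:C%C :> 'M[C]_2.
Proof. by apply/matrixP; elim/ord2_ind; elim/ord2_ind; rewrite !mxE. Qed.
Lemma cplx_row2 (a b : R) : cplx (row2 a b) = row2 a%:C%C b%:C%C :> 'rV[C]_2.
Proof. by apply/matrixP=> i; rewrite (ord1 i); elim/ord2_ind; rewrite !mxE. Qed.
Lemma cplx_col2 (a b : R) : cplx (col2 a b) = col2 a%:C%C b%:C%C :> 'cV[C]_2.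
Proof.
by apply/matrixP=> i j; rewrite (ord1 j); elim/ord2_ind: i; rewrite !mxE.
Qed.

Lemma cplxM p q r (A : 'M[R]_(p, q)) (B : 'M[R]_(q, r)) :
  cplx (A *m B) = cplx A *m cplx B.
Proof. exact: map_mxM. Qed.

Lemma xiE : xi R = col2 1 0.
Proof. by rewrite [LHS]col2P !mxE. Qed.
Lemma etaE : eta R = col2 0 1.
Proof. by rewrite [LHS]col2P !mxE. Qed.
Lemma x_E : x_ R = row2 1 0.
Proof. by rewrite [LHS]row2P !mxE. Qed.
Lemma y_E : y_ R = row2 0 1.
Proof. by rewrite [LHS]row2P !mxE. Qed.

Lemma JE : J R = mat2 0 1 (-1) 0.
Proof.
rewrite /J xiE etaE x_E y_E opp_row2 !mul_col2_row2 add_mat2.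
by congr mat2; ring.
Qed.

Definition rot_mx (p q : R) : 'M[R]_2 := mat2 p (- q) q p.
Definition ref_mx (p q : R) : 'M[R]_2 := mat2 p q q (- p).

Lemma invmx_unique (A B : 'M[R]_2) : A *m B = 1%:M -> invmx A = B.
Proof.
move=> AB1; have [uA _] := mulmx1_unit AB1.
by rewrite -[LHS]mulmx1 -AB1 mulmxA mulVmx // mul1mx.
Qed.

Lemma invmx_rot p q : p * p + q * q = 1 -> invmx (rot_mx p q) = rot_mx p (- q).
Proof.
move=> pq1; apply: invmx_unique; rewrite mul_mat2 scalar_mat2 -pq1.
by congr mat2; ring.
Qed.

Lemma invmx_ref p q : p * p + q * q = 1 -> invmx (ref_mx p q) = ref_mx p q.
Proof.
move=> pq1; apply: invmx_unique; rewrite mul_mat2 scalar_mat2 -pq1.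
by congr mat2; ring.
Qed.

Variable m : nat.

Lemma alphaE (j : 'I_m) : alpha_ R j = col2 (sin (angle R j)) (- cos (angle R j)).
Proof.
rewrite /alpha_ xiE etaE !scale_col2 opp_col2 add_col2.
by congr col2; ring.
Qed.

Lemma aE (j : 'I_m) : a_ R j = row2 (sin (angle R j)) (- cos (angle R j)).
Proof.
rewrite /a_ x_E y_E !scale_row2 opp_row2 add_row2.
by congr row2; ring.
Qed.

Lemma reflectionE (j : 'I_m) :
  reflection R j = ref_mx (cos (angle R j *+ 2)) (sin (angle R j *+ 2)).
Proof.
rewrite /reflection alphaE aE mul_col2_row2 scale_mat2 opp_mat2 scalar_mat2.
rewrite add_mat2 cos_mulr2n sin_mulr2n.
have := cos2Dsin2 (angle R j); set s := sin _; set c := cos _ => cs.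
have ss: s * s = 1 - c * c by rewrite -cs; ring.
by congr mat2; rewrite ?ss; ring.
Qed.

(** The entries p = cos t and q = sin t take the place of the angle t, so
    that no angle has to be chosen for products. *)
Inductive isometry_spec (g : 'M[R]_2) : Prop :=
  | IsRotation p q of p * p + q * q = 1 & g = rot_mx p q
  | IsReflection p q of p * p + q * q = 1 & g = ref_mx p q.

Lemma dihedral_isometry g : dihedral m g -> isometry_spec g.
Proof.
apply: smallest_sub => {g}; last first.
  move=> _ [j _ <-]; rewrite reflectionE; apply: IsReflection (erefl _).
  by rewrite -!expr2 cos2Dsin2.
split=> [|_ _ [] p q pq1 -> [] p' q' pq1' ->|_ [] p q pq1 ->].
- by apply: (@IsRotation _ 1 0); [ring | rewrite scalar_mat2 /rot_mx oppr0].
- apply: (@IsRotation _ (p * p' - q * q') (p * q' + q * p')).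
    by rewrite -[RHS]mul1r -{1}pq1 -pq1'; ring.
  by rewrite mul_mat2; congr mat2; ring.
- apply: (@IsReflection _ (p * p' - q * q') (p * q' + q * p')).
    by rewrite -[RHS]mul1r -{1}pq1 -pq1'; ring.
  by rewrite mul_mat2; congr mat2; ring.
- apply: (@IsReflection _ (p * p' + q * q') (q * p' - p * q')).
    by rewrite -[RHS]mul1r -{1}pq1 -pq1'; ring.
  by rewrite mul_mat2; congr mat2; ring.
- apply: (@IsRotation _ (p * p' + q * q') (q * p' - p * q')).
    by rewrite -[RHS]mul1r -{1}pq1 -pq1'; ring.
  by rewrite mul_mat2; congr mat2; ring.
- rewrite invmx_rot //; apply: IsRotation (erefl _).
  by rewrite -pq1; ring.
- by rewrite invmx_ref //; apply: IsReflection (erefl _).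
Qed.

Lemma dihedral_group : matrix_group (@dihedral R m).
Proof.
split=> [A [[A1 _ _] _] //|g h Dg Dh A AP|g Dg A AP]; have [[_ AM AV] _] := AP.
  exact: AM (Dg A AP) (Dh A AP).
exact: AV (Dg A AP).
Qed.

Local Notation G := (@dihedral R m).

Lemma gmul_proof (g k : G) : val g *m val k \in G.
Proof.
apply/mem_set; have [_ + _] := dihedral_group.
by apply; apply: set_mem; apply: valP.
Qed.
Definition gmul (g k : G) : G := exist (fun r : 'M[R]_2 => r \in G) _ (gmul_proof g k).

Lemma ginv_proof (g : G) : invmx (val g) \in G.
Proof.
apply/mem_set; have [_ _] := dihedral_group.
by apply; apply: set_mem; apply: valP.
Qed.
Definition ginv (g : G) : G := exist (fun r : 'M[R]_2 => r \in G) _ (ginv_proof g).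

Lemma gid_proof : (1%:M : 'M[R]_2) \in G.
Proof. by apply/mem_set; have [] := dihedral_group. Qed.
Definition gid : G := exist (fun r : 'M[R]_2 => r \in G) _ gid_proof.

Lemma rot_mxJ p q : rot_mx p q *m J R = J R *m rot_mx p q.
Proof. by rewrite JE !mul_mat2; congr mat2; ring. Qed.

(** J is a rotation by a right angle and a reflection reverses rotations, so
    G^J consists of rotations. *)
Lemma ref_mxJ p q :
  p * p + q * q = 1 -> ref_mx p q *m J R = J R *m ref_mx p q -> False.
Proof.
move=> pq1; rewrite JE !mul_mat2 => /matrixP E.
have := E 0 0; have := E 0 1; rewrite !mxE /= => E1 E2.
have p0 : p = 0 by lra.
have q0 : q = 0 by lra.
by move: pq1; rewrite p0 q0 mul0r addr0 => /esym/eqP; rewrite oner_eq0.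
Qed.

Lemma dihedralJ_rotation g : dihedralJ m g ->
  exists p q, p * p + q * q = 1 /\ g = rot_mx p q.
Proof.
move=> [/dihedral_isometry [] p q pq1 ->]; first by exists p, q.
by move=> /(ref_mxJ pq1).
Qed.

Lemma dihedralJ_abelian (g h : 'M[R]_2) :
  dihedralJ m g -> dihedralJ m h -> g *m h = h *m g.
Proof.
move=> /dihedralJ_rotation[p [q [_ ->]]] /dihedralJ_rotation[p' [q' [_ ->]]].
by rewrite !mul_mat2; congr mat2; ring.
Qed.

End PlaneMatrices.

(** * The Cherednik algebra in the coordinates z, zbar, zeta, zetabar *)

Section PresentedAlgebraLemmas.
Variables (K : comPzRingType) (X : Type) (rel : expr K X -> expr K X -> Prop).
Local Notation A := (presented rel).

Lemma presD s t : pres rel (s + t) = pres rel s + pres rel t.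
Proof. exact/esym/pres_addE. Qed.
Lemma presN s : pres rel (- s) = - pres rel s.
Proof. exact/esym/pres_oppE. Qed.
Lemma presM s t : pres rel (s * t) = pres rel s * pres rel t.
Proof. exact/esym/pres_mulE. Qed.
Lemma presZ k s : pres rel (k *: s) = k *: pres rel s.
Proof. exact/esym/pres_scaleE. Qed.

Definition presE := (presD, presN, presM, presZ).

Lemma pres_relE s t : rel s t -> pres rel s = pres rel t.
Proof. by move=> st; apply/presP/congr_rel. Qed.

Lemma pres_span (P : A -> Prop) :
    (forall x, P (pres rel (Gen x))) -> P 1 ->
    (forall k a b, P a -> P b -> P (k *: a + b)) ->
    (forall a b, P a -> P b -> P (a * b)) ->
  forall a, P a.
Proof.
move=> Pgen P1 PL PM; have P0: P 0.
  by rewrite -(addNr 1) -scaleN1r; apply: PL.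
apply: pres_ind; elim=> [x||| s IH|s IHs t IHt|s IHs t IHt|k s IH] //.
- by rewrite presN -[X in P X]addr0 -scaleN1r; apply: PL.
- by rewrite presD -[X in X + _]scale1r; apply: PL.
- by rewrite presM; apply: PM.
- by rewrite presZ -[X in P X]addr0; apply: PL.
Qed.

End PresentedAlgebraLemmas.

Section Cherednik.
Variables (R : realType) (m : nat) (c : 'M[R]_2 -> R[i]).
Local Notation C := R[i].
Local Notation H := (cherednik m c).
Local Notation z := (z_ m c).
Local Notation zb := (zbar m c).
Local Notation ze := (zeta m c).
Local Notation zeb := (zetabar m c).
Local Notation sg := (sigma m c).

Lemma scaleAl_H k (a b : H) : (k *: a) * b = k *: (a * b).
Proof. exact/esym/pres_scalerAl. Qed.
Lemma scaleAr_H k (a b : H) : a * (k *: b) = k *: (a * b).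
Proof. exact/esym/pres_scalerAr. Qed.

Definition expandE := (mulrDl, mulrDr, mulrN, mulNr, scaleAl_H, scaleAr_H,
  mulrA, mulr1, mul1r, mulr0, mul0r).

Lemma hcov_lin k u v : hcov m c (k *: u + v) = k *: hcov m c u + hcov m c v.
Proof. by rewrite -presZ -presD; apply/pres_relE/cherednik_cov_lin. Qed.
Lemma hvec_lin k u v : hvec m c (k *: u + v) = k *: hvec m c u + hvec m c v.
Proof. by rewrite -presZ -presD; apply/pres_relE/cherednik_vec_lin. Qed.
Lemma hcovZ k u : hcov m c (k *: u) = k *: hcov m c u.
Proof.
have hcov0: hcov m c 0 = 0.
  by have := hcov_lin (-1) 0 0; rewrite !scaleN1r !addNr.
by rewrite -[X in hcov _ _ X]addr0 hcov_lin hcov0 addr0.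
Qed.
Lemma hvecZ k u : hvec m c (k *: u) = k *: hvec m c u.
Proof.
have hvec0: hvec m c 0 = 0.
  by have := hvec_lin (-1) 0 0; rewrite !scaleN1r !addNr.
by rewrite -[X in hvec _ _ X]addr0 hvec_lin hvec0 addr0.
Qed.

Lemma z_E : z = hcov m c (row2 1 'i%C).
Proof.
rewrite /z_ x_E y_E !cplx_row2 scale_row2 add_row2.
by congr (hcov _ _ (row2 _ _)); ring.
Qed.
Lemma zbarE : zb = hcov m c (row2 1 (- 'i%C)).
Proof.
rewrite /zbar x_E y_E !cplx_row2 scale_row2 opp_row2 add_row2.
by congr (hcov _ _ (row2 _ _)); ring.
Qed.
Lemma zetaE : ze = hvec m c (col2 2^-1 (- 'i%C / 2)).
Proof.
rewrite /zeta xiE etaE !cplx_col2 scale_col2 opp_col2 add_col2 scale_col2.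
by congr (hvec _ _ (col2 _ _)); ring.
Qed.
Lemma zetabarE : zeb = hvec m c (col2 2^-1 ('i%C / 2)).
Proof.
rewrite /zetabar xiE etaE !cplx_col2 scale_col2 add_col2 scale_col2.
by congr (hvec _ _ (col2 _ _)); ring.
Qed.

Lemma grp_cov (g : dihedral m) u :
  hgrp c g * hcov m c u = hcov m c (u *m cplx (invmx (val g))) * hgrp c g.
Proof. by rewrite -!presM; apply/pres_relE/cherednik_grp_cov. Qed.
Lemma grp_vec (g : dihedral m) u :
  hgrp c g * hvec m c u = hvec m c (cplx (val g) *m u) * hgrp c g.
Proof. by rewrite -!presM; apply/pres_relE/cherednik_grp_vec. Qed.
Lemma covC u v : hcov m c u * hcov m c v = hcov m c v * hcov m c u.
Proof. by rewrite -!presM; apply/pres_relE/cherednik_covC. Qed.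
Lemma vecC u v : hvec m c u * hvec m c v = hvec m c v * hvec m c u.
Proof. by rewrite -!presM; apply/pres_relE/cherednik_vecC. Qed.
Lemma vec_cov u v :
  hvec m c v * hcov m c u = hcov m c u * hvec m c v + pairing u v *: (1 : H) -
    2 *: \sum_(j < m) (c (reflection R j) * pairing u (cplx (alpha_ R j)) *
                       pairing (cplx (a_ R j)) v) *: hgrp c (s_ R j).
Proof.
rewrite -addrA; apply/eqP; rewrite addrC -subr_eq; apply/eqP.
have := pres_relE (@cherednik_comm R m c v u); rewrite !presE => ->.
congr (_ - _ *: _); rewrite (big_morph _ (@presD _ _ _) (erefl _)).
by apply: eq_bigr => j _; rewrite presZ.
Qed.

Lemma ii : 'i%C * 'i%C = -1 :> C.
Proof. exact: sqr_i. Qed.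

(** One letter for each of z, zbar, zeta, zetabar: up separates degree one
    from degree minus one, and bar marks the conjugates. A uniform notation
    for the four makes each relation below a single statement. *)
Definition coordinate (up bar : bool) : H :=
  if up then if bar then zb else z else if bar then zeb else ze.

Local Notation letter := coordinate.

(** The four coordinates are eigenvectors of the rotations; z and zetabar
    share an eigenvalue, whence the parity up (+) bar. *)
Lemma rot_letter (g : dihedral m) (p q : R) up bar :
    p * p + q * q = 1 -> val g = rot_mx p q ->
  hgrp c g * letter up bar =
  (p%:C%C + (-1) ^+ (up (+) bar) * ('i%C * q%:C%C)) *: (letter up bar * hgrp c g).
Proof.
move=> pq1 gE; rewrite /coordinate z_E zbarE zetaE zetabarE.
case: up; rewrite ?(fun_if (fun a => _ * a)) ?grp_cov ?grp_vec gE ?invmx_rot //;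
  rewrite cplx_mat2 ?mul_row2_mat2 ?mul_mat2_col2.
- case: bar; rewrite -scaleAl_H -hcovZ scale_row2 /=;
  by congr (hcov _ _ (row2 _ _) * _); rewrite ?rmorphN /=; ring: ii.
- case: bar; rewrite -scaleAl_H -hvecZ scale_col2 /=;
  by congr (hvec _ _ (col2 _ _) * _); rewrite ?rmorphN /=; field: ii.
Qed.

Lemma ref_letter (g : dihedral m) (p q : R) up bar :
    p * p + q * q = 1 -> val g = ref_mx p q ->
  hgrp c g * letter up bar =
  (p%:C%C - (-1) ^+ (up (+) bar) * ('i%C * q%:C%C))
    *: (letter up (~~ bar) * hgrp c g).
Proof.
move=> pq1 gE; rewrite /coordinate z_E zbarE zetaE zetabarE.
case: up; rewrite ?(fun_if (fun a => _ * a)) ?grp_cov ?grp_vec gE ?invmx_ref //;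
  rewrite cplx_mat2 ?mul_row2_mat2 ?mul_mat2_col2.
- case: bar; rewrite -scaleAl_H -hcovZ scale_row2 /=;
  by congr (hcov _ _ (row2 _ _) * _); rewrite ?rmorphN /=; ring: ii.
- case: bar; rewrite -scaleAl_H -hvecZ scale_col2 /=;
  by congr (hvec _ _ (col2 _ _) * _); rewrite ?rmorphN /=; field: ii.
Qed.

(** The number exp(2 i t) for the angle t of alpha_j: the reflection s_j
    exchanges the coordinate lines of z and zbar with the factors w_j and
    its conjugate wb_j. *)
Definition w_ (j : 'I_m) : C :=
  (cos (angle R j *+ 2))%:C%C + 'i%C * (sin (angle R j *+ 2))%:C%C.
Definition wb_ (j : 'I_m) : C :=
  (cos (angle R j *+ 2))%:C%C - 'i%C * (sin (angle R j *+ 2))%:C%C.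

Lemma w_wb j : w_ j * wb_ j = 1.
Proof.
have := congr1 (real_complex R) (cos2Dsin2 (angle R j *+ 2)).
rewrite rmorphD !rmorphXn rmorph1 /= => <-.
by rewrite /w_ /wb_; ring: ii.
Qed.

Lemma s_letter j up bar :
  hgrp c (s_ R j) * letter up bar =
  (if up (+) bar then w_ j else wb_ j) *:
    (letter up (~~ bar) * hgrp c (s_ R j)).
Proof.
rewrite (@ref_letter (s_ R j) _ _ up bar _ (reflectionE R j)); last first.
  by rewrite -!expr2 cos2Dsin2.
by case: (up (+) bar); congr (_ *: _); rewrite /w_ /wb_ ?expr0 ?expr1; ring.
Qed.

Lemma letter_s j up bar :
  letter up bar * hgrp c (s_ R j) =
  (if up (+) bar then w_ j else wb_ j) *:
    (hgrp c (s_ R j) * letter up (~~ bar)).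
Proof.
rewrite s_letter negbK scalerA; case: up; case: bar => /=;
by rewrite ?[wb_ j * _]mulrC w_wb scale1r.
Qed.

(** The twisted versions of sigma that appear in [zetabar, z] and [zeta,
    zbar], and when sigma moves past a coordinate. *)
Definition tau : H := \sum_(j < m) (c (reflection R j) * w_ j) *: hgrp c (s_ R j).
Definition taub : H :=
  \sum_(j < m) (c (reflection R j) * wb_ j) *: hgrp c (s_ R j).

Lemma sg_letter up bar :
  sg * letter up bar = letter up (~~ bar) * (if up (+) bar then tau else taub).
Proof.
rewrite /sigma mulr_suml (fun_if (fun a => _ * a)) !mulr_sumr.
case E: (up (+) bar); apply: eq_bigr => j _;
by rewrite scaleAl_H scaleAr_H s_letter E scalerA.
Qed.

Lemma letter_sg up bar :
  letter up bar * sg = (if up (+) bar then tau else taub) * letter up (~~ bar).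
Proof.
rewrite /sigma mulr_sumr (fun_if (fun a => a * _)) !mulr_suml.
case E: (up (+) bar); apply: eq_bigr => j _;
by rewrite scaleAl_H scaleAr_H letter_s E scalerA.
Qed.

(** With a_j in coordinates, the products of pairings <x', alpha_j><a_j,
    xi'> are 1/2, - w_j/2 or - wb_j/2, by the double angle formulas. *)
Lemma letter_comm bar bar' :
  letter false bar * letter true bar' = letter true bar' * letter false bar +
    (if bar == bar' then 1 - sg else if bar then tau else taub).
Proof.
have trig j : exists co si : C, [/\ co * co = 1 - si * si,
    cplx (alpha_ R j) = col2 si (- co) & cplx (a_ R j) = row2 si (- co)]
    /\ w_ j = (co + 'i%C * si) * (co + 'i%C * si)
    /\ wb_ j = (co - 'i%C * si) * (co - 'i%C * si) :> C.
  exists (cos (angle R j))%:C%C, (sin (angle R j))%:C%C.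
  have := congr1 (real_complex R) (cos2Dsin2 (angle R j)).
  rewrite rmorphD !rmorphXn rmorph1 /= => cs.
  rewrite alphaE aE cplx_row2 cplx_col2 !rmorphN /w_ /wb_ cos_mulr2n sin_mulr2n.
  rewrite rmorphB !rmorphMn /= rmorphXn rmorphM rmorph1 /=.
  move: cs; set co := (cos _)%:C%C; set si := (sin _)%:C%C => cs.
  have co2 : co * co = 1 - si * si by rewrite -cs; ring.
  by split; [split|split]; rewrite //; ring: ii co2.
case: bar; case: bar'; rewrite /coordinate ?z_E ?zbarE ?zetaE ?zetabarE vec_cov;
  rewrite -addrA; congr (_ + _); rewrite {1}/pairing mul_row2_col2 /=.
- congr (_ - _).
    by rewrite -[RHS]scale1r; congr (_ *: _); field: ii.
  rewrite /sigma scaler_sumr; apply: eq_bigr => j _; rewrite scalerA.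
  have [co [si [[co2 -> ->] _]]] := trig j; rewrite /pairing !mul_row2_col2.
  by congr (_ *: _); field: ii co2.
- rewrite -[RHS]add0r; congr (_ + _).
    by rewrite -[RHS](scale0r (1 : H)); congr (_ *: _); field: ii.
  rewrite /tau scaler_sumr -sumrN; apply: eq_bigr => j _.
  rewrite scalerA -scaleNr.
  have [co [si [[co2 -> ->] [-> _]]]] := trig j; rewrite /pairing !mul_row2_col2.
  by congr (_ *: _); field: ii co2.
- rewrite -[RHS]add0r; congr (_ + _).
    by rewrite -[RHS](scale0r (1 : H)); congr (_ *: _); field: ii.
  rewrite /taub scaler_sumr -sumrN; apply: eq_bigr => j _.
  rewrite scalerA -scaleNr.
  have [co [si [[co2 -> ->] [_ ->]]]] := trig j; rewrite /pairing !mul_row2_col2.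
  by congr (_ *: _); field: ii co2.
- congr (_ - _).
    by rewrite -[RHS]scale1r; congr (_ *: _); field: ii.
  rewrite /sigma scaler_sumr; apply: eq_bigr => j _; rewrite scalerA.
  have [co [si [[co2 -> ->] _]]] := trig j; rewrite /pairing !mul_row2_col2.
  by congr (_ *: _); field: ii co2.
Qed.

Lemma letterC up bar bar' :
  letter up bar * letter up bar' = letter up bar' * letter up bar.
Proof.
by case: up; case: bar; case: bar';
  rewrite /coordinate ?z_E ?zbarE ?zetaE ?zetabarE 1?covC 1?vecC.
Qed.

End Cherednik.

(** * Linear spans *)

Section LinearSpan.
Variables (K : pzRingType) (V : lmodType K).

Inductive lspan (S : V -> Prop) : V -> Prop :=
  | lspan0 : lspan S 0
  | lspan_cons k a b : S a -> lspan S b -> lspan S (k *: a + b).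

Lemma lspan_lin S k a b : lspan S a -> lspan S b -> lspan S (k *: a + b).
Proof.
move=> Sa Sb; elim: Sa => {a} [|l a a' Sa _ IH]; first by rewrite scaler0 add0r.
by rewrite scalerDr -addrA scalerA; apply: lspan_cons.
Qed.

Lemma lspan_gen (S : V -> Prop) a : S a -> lspan S a.
Proof.
move=> Sa; rewrite -[a]addr0 -[X in X + _]scale1r.
by apply: lspan_cons => //; apply: lspan0.
Qed.

Lemma lspanD S a b : lspan S a -> lspan S b -> lspan S (a + b).
Proof. by rewrite -{2}[a]scale1r; apply: lspan_lin. Qed.
Lemma lspanZ S k a : lspan S a -> lspan S (k *: a).
Proof. by move=> Sa; rewrite -[_ *: _]addr0; apply: lspan_lin (lspan0 S). Qed.
Lemma lspanN S a : lspan S a -> lspan S (- a).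
Proof. by rewrite -scaleN1r; apply: lspanZ. Qed.
Lemma lspanB S a b : lspan S a -> lspan S b -> lspan S (a - b).
Proof. by move=> Sa Sb; apply: lspanD (lspanN Sb). Qed.

Lemma lspan_sum S (I : Type) (r : seq I) (F : I -> V) :
  (forall i, lspan S (F i)) -> lspan S (\sum_(i <- r) F i).
Proof.
by move=> SF; elim/big_ind: _ => // *; [exact: lspan0 | exact: lspanD].
Qed.

Lemma lspan_least (S P : V -> Prop) :
    P 0 -> (forall k a b, P a -> P b -> P (k *: a + b)) ->
  (forall a, S a -> P a) -> forall a, lspan S a -> P a.
Proof. by move=> P0 PL SP a; elim=> // k x y /SP Px _; apply: PL. Qed.

End LinearSpan.

Section LinearSpanMap.
Variables (K : pzRingType) (V W : lmodType K).

Lemma lspan_map (S : V -> Prop) (S' : W -> Prop) (f : V -> W) :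
    (forall k a b, f (k *: a + b) = k *: f a + f b) ->
  (forall a, S a -> lspan S' (f a)) -> forall a, lspan S a -> lspan S' (f a).
Proof.
move=> fL SS' a; apply: (lspan_least (P := fun a => lspan S' (f a))) => //.
- have f0 : f 0 = 0 by have := fL (-1) 0 0; rewrite !scaleN1r !addNr.
  by rewrite f0; apply: lspan0.
- by move=> k x y Sx Sy; rewrite fL; apply: lspan_lin.
Qed.

End LinearSpanMap.

(** * The sl(2)-triple *)

Section SL2.
Variables (R : realType) (m : nat) (c : 'M[R]_2 -> R[i]).
Local Notation C := R[i].
Local Notation H := (cherednik m c).
Local Notation z := (z_ m c).
Local Notation zb := (zbar m c).
Local Notation ze := (zeta m c).
Local Notation zeb := (zetabar m c).
Local Notation sg := (sigma m c).
Local Notation tau := (tau m c).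
Local Notation taub := (taub m c).
Local Notation letter := (coordinate m c).

Definition ad (a x : H) : H := a * x - x * a.

Lemma ad_lin a k x y : ad a (k *: x + y) = k *: ad a x + ad a y.
Proof. by rewrite /ad !expandE; lin C H. Qed.
Lemma ad0 a : ad a 0 = 0. Proof. by rewrite /ad mulr0 mul0r subrr. Qed.
Lemma adD a x y : ad a (x + y) = ad a x + ad a y.
Proof. by have := ad_lin a 1 x y; rewrite !scale1r. Qed.
Lemma adZ a k x : ad a (k *: x) = k *: ad a x.
Proof. by have := ad_lin a k x 0; rewrite ad0 !addr0. Qed.
Lemma adN a x : ad a (- x) = - ad a x.
Proof. by rewrite -scaleN1r adZ scaleN1r. Qed.
Lemma ad_mul a x y : ad a (x * y) = ad a x * y + x * ad a y.
Proof. rewrite /ad !expandE. lin C H. Qed.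
Lemma ad_opp a b : ad a b = - ad b a.
Proof. by rewrite /ad opprB. Qed.
Lemma ad_commute a x : a * x = x * a -> ad a x = 0.
Proof. by move=> ax; rewrite /ad ax subrr. Qed.
Lemma ad_mull a b x : ad (a * b) x = a * ad b x + ad a x * b.
Proof. by rewrite /ad !expandE; lin C H. Qed.
Lemma ad_ad a b x : ad (ad a b) x = ad a (ad b x) - ad b (ad a x).
Proof. by rewrite /ad !expandE; lin C H. Qed.

(** Up to the scalar factors of E_+ and E_-, which do not change what
    commutes with them; the signs of e_op and f_op are normalised so that
    letters go to letters. *)
Definition E_up : H := z * zb.
Definition E_down : H := ze * zeb.
Definition h_elt : H := ad E_down E_up.
Definition e_op (x : H) : H := ad x E_up.
Definition f_op (x : H) : H := ad E_down x.

(** The angular momentum operator: it generates, together with G, the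
    invariants of sl(2). *)
Definition angular : H := zb * zeb - z * ze.

Lemma ad_letter_down_up bar bar' :
  ad (letter false bar) (letter true bar') =
  if bar == bar' then 1 - sg else if bar then tau else taub.
Proof. by rewrite /ad letter_comm addrC addrA addNr add0r. Qed.

Lemma e_up bar : e_op (letter true bar) = 0.
Proof.
rewrite /e_op /E_up ad_mul.
rewrite -[z]/(letter true false) -[zb]/(letter true true).
by rewrite !(ad_commute (letterC _ _ _ _ _)) mul0r mulr0 addr0.
Qed.

(** The corrections from the reflections cancel: the commutator of zeta with
    z zbar is (1 - sigma) zbar + z taub, and z taub = sigma zbar. *)
Lemma e_down bar : e_op (letter false bar) = letter true (~~ bar).
Proof.
rewrite /e_op /E_up ad_mul.
rewrite -[z]/(letter true false) -[zb]/(letter true true) !ad_letter_down_up.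
have := letter_sg m c true false; have := sg_letter m c true true.
by case: bar => /= E1 E2; rewrite !expandE -?E1 -?E2; lin C H.
Qed.

Lemma f_down bar : f_op (letter false bar) = 0.
Proof.
rewrite /f_op /E_down ad_mull.
rewrite -[ze]/(letter false false) -[zeb]/(letter false true).
by rewrite !(ad_commute (letterC _ _ _ _ _)) mul0r mulr0 addr0.
Qed.

Lemma f_up bar : f_op (letter true bar) = letter false (~~ bar).
Proof.
rewrite /f_op /E_down ad_mull.
rewrite -[ze]/(letter false false) -[zeb]/(letter false true) !ad_letter_down_up.
have := letter_sg m c false false; have := sg_letter m c false true.
by case: bar => /= E1 E2; rewrite !expandE -?E1 -?E2; lin C H.
Qed.

Lemma e_f x : e_op (f_op x) - f_op (e_op x) = ad h_elt x.
Proof.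
by rewrite /e_op /f_op !(ad_opp _ E_up) /h_elt ad_ad adN; lin C H.
Qed.

End SL2.

#[local] Arguments coordinate : simpl never.

(** * The invariants of sl(2) *)

Section Invariants.
Variables (R : realType) (m : nat) (c : 'M[R]_2 -> R[i]).
Local Notation C := R[i].
Local Notation H := (cherednik m c).
Local Notation z := (z_ m c).
Local Notation zb := (zbar m c).
Local Notation ze := (zeta m c).
Local Notation zeb := (zetabar m c).
Local Notation grp := (@hgrp R m c).
Local Notation letter := (coordinate m c).
Local Notation h := (h_elt m c).
Local Notation A := (E_up m c).
Local Notation B := (E_down m c).
Local Notation M := (angular m c).
Local Notation e := (@e_op R m c).
Local Notation f := (@f_op R m c).

Lemma grp_mul g k : exists l, grp g * grp k = grp l.
Proof.
by exists (gmul g k); rewrite -presM; apply/pres_relE/cherednik_grpM.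
Qed.

Lemma grp_one : exists g, (1 : H) = grp g.
Proof. by exists (gid R m); apply/esym/pres_relE/cherednik_grp1. Qed.

Lemma grp_letter (g : dihedral m) up bar :
  exists k bar', grp g * letter up bar = k *: (letter up bar' * grp g).
Proof.
have [p q pq1 gE|p q pq1 gE] := dihedral_isometry (set_mem (valP g)).
  by rewrite (rot_letter c up bar pq1 gE); do 2!eexists.
by rewrite (ref_letter c up bar pq1 gE); do 2!eexists.
Qed.

Definition word (s : seq (bool * bool)) : H :=
  foldr (fun l x => letter l.1 l.2 * x) 1 s.

Definition weight (s : seq (bool * bool)) : int :=
  \sum_(l <- s) (if l.1 then 1 else -1).

Lemma word_cat s t : word (s ++ t) = word s * word t.
Proof. by elim: s => [|l s IH] /=; rewrite ?mul1r // IH mulrA. Qed.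

Lemma weight_cons l s : weight (l :: s) = (if l.1 then 1 else -1) + weight s.
Proof. exact: big_cons. Qed.
Lemma weight_cat s t : weight (s ++ t) = weight s + weight t.
Proof. exact: big_cat. Qed.
Lemma weight_perm s t : perm_eq s t -> weight s = weight t.
Proof. exact: perm_big. Qed.

Lemma grp_word (g : dihedral m) s :
  exists k t, [/\ size t = size s, weight t = weight s &
    grp g * word s = k *: (word t * grp g)].
Proof.
elim: s => [|[up bar] s [k [t [st wt E]]]].
  by exists 1, [::]; split; rewrite //= mulr1 mul1r scale1r.
have [k' [bar' E']] := grp_letter g up bar.
exists (k' * k), ((up, bar') :: t); split; rewrite /= ?st ?weight_cons ?wt //.
by rewrite mulrA E' scaleAl_H -mulrA E scaleAr_H scalerA mulrA.
Qed.

(** Modulo this span the letters of a word of length n commute (perm_lower);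
    sorting words in this way takes the place of a basis of H. *)
Definition lower (n : nat) (w : int) : H -> Prop :=
  lspan (fun x => exists s g, [/\ (size s < n)%N, weight s = w &
                                  x = word s * grp g]).

Lemma word_lower s n : (size s < n)%N -> lower n (weight s) (word s).
Proof.
move=> sn; apply: lspan_gen; have [g E] := grp_one.
by exists s, g; rewrite -E mulr1.
Qed.

Lemma letter_lower n w up bar x : lower n w x ->
  lower n.+1 ((if up then 1 else -1) + w) (letter up bar * x).
Proof.
move: x; apply: lspan_map => [k a b|_ [s [g [sn sw ->]]]]; first by rewrite !expandE.
apply: lspan_gen; exists ((up, bar) :: s), g; split=> //=.
  by rewrite weight_cons sw.
by rewrite mulrA.
Qed.

Lemma grp_lower n w g x : lower n w x -> lower n w (grp g * x).
Proof.
move: x; apply: lspan_map => [k a b|_ [s [g' [sn sw ->]]]]; first by rewrite !expandE.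
have [k [t [st wt E]]] := grp_word g s; have [l E'] := grp_mul g g'.
rewrite mulrA E scaleAl_H -mulrA E'; apply/lspanZ/lspan_gen.
by exists t, l; rewrite st wt.
Qed.

(** The commutator of two letters lies in the group algebra, so that
    swapping them loses two letters and keeps the weight. *)
Lemma swap_lower l l' s : lower (size s).+2 (weight (l :: l' :: s))
  (word (l :: l' :: s) - word (l' :: l :: s)).
Proof.
have sums F : lower (size s).+2 (weight s)
    ((\sum_(j < m) F j *: grp (s_ R j)) * word s).
  rewrite mulr_suml; apply: lspan_sum => j; rewrite scaleAl_H; apply: lspanZ.
  by apply: grp_lower; apply: word_lower; rewrite ltnW.
have diff bar bar' : lower (size s).+2 (weight s)
    ((letter false bar * letter true bar' -
      letter true bar' * letter false bar) * word s).
  rewrite letter_comm [_ + (if _ then _ else _)]addrC addrK.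
  case: eqP => _; last by case: bar; apply: sums.
  rewrite mulrBl mul1r; apply: lspanB; last exact: sums.
  by apply: word_lower; rewrite ltnW.
rewrite /= !mulrA -mulrBl !weight_cons !addrA.
case: l l' => [[] bar] [[] bar'] /=.
- by rewrite letterC subrr mul0r; apply: lspan0.
- by rewrite subrr add0r -opprB mulNr; apply: lspanN; apply: diff.
- by rewrite addNr add0r; apply: diff.
- by rewrite letterC subrr mul0r; apply: lspan0.
Qed.

Lemma perm_lower s t : perm_eq s t ->
  lower (size s) (weight s) (word s - word t).
Proof.
elim: s t => [t|l s IH t pst].
  by rewrite perm_sym => /perm_nilP ->; rewrite subrr; apply: lspan0.
have lt : l \in t by rewrite -(perm_mem pst) mem_head.
case/splitPr: lt pst => t1 t2 pst.
have ps : perm_eq s (t1 ++ t2).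
  by rewrite -(perm_cons l) (perm_trans pst) // (perm_catCA t1 [:: l] t2) perm_refl.
have front r1 : lower (size (l :: r1 ++ t2)) (weight (l :: r1 ++ t2))
    (word (l :: r1 ++ t2) - word (r1 ++ l :: t2)).
  elim: r1 => [|l' r1 IHr] /=; first by rewrite subrr; apply: lspan0.
  rewrite -(subrKA (word (l' :: l :: r1 ++ t2))); apply: lspanD.
    exact: swap_lower.
  rewrite !weight_cons addrCA -weight_cons /= -mulrBr.
  by apply: letter_lower.
rewrite -(subrKA (word (l :: t1 ++ t2))); apply: lspanD.
  by rewrite weight_cons /= -mulrBr; apply: letter_lower; apply: IH.
have E : perm_eq (l :: s) (l :: t1 ++ t2) by rewrite perm_cons.
by rewrite (perm_size E) (weight_perm E); apply: front.
Qed.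

Lemma f_lin k x y : f (k *: x + y) = k *: f x + f y.
Proof. exact: ad_lin. Qed.

Lemma f_mul x y : f (x * y) = f x * y + x * f y.
Proof. exact: ad_mul. Qed.

Lemma f_word_cons l s : f (word (l :: s)) =
  (if l.1 then word ((false, ~~ l.2) :: s) else 0) + letter l.1 l.2 * f (word s).
Proof.
rewrite /= f_mul; case: l => [[] bar] /=; first by rewrite f_up.
by rewrite f_down mul0r.
Qed.

(** Up to order and shorter words, f acts on a word as a derivation that
    turns each letter z into zetabar and each zbar into zeta; replaced s bar
    collects the terms coming from one of the two letters. *)
Definition replaced (s : seq (bool * bool)) (bar : bool) : H :=
  (count_mem (true, bar) s)%:R *: word ((false, ~~ bar) :: rem (true, bar) s).

Lemma replaced_cons l s bar : lower (size s).+1 (weight (l :: s) - 2)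
  (letter l.1 l.2 * replaced s bar -
   (replaced (l :: s) bar -
    (if l == (true, bar) then word ((false, ~~ bar) :: s) else 0))).
Proof.
rewrite /replaced scaleAr_H.
set x := (true, bar); set y := (false, ~~ bar).
have [xs|nxs] := boolP (x \in s); last first.
  rewrite [count_mem x (_ :: _)]/= (count_memPn nxs) scale0r sub0r.
  case: eqP => [->|_]; last by rewrite scale0r subrr oppr0; apply: lspan0.
  by rewrite addn0 scale1r /= eqxx subrr oppr0; apply: lspan0.
have size_rem : (size s).+1 = size [:: l, y & rem x s].
  by rewrite /= size_rem // prednK // -has_predT; apply/hasP; exists x.
have weight_rem : weight (l :: s) - 2 = weight [:: l, y & rem x s].
  by rewrite !weight_cons (weight_perm (perm_to_rem xs)) weight_cons /=; ring.
have -> : letter l.1 l.2 * word (y :: rem x s) = word [:: l, y & rem x s] by [].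
rewrite size_rem weight_rem [count_mem x (_ :: _)]/=; case: eqP => [lx|/eqP lx].
  rewrite lx [rem x (x :: s)]/= eqxx natrD scalerDl scale1r.
  rewrite [X in _ - X]addrC addKr -scalerBr.
  apply/lspanZ/perm_lower.
  rewrite -[[:: x, y & _]]/([:: x] ++ [:: y] ++ _) perm_catCA perm_cons /=.
  by rewrite perm_sym; apply: perm_to_rem.
rewrite add0n subr0 -scalerBr [rem x (l :: s)]/= (negPf lx).
apply/lspanZ/perm_lower.
by rewrite -[[:: l, y & _]]/([:: l] ++ [:: y] ++ _) perm_catCA perm_refl.
Qed.

Lemma f_word s : lower (size s) (weight s - 2)
  (f (word s) - (replaced s false + replaced s true)).
Proof.
elim: s => [|l s IH].
  rewrite /replaced !scale0r addr0 subr0 /f_op ad_commute ?mulr1 ?mul1r //.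
  exact: lspan0.
rewrite f_word_cons; have := letter_lower l.1 l.2 IH.
have Dw : (if l.1 then 1 else -1) + (weight s - 2) = weight (l :: s) - 2.
  by rewrite weight_cons addrA.
rewrite {}Dw => IHl.
have L0 := replaced_cons l s false; have L1 := replaced_cons l s true.
refine (eq_ind _ (lower _ _) (lspanD (lspanD L0 L1) IHl) _ _).
rewrite (_ : (if l.1 then _ else 0) =
  (if l == (true, false) then word ((false, ~~ false) :: s) else 0) +
  (if l == (true, true) then word ((false, ~~ true) :: s) else 0)); last first.
  by case: l {IHl L0 L1} => [[] []] /=; rewrite ?addr0 ?add0r.
by rewrite !expandE; lin C H.
Qed.

Lemma e_lin k x y : e (k *: x + y) = k *: e x + e y.
Proof. by rewrite /e_op !(ad_opp _ A) ad_lin opprD scalerN. Qed.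

Lemma e_mul x y : e (x * y) = e x * y + x * e y.
Proof. by rewrite /e_op !(ad_opp _ A) ad_mul opprD mulNr mulrN. Qed.

Lemma e0 : e 0 = 0. Proof. by rewrite /e_op ad_opp ad0 oppr0. Qed.
Lemma f0 : f 0 = 0. Proof. exact: ad0. Qed.

Lemma M_letters : M = letter true true * letter false true
                    - letter true false * letter false false.
Proof. by []. Qed.

Lemma e_M : e M = 0.
Proof.
rewrite M_letters -scaleN1r addrC e_lin !e_mul !e_up !e_down /= !mul0r !add0r.
by rewrite scaleN1r (letterC m c true false) addNr.
Qed.

Lemma f_M : f M = 0.
Proof.
rewrite M_letters -scaleN1r addrC f_lin !f_mul !f_up !f_down /= !mulr0 !addr0.
by rewrite scaleN1r (letterC m c false false) addNr.
Qed.

Lemma h_M : ad h M = 0.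
Proof. by rewrite -e_f e_M f_M e0 f0 subrr. Qed.

Lemma grp_pair (g : dihedral m) up :
  grp g * (letter up false * letter up true) =
  letter up false * letter up true * grp g.
Proof.
have norm (p q : R) : p * p + q * q = 1 ->
    (p%:C%C + 'i%C * q%:C%C) * (p%:C%C - 'i%C * q%:C%C) = 1 :> C.
  move=> /(congr1 (real_complex R)); rewrite rmorphD !rmorphM rmorph1 /= => <-.
  by ring: (ii R).
have [p q pq1 gE|p q pq1 gE] := dihedral_isometry (set_mem (valP g)).
  rewrite mulrA (rot_letter c up false pq1 gE) scaleAl_H -mulrA.
  rewrite (rot_letter c up true pq1 gE) scaleAr_H scalerA mulrA -[RHS]scale1r.
  congr (_ *: _); apply: etrans _ (norm _ _ pq1).
  by case: up; rewrite /= ?expr0 ?expr1; ring.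
rewrite mulrA (ref_letter c up false pq1 gE) scaleAl_H -mulrA.
rewrite (ref_letter c up true pq1 gE) scaleAr_H scalerA mulrA.
rewrite (letterC m c up true) -[RHS]scale1r.
congr (_ *: _); apply: etrans _ (norm _ _ pq1).
by case: up; rewrite /= ?expr0 ?expr1; ring.
Qed.

Lemma f_grp g : f (grp g) = 0.
Proof. exact/ad_commute/esym/(grp_pair g false). Qed.
Lemma e_grp g : e (grp g) = 0.
Proof. exact/ad_commute/(grp_pair g true). Qed.
Lemma h_grp g : ad h (grp g) = 0.
Proof.
by rewrite -e_f e_grp f_grp e0 f0 subrr.
Qed.

Lemma h_letter up bar :
  ad h (letter up bar) = (if up then 1 else -1) *: letter up bar.
Proof.
rewrite -e_f; case: up.
  by rewrite f_up e_up e_down negbK f0 subr0 scale1r.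
by rewrite e_down f_up f_down negbK e0 sub0r scaleN1r.
Qed.

Lemma h_word s : ad h (word s) = (weight s)%:~R *: word s.
Proof.
elim: s => [|l s IH].
  by rewrite /weight big_nil mulr0z scale0r ad_commute ?mulr1 ?mul1r.
rewrite weight_cons /= ad_mul h_letter IH !expandE -scalerDl rmorphD /=.
by congr (_ *: _); case: l.1.
Qed.

Lemma h_f x : ad h (f x) = f (ad h x) - 2 *: f x.
Proof.
have -> : - (2 *: f x) = ad (ad h B) x.
  rewrite /E_down -[ze]/(letter false false) -[zeb]/(letter false true).
  rewrite ad_mul !h_letter /f_op /E_down /ad -[ze]/(letter false false).
  by rewrite -[zeb]/(letter false true) !expandE; lin C H.
by rewrite ad_ad /f_op; lin C H.
Qed.

(** Spans the whole algebra of sl2-invariants, by sl2_invariants below. *)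
Definition sl2_inv : H -> Prop :=
  lspan (fun x => exists k g, x = M ^+ k * grp g).

Lemma f_inv x : sl2_inv x -> f x = 0.
Proof.
move: x; apply: lspan_least => [|k a b fa fb|_ [k [g ->]]]; first exact: ad0.
  by rewrite f_lin fa fb scaler0 addr0.
elim: k => [|k IH]; first by rewrite expr0 mul1r f_grp.
by rewrite exprS -mulrA f_mul f_M IH mul0r mulr0 addr0.
Qed.

Lemma e_inv x : sl2_inv x -> e x = 0.
Proof.
move: x; apply: lspan_least => [|k a b fa fb|_ [k [g ->]]].
- exact: e0.
- by rewrite e_lin fa fb scaler0 addr0.
elim: k => [|k IH]; first by rewrite expr0 mul1r e_grp.
by rewrite exprS -mulrA e_mul e_M IH mul0r mulr0 addr0.
Qed.

Lemma h_inv x : sl2_inv x -> ad h x = 0.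
Proof.
move=> Ix; rewrite -e_f (e_inv Ix) (f_inv Ix).
by rewrite e0 f0 subrr.
Qed.

Lemma M_inv x : sl2_inv x -> sl2_inv (M * x).
Proof.
move: x; apply: lspan_map => [k a b|_ [k [g ->]]].
  by rewrite mulrDr scaleAr_H.
by apply: lspan_gen; exists k.+1, g; rewrite exprS mulrA.
Qed.

Lemma inv_grp g x : sl2_inv x -> sl2_inv (x * grp g).
Proof.
move: x; apply: lspan_map => [k a b|_ [k [g' ->]]]; first by rewrite !expandE.
have [l E] := grp_mul g' g.
by apply: lspan_gen; exists k, l; rewrite -mulrA E.
Qed.

(** A decomposition that complete reducibility would give for every x of
    weight zero. Elements that split form a subspace stable under M and G,
    and words are treated one by one. *)
Definition splits (x : H) : Prop :=
  exists i y, [/\ sl2_inv i, ad h y = 2 *: y & x = i + f y].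

Lemma splits_lin k x y : splits x -> splits y -> splits (k *: x + y).
Proof.
move=> [i [u [Ii hu ->]]] [j [v [Ij hv ->]]].
exists (k *: i + j), (k *: u + v); split; first exact: lspan_lin.
  by rewrite ad_lin hu hv; lin C H.
by rewrite f_lin; lin C H.
Qed.

Lemma splits0 : splits 0.
Proof.
exists 0, 0; split; first exact: lspan0.
  by rewrite ad0 scaler0.
by rewrite f0 addr0.
Qed.

Lemma splitsZ k x : splits x -> splits (k *: x).
Proof. by move=> Tx; rewrite -[_ *: _]addr0; apply: splits_lin splits0. Qed.
Lemma splitsD x y : splits x -> splits y -> splits (x + y).
Proof. by rewrite -{2}[x]scale1r; apply: splits_lin. Qed.
Lemma splitsB x y : splits x -> splits y -> splits (x - y).
Proof. by move=> Tx Ty; rewrite -scaleN1r addrC; apply: splits_lin. Qed.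
Lemma splitsZV k x : k != 0 -> splits (k *: x) -> splits x.
Proof. by move=> k0 /(splitsZ k^-1); rewrite scalerA mulVf ?scale1r. Qed.

Lemma splits_M x : splits x -> splits (M * x).
Proof.
move=> [i [y [Ii hy ->]]]; exists (M * i), (M * y); split; first exact: M_inv.
  by rewrite ad_mul h_M hy mul0r add0r scaleAr_H.
by rewrite f_mul f_M mul0r add0r mulrDr.
Qed.

Lemma splits_grp g x : splits x -> splits (x * grp g).
Proof.
move=> [i [y [Ii hy ->]]]; exists (i * grp g), (y * grp g); split.
- exact: inv_grp.
- by rewrite ad_mul h_grp hy mulr0 addr0 scaleAl_H.
- by rewrite f_mul f_grp mulr0 addr0 mulrDl.
Qed.

(** The source of relations: words of weight two give combinations of words
    of weight zero that split. *)
Lemma splits_f y : ad h y = 2 *: y -> splits (f y).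
Proof. by move=> hy; exists 0, y; split; rewrite ?add0r //; apply: lspan0. Qed.

Lemma h_splits x : splits x -> ad h x = 0.
Proof.
move=> [i [y [Ii hy ->]]]; rewrite adD (h_inv Ii) h_f hy /f_op adZ.
by rewrite subrr addr0.
Qed.

Definition mono (i j k l : nat) : seq (bool * bool) :=
  nseq i (true, false) ++ nseq j (true, true) ++
  nseq k (false, false) ++ nseq l (false, true).

Lemma size_mono i j k l : size (mono i j k l) = (i + j + k + l)%N.
Proof. by rewrite !size_cat !size_nseq !addnA. Qed.

Lemma weight_mono i j k l : weight (mono i j k l) = i%:Z + j%:Z - k%:Z - l%:Z.
Proof.
by rewrite !weight_cat /weight !big_nseq !iter_addr_0 /= !mulNrn; lia.
Qed.

Lemma perm_rem (x : bool * bool) s t : perm_eq s (x :: t) -> perm_eq (rem x s) t.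
Proof.
move=> st; rewrite -(perm_cons x) -(permPr st) perm_sym; apply: perm_to_rem.
by rewrite (perm_mem st) mem_head.
Qed.

Lemma perm_mono s :
  perm_eq s (mono (count_mem (true, false) s) (count_mem (true, true) s)
                  (count_mem (false, false) s) (count_mem (false, true) s)).
Proof.
apply/allP => x _; apply/eqP; rewrite !count_cat !count_nseq.
by case: x => [[] []] /=; lia.
Qed.

Section Degree.
Variable q : nat.
Hypothesis splits_lower : forall x, lower q.*2 0 x -> splits x.

Lemma splits_perm s t :
  size s = q.*2 -> weight s = 0 -> perm_eq s t -> splits (word s) -> splits (word t).
Proof.
move=> sq sw st Ts; rewrite -[word t](subKr (word s)); apply: splitsB => //.
by apply: splits_lower; rewrite -sq -sw; apply: perm_lower.
Qed.

Lemma replaced_mono s t bar : size s = q.*2 -> weight s = 2 ->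
    perm_eq s ((true, bar) :: t) ->
  splits (replaced s bar -
     (count_mem (true, bar) s)%:R *: word ((false, ~~ bar) :: t)).
Proof.
move=> sq sw st; rewrite /replaced -scalerBr; apply: splitsZ.
have xs : (true, bar) \in s by rewrite (perm_mem st) mem_head.
have lw : lower q.*2 0 (word ((false, ~~ bar) :: rem (true, bar) s) -
                        word ((false, ~~ bar) :: t)).
  have -> : q.*2 = size ((false, ~~ bar) :: rem (true, bar) s).
    by rewrite -sq /= size_rem // prednK // -has_predT; apply/hasP; exists (true, bar).
  have -> : 0 = weight ((false, ~~ bar) :: rem (true, bar) s).
    by move: sw; rewrite (weight_perm (perm_to_rem xs)) !weight_cons /=; lia.
  by apply: perm_lower; rewrite perm_cons; apply: perm_rem.
exact: splits_lower.
Qed.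

(** The image under f of the word z^i zbar^j zeta^k zetabar^l of weight two
    is i z^(i-1) zbar^j zeta^k zetabar^(l+1) + j z^i zbar^(j-1) zeta^(k+1)
    zetabar^l modulo shorter words. *)
Lemma chain i j k l : (i + j)%N = q.+1 -> (k + l).+1 = q ->
  splits (i%:R *: word (mono i.-1 j k l.+1) + j%:R *: word (mono i j.-1 k.+1 l)).
Proof.
move=> ij kl; set s := mono i j k l.
have sq : size s = q.*2 by rewrite size_mono; lia.
have sw : weight s = 2 by rewrite weight_mono; lia.
have Ts : splits (replaced s false + replaced s true).
  rewrite -[X in splits X](subKr (f (word s))); apply: splitsB.
    by apply: splits_f; rewrite h_word sw.
  by apply: splits_lower; have := f_word s; rewrite sq sw subrr.
have counts : count_mem (true, false) s = i /\ count_mem (true, true) s = j.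
  by rewrite !count_cat !count_nseq /=; lia.
have T0s : splits (replaced s false - i%:R *: word (mono i.-1 j k l.+1)).
  case: i @s ij sq sw Ts counts => [|i] s ij sq sw Ts [ci cj].
    by rewrite /replaced ci !scale0r subrr; apply: splits0.
  have E : perm_eq s ((true, false) :: mono i j k l) by rewrite perm_refl.
  have := replaced_mono sq sw E; rewrite ci => T1.
  rewrite -(subrKA (i.+1%:R *: word ((false, true) :: mono i j k l))).
  apply: splitsD => //; rewrite -scalerBr; apply: splitsZ; apply: splits_lower.
  have -> : q.*2 = size ((false, true) :: mono i j k l).
    by rewrite /= size_mono; lia.
  have -> : 0 = weight ((false, true) :: mono i j k l).
    by rewrite weight_cons weight_mono /=; lia.
  apply: perm_lower; apply/permP => a.
  by rewrite /= !count_cat !count_nseq; lia.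
have T1s : splits (replaced s true - j%:R *: word (mono i j.-1 k.+1 l)).
  case: j @s ij sq sw Ts counts {T0s} => [|j] s ij sq sw Ts [ci cj].
    by rewrite /replaced cj !scale0r subrr; apply: splits0.
  have E : perm_eq s ((true, true) :: mono i j k l).
    by apply/permP => a; rewrite /= !count_cat !count_nseq; lia.
  have := replaced_mono sq sw E; rewrite cj => T1.
  rewrite -(subrKA (j.+1%:R *: word ((false, false) :: mono i j k l))).
  apply: splitsD => //; rewrite -scalerBr; apply: splitsZ; apply: splits_lower.
  have -> : q.*2 = size ((false, false) :: mono i j k l).
    by rewrite /= size_mono; lia.
  have -> : 0 = weight ((false, false) :: mono i j k l).
    by rewrite weight_cons weight_mono /=; lia.
  apply: perm_lower; apply/permP => a.
  by rewrite /= !count_cat !count_nseq; lia.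
have := splitsB (splitsB Ts T0s) T1s; set u := replaced s false; set v := replaced s true.
by rewrite (_ : _ - _ = i%:R *: word (mono i.-1 j k l.+1) +
   j%:R *: word (mono i j.-1 k.+1 l)) //; lin C H.
Qed.

(** The sorted words of weight zero and length 2q. The relations in chain
    link (p, k) to (p + 1, k + 1), so that p - k is constant along a chain
    of relations. *)
Definition balanced p k : H := word (mono p (q - p) k (q - k)).

Lemma balanced_chain p k : (p <= q)%N -> (k < q)%N ->
  splits (p.+1%:R *: balanced p k + (q - p)%:R *: balanced p.+1 k.+1).
Proof.
move=> pq kq.
have := @chain p.+1 (q - p) k (q - k).-1; rewrite prednK ?subn_gt0 //.
by move=> chain_pk; rewrite /balanced !subnS; apply: chain_pk; lia.
Qed.

Lemma natC_neq0 n : n.+1%:R != 0 :> C. Proof. by rewrite pnatr_eq0. Qed.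

(** The relation that precedes (0, k) in its chain, for k > 0, has a
    vanishing coefficient; this starts an induction upwards. *)
Lemma balanced_lt p k : (p < k <= q)%N -> splits (balanced p k).
Proof.
elim: p k => [|p IH] [//|k] /andP[pk kq].
  have := @chain 0 q.+1 k (q - k.+1) erefl; rewrite scale0r add0r.
  move=> Tk; apply: (splitsZV (natC_neq0 q)); rewrite /balanced subn0; apply: Tk.
  by lia.
have pq : (q - p)%:R != 0 :> C by rewrite pnatr_eq0; lia.
apply: (splitsZV pq); rewrite -[X in splits X](addKr (p.+1%:R *: balanced p k)) addrC.
by apply: splitsB; [apply: balanced_chain; lia | apply/splitsZ/IH; lia].
Qed.

(** Here the chain stops at p = q, and the induction goes downwards from
    there. *)
Lemma balanced_gt p k : (k < p <= q)%N -> splits (balanced p k).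
Proof.
move: {2}(q - p)%N (leqnn (q - p)) => d.
elim: d p k => [|d IH] p k qp /andP[kp pq]; apply: (splitsZV (natC_neq0 p)).
  have := balanced_chain pq (leq_trans kp pq).
  by rewrite (_ : (q - p)%N = 0%N) ?scale0r ?addr0 //; lia.
rewrite -[X in splits X](addrK ((q - p)%:R *: balanced p.+1 k.+1)).
apply: splitsB; first by apply: balanced_chain; lia.
have [->|pq'] := eqVneq p q; first by rewrite subnn scale0r; apply: splits0.
by apply/splitsZ/IH; lia.
Qed.

Hypothesis splits_shorter : forall p, q = p.+1 -> splits (word (mono 0 p 0 p)).

(** The chain p = k has one more word than relations, as it must, since M ^+
    q is an invariant. The missing relation is M times the shorter word
    zbar^(q-1) zetabar^(q-1), which splits by induction on q; with the first
    relation of the chain it forms a system of determinant - (q + 1). *)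
Lemma splits_diag : (0 < q)%N -> splits (balanced 0 0) /\ splits (balanced 1 1).
Proof.
move=> q0.
have T1 : splits (balanced 0 0 + q%:R *: balanced 1 1).
  by have := @balanced_chain 0 0 (leq0n _) q0; rewrite scale1r subn0.
have T2 : splits (balanced 0 0 - balanced 1 1).
  have := splits_M (splits_shorter (esym (prednK q0))).
  set s := mono 0 _ 0 _ => TM.
  have MsE : M * word s = word [:: (true, true), (false, true) & s] -
                          word [:: (true, false), (false, false) & s].
    by rewrite M_letters mulrBl /= !mulrA.
  have low b : splits (word [:: (true, b), (false, b) & s] - balanced (~~ b) (~~ b)).
    apply: splits_lower.
    have -> : q.*2 = size [:: (true, b), (false, b) & s].
      by rewrite /= size_mono; lia.
    have -> : 0 = weight [:: (true, b), (false, b) & s].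
      by rewrite !weight_cons weight_mono /=; lia.
    apply: perm_lower; apply/permP => a; rewrite /= !count_cat !count_nseq.
    by case: b => /=; move: q0; case: q => // q' _; rewrite ?subn0 ?subn1; nia.
  rewrite (_ : _ - _ = M * word s
      - (word [:: (true, true), (false, true) & s] - balanced 0 0)
      + (word [:: (true, false), (false, false) & s] - balanced 1 1)).
    apply: splitsD; last exact: (low false).
    by apply: splitsB => //; exact: (low true).
  by rewrite MsE; lin C H.
have T11 : splits (balanced 1 1).
  apply: (splitsZV (natC_neq0 q)); rewrite (_ : _ *: _ =
    (balanced 0 0 + q%:R *: balanced 1 1) - (balanced 0 0 - balanced 1 1)).
    exact: splitsB.
  by rewrite -natr1; lin C H.
by split=> //; rewrite -[balanced 0 0](subrK (balanced 1 1)); apply: splitsD.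
Qed.

Lemma splits_balanced p k : (p <= q)%N -> (k <= q)%N -> (0 < q)%N -> splits (balanced p k).
Proof.
move=> pq kq q0; have [lt|gt|->] := ltngtP p k.
- by apply: balanced_lt; rewrite lt.
- by apply: balanced_gt; rewrite gt.
elim: k kq {p pq} => [|p IH] pq; first by have [] := splits_diag q0.
have qp : (q - p)%:R != 0 :> C by rewrite pnatr_eq0; lia.
apply: (splitsZV qp); rewrite -[X in splits X](addKr (p.+1%:R *: balanced p p)) addrC.
by apply: splitsB; [apply: balanced_chain; lia | apply/splitsZ/IH; lia].
Qed.

Lemma splits_word s : size s = q.*2 -> weight s = 0 -> (0 < q)%N -> splits (word s).
Proof.
move=> sq sw q0; have ps := perm_mono s; rewrite perm_sym in ps.
have := perm_size ps; have := weight_perm ps.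
rewrite weight_mono size_mono sw sq => w0 sz.
apply: splits_perm ps _; [by rewrite size_mono; lia | by rewrite weight_mono; lia |].
set i := count_mem _ s; set k := count_mem (false, false) s.
rewrite (_ : mono _ _ _ _ = mono i (q - i) k (q - k)).
  by apply: splits_balanced => //; rewrite /i /k; lia.
by rewrite /i /k; congr mono; lia.
Qed.

End Degree.

(** Strong induction on the length, which is even for a word of weight zero:
    words of length 2q are treated modulo shorter ones. *)
Lemma splits_weight0 n x : lower n 0 x -> splits x.
Proof.
elim: n x => [|n IH]; apply: lspan_least => [|k a b|x [s [g [// + + ->]]]].
1,3: exact: splits0.
1,2: exact: splits_lin.
move=> sn sw.
apply: splits_grp; have [lt|ge] := ltnP (size s) n.
  by apply: IH; rewrite -sw; apply: word_lower.
have [q sq] : exists q, size s = q.*2.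
  exists (count_mem (true, false) s + count_mem (true, true) s)%N.
  have ps := perm_mono s; have := perm_size ps; have := weight_perm ps.
  rewrite weight_mono size_mono sw => w0 sz.
  move: (size s) w0 sz; do 4!move: (count_mem _ s) => ?; clear; lia.
have [q0|q0] := posnP q.
  have [g1 E] := grp_one.
  exists 1, 0; split.
  - by apply: lspan_gen; exists 0%N, g1; rewrite expr0 mul1r.
  - by rewrite ad0 scaler0.
  - by rewrite f0 addr0; move: sq; rewrite q0 => /size0nil ->.
have nE : n = q.*2 by lia.
apply: (@splits_word q) => //; first by rewrite -nE.
move=> p qp; apply: IH.
have -> : 0 = weight (mono 0 p 0 p) by rewrite weight_mono; lia.
by apply: word_lower; rewrite size_mono; lia.
Qed.

Definition all_words : H -> Prop := lspan (fun x => exists s g, x = word s * grp g).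

Lemma letter_words up bar : all_words (letter up bar).
Proof.
have [g E] := grp_one.
by apply: lspan_gen; exists [:: (up, bar)], g; rewrite -E /= !mulr1.
Qed.

Lemma words_mul x y : all_words x -> all_words y -> all_words (x * y).
Proof.
move=> Wx Wy; move: x Wx; apply: lspan_map => [k a b|x [s [g ->]]].
  by rewrite !expandE.
move: y Wy; apply: lspan_map => [k a b|y [t [g' ->]]]; first by rewrite !expandE.
have [k [t' [_ _ E]]] := grp_word g t; have [l E'] := grp_mul g g'.
rewrite -mulrA (mulrA (grp g)) E !scaleAl_H scaleAr_H -mulrA E' mulrA -word_cat.
by apply/lspanZ/lspan_gen; exists (s ++ t'), l.
Qed.

Lemma hcov_letters u : hcov m c u =
  ((u 0 0 - 'i%C * u 0 1) / 2) *: letter true false +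
  ((u 0 0 + 'i%C * u 0 1) / 2) *: letter true true.
Proof.
rewrite /coordinate z_E zbarE -[X in _ + X]hcovZ -hcov_lin {1}[u]row2P !scale_row2 add_row2.
by congr (hcov _ _ (row2 _ _)); field: (ii R).
Qed.

Lemma hvec_letters v : hvec m c v =
  (v 0 0 + 'i%C * v 1 0) *: letter false false +
  (v 0 0 - 'i%C * v 1 0) *: letter false true.
Proof.
rewrite /coordinate zetaE zetabarE -[X in _ + X]hvecZ -hvec_lin {1}[v]col2P !scale_col2 add_col2.
by congr (hvec _ _ (col2 _ _)); field: (ii R).
Qed.

Lemma words_span x : all_words x.
Proof.
elim/pres_span: x => [[v|u|g]||k a b|a b].
- rewrite -[pres _ _]/(hvec m c v) hvec_letters.
  by apply: lspan_lin; [|apply: lspanZ]; apply: letter_words.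
- rewrite -[pres _ _]/(hcov m c u) hcov_letters.
  by apply: lspan_lin; [|apply: lspanZ]; apply: letter_words.
- by apply: lspan_gen; exists [::], g; rewrite /= mul1r.
- have [g E] := grp_one.
  by apply: lspan_gen; exists [::], g; rewrite /= mul1r.
- exact: lspan_lin.
- exact: words_mul.
Qed.

Lemma e_iter_mul k l x y :
  iter k e x = 0 -> iter l e y = 0 -> iter (k + l) e (x * y) = 0.
Proof.
have iter_lin n u v : iter n e (u + v) = iter n e u + iter n e v.
  by elim: n => //= n ->; have := e_lin 1 (iter n e u) (iter n e v); rewrite !scale1r.
have iter_0 n : iter n e 0 = 0 by elim: n => //= n ->; apply: e0.
elim: k l x y => [|k IHk] l x y; first by move=> /= -> _; rewrite mul0r iter_0.
elim: l y => [|l IHl] y x0; first by move=> y0; rewrite (_ : y = 0) ?mulr0 ?iter_0.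
move=> y0; rewrite addSn iterSr e_mul iter_lin.
rewrite (IHk l.+1) ?add0r //; last by rewrite -iterSr.
by rewrite addnS -addSn; apply: IHl => //; rewrite -iterSr.
Qed.

(** A derivation that is nilpotent on generators is locally nilpotent. *)
Lemma e_nilpotent x : exists k, iter k e x = 0.
Proof.
have iter_0 n : iter n e 0 = 0 by elim: n => //= n ->; apply: e0.
elim: (words_span x) => {x} [|k a b [s [g ->]] _ [n En]]; first by exists 0%N.
have [n' En'] : exists n, iter n e (word s * grp g) = 0.
  elim: s => [|l s [n1 E1]].
    by exists 1%N; rewrite /= mul1r e_grp.
  exists (2 + n1)%N.
  rewrite -[word (l :: s)]/(letter l.1 l.2 * word s) -mulrA; apply: e_iter_mul => //=.
  by case: l.1; rewrite ?e_down e_up ?e0.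
exists (n' + n)%N.
have iter_lin r u v : iter r e (k *: u + v) = k *: iter r e u + iter r e v.
  by elim: r => //= r ->; rewrite e_lin.
rewrite iter_lin addnC iterD En' iter_0 scaler0 add0r addnC iterD En.
by rewrite iter_0.
Qed.

Lemma h_e x : ad h (e x) = e (ad h x) + 2 *: e x.
Proof.
have -> : 2 *: e x = - ad (ad h A) x.
  rewrite /E_up -[z]/(letter true false) -[zb]/(letter true true).
  rewrite ad_mul !h_letter /e_op /E_up /ad -[z]/(letter true false).
  by rewrite -[zb]/(letter true true) !expandE; lin C H.
by rewrite ad_ad /e_op !(ad_opp _ A) adN; lin C H.
Qed.

(** As e f - f e = ad h, the hypotheses give f e y = - (la + mu) y, so that
    y = 0 as soon as e y = 0. And e y satisfies the same hypotheses, with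
    weight mu + 2, la + mu in place of la, and a smaller power of e that
    kills it; the parameter la, zero in the application, is there for this
    induction. *)
Lemma no_singular n (y : H) (mu la : nat) : (0 < mu)%N ->
    iter n e y = 0 -> ad h y = mu%:R *: y -> e (f y) = - (la%:R *: y) -> y = 0.
Proof.
elim: n y mu la => [//|n IH] y mu la mu0; rewrite iterSr => En hy efy.
have fey : f (e y) = - ((la + mu)%:R *: y).
  have := e_f y; rewrite efy hy => /eqP; rewrite subr_eq addrC -subr_eq => /eqP <-.
  by rewrite natrD; lin C H.
have ey0 : e y = 0.
  apply: (IH _ mu.+2 (la + mu)%N) => //.
    by rewrite h_e hy -[_ *: y]addr0 e_lin e0 -addn2 natrD; lin C H.
  by rewrite fey -scaleNr -[_ *: y]addr0 e_lin e0 addr0 scaleNr.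
move: fey; rewrite ey0 f0 => /esym/eqP; rewrite oppr_eq0 => /eqP lamu.
rewrite -[y]scale1r -(@mulVf _ (la + mu)%:R) -?scalerA ?lamu ?scaler0 //.
by rewrite pnatr_eq0; lia.
Qed.

(** Kills the words whose weights occur in ws, and acts as a non-zero scalar
    on what ad h annihilates if no entry of ws is zero; used to extract
    weight zero without knowing that H is the direct sum of its weight
    spaces. *)
Definition h_shift (ws : seq C) (x : H) : H :=
  foldr (fun w x => ad h x - w *: x) x ws.

Lemma h_shift_lin ws k x y :
  h_shift ws (k *: x + y) = k *: h_shift ws x + h_shift ws y.
Proof. by elim: ws => //= w ws ->; rewrite ad_lin; lin C H. Qed.

Lemma h_shift_swap w ws x :
  h_shift ws (ad h x - w *: x) = ad h (h_shift ws x) - w *: h_shift ws x.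
Proof.
elim: ws => //= v ws ->.
by rewrite -!scaleNr ![ad h _ + _]addrC !ad_lin; lin C H.
Qed.

Lemma h_shift_splits ws x : splits x -> splits (h_shift ws x).
Proof.
by elim: ws => //= w ws IH Tx; rewrite (h_splits (IH Tx)) sub0r -scaleNr; apply/splitsZ/IH.
Qed.

(** Combining the weights of the words of x: those that are not zero are
    removed by h_shift, and the others split. *)
Lemma words_splits x : exists ws, all (fun w => w != 0) ws /\ splits (h_shift ws x).
Proof.
elim: (words_span x) => {x} [|k a b [s [g ->]] _ [ws [ws0 Tws]]].
  by exists [::]; split=> //; apply: splits0.
have [vs [vs0 Tvs]] : exists vs, all (fun w => w != 0) vs /\
    splits (h_shift vs (word s * grp g)).
  have [s0|s0] := eqVneq (weight s) 0.
    exists [::]; split=> //=; apply: splits_grp; apply: (@splits_weight0 (size s).+1).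
    by rewrite -s0; apply: word_lower.
  exists [:: (weight s)%:~R]; rewrite /= intr_eq0 s0; split=> //.
  by rewrite ad_mul h_word h_grp mulr0 addr0 scaleAl_H subrr; apply: splits0.
exists (vs ++ ws); rewrite all_cat vs0 ws0; split=> //.
have catE y : h_shift (vs ++ ws) y = h_shift vs (h_shift ws y).
  by rewrite /h_shift foldr_cat.
have swap y : h_shift vs (h_shift ws y) = h_shift ws (h_shift vs y).
  elim: vs {vs0 Tvs catE} => //= v vs ->; rewrite -h_shift_swap.
  by [].
rewrite h_shift_lin !catE; apply: splits_lin; last exact: h_shift_splits.
by rewrite swap; apply: h_shift_splits.
Qed.

(** An invariant x splits as i + f y with y of weight two. As e kills x and
    i, it kills f y, hence y = 0 by no_singular. *)
Lemma sl2_invariants x : A * x = x * A -> B * x = x * B -> sl2_inv x.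
Proof.
move=> /ad_commute Ax /ad_commute Bx.
have ex : e x = 0 by rewrite /e_op ad_opp Ax oppr0.
have hx : ad h x = 0 by rewrite -e_f ex /f_op Bx ad0 e0 subrr.
have Tx : splits x.
  have [ws [ws0 Tws]] := words_splits x.
  elim: ws ws0 Tws => //= w ws IH /andP[w0 ws0]; rewrite -h_shift_swap hx sub0r.
  rewrite -scaleNr -[_ *: x]addr0 h_shift_lin => Tws; apply: IH => //.
  apply: (@splitsZV (- w)); first by rewrite oppr_eq0.
  have h0 : h_shift ws 0 = 0.
    by elim: ws {ws0 Tws} => //= v ws ->; rewrite ad0 scaler0 subrr.
  by rewrite h0 addr0 in Tws.
have [j [y [Ij hy xE]]] := Tx.
have efy : e (f y) = 0.
  by move: ex; rewrite xE -[j]scale1r e_lin (e_inv Ij) scaler0 add0r.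
have [n En] := e_nilpotent y.
have y0 : y = 0.
  by apply: (@no_singular n y 2 0) => //; rewrite efy scale0r oppr0.
by rewrite xE y0 f0 addr0.
Qed.

End Invariants.

(** * Power series at a regular point *)

Section PowerSeries.
Variable R : realType.
Local Notation C := R[i].

(** Formal power series in two variables, in local coordinates at the point
    (1, 2i) of the complexified plane. No non-zero real linear form vanishes
    there, nor do z and zbar, so that all of them are invertible functions
    near this point. *)
Definition series : Type := nat -> nat -> C^o.
HB.instance Definition _ := GRing.Lmodule.on series.

Implicit Types (p q : series) (u : 'rV[C]_2) (v : 'cV[C]_2).

Definition shx p : series := fun i j => if i is i'.+1 then p i' j else 0.
Definition shy p : series := fun i j => if j is j'.+1 then p i j' else 0.
Definition dx p : series := fun i j => i.+1%:R * p i.+1 j.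
Definition dy p : series := fun i j => j.+1%:R * p i j.+1.

(** The value at (1, 2i) of the linear form u. *)
Definition value u : C := u 0 0 + 2 * 'i%C * u 0 1.
Definition mulform_def u p : series :=
  value u *: p + u 0 0 *: shx p + u 0 1 *: shy p.
Definition dird_def v p : series := v 0 0 *: dx p + v 1 0 *: dy p.

Fixpoint solve_row u (s : nat -> C) (j : nat) : C :=
  if j is j'.+1 then (value u)^-1 * (s j - u 0 1 * solve_row u s j')
  else (value u)^-1 * s 0%N.
Fixpoint divform_def u p (i : nat) : nat -> C^o :=
  solve_row u (if i is i'.+1 then fun j => p i j - u 0 0 * divform_def u p i' j
               else p 0%N).

End PowerSeries.

(** The linear form u is its value at the base point plus its linear part.
    Locking keeps the coefficient formulas out of unification. *)
HB.lock Definition mulform (R : realType) (u : 'rV[R[i]]_2) (p : series R) :=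
  mulform_def u p.
HB.lock Definition dird (R : realType) (v : 'cV[R[i]]_2) (p : series R) :=
  dird_def v p.
HB.lock Definition divform (R : realType) (u : 'rV[R[i]]_2) (p : series R) :
  series R := divform_def u p.

Section PowerSeriesTheory.
Variable R : realType.
Local Notation C := R[i].
Local Notation series := (series R).

Implicit Types (p q : series) (u : 'rV[C]_2) (v : 'cV[C]_2).

Lemma seriesP p q : (forall i j, p i j = q i j) -> p = q.
Proof. by move=> pq; apply/funext => i; apply/funext => j. Qed.

Definition seriesE := (fun p q i j => erefl : (p + q) i j = p i j + q i j :> C,
  fun p i j => erefl : (- p) i j = - p i j :> C,
  fun (k : C) p i j => erefl : (k *: p) i j = k * p i j :> C).

Lemma mulformE u p i j : mulform u p i j =
  value u * p i j + u 0 0 * shx p i j + u 0 1 * shy p i j.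
Proof. by rewrite mulform.unlock. Qed.

Lemma dirdE v p i j : dird v p i j = v 0 0 * dx p i j + v 1 0 * dy p i j.
Proof. by rewrite dird.unlock. Qed.

Lemma mulform_linear u : linear (mulform u).
Proof.
move=> k p q; apply: seriesP => i j; rewrite !(mulformE, seriesE).
by case: i => [|i]; case: j => [|j]; rewrite /= ?seriesE; ring.
Qed.

Lemma dird_linear v : linear (dird v).
Proof.
by move=> k p q; apply: seriesP => i j; rewrite !(dirdE, seriesE) /dx /dy !seriesE; ring.
Qed.

Lemma mulform_linl k u u' p : mulform (k *: u + u') p = k *: mulform u p + mulform u' p.
Proof.
by apply: seriesP => i j; rewrite !(mulformE, seriesE) /value !mxE; ring.
Qed.

Lemma dird_linl k v v' p : dird (k *: v + v') p = k *: dird v p + dird v' p.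
Proof. by apply: seriesP => i j; rewrite !(dirdE, seriesE) !mxE; ring. Qed.

Lemma mulformC u u' p : mulform u (mulform u' p) = mulform u' (mulform u p).
Proof.
apply: seriesP => i j; rewrite !(mulformE, seriesE).
by case: i => [|[|i]]; case: j => [|[|j]]; rewrite /= ?mulformE /=; ring.
Qed.

Lemma dirdC v v' p : dird v (dird v' p) = dird v' (dird v p).
Proof.
by apply: seriesP => i j; rewrite !(dirdE, seriesE) /dx /dy !dirdE /dx /dy; ring.
Qed.

Lemma pairingE u v : pairing u v = u 0 0 * v 0 0 + u 0 1 * v 1 0.
Proof.
by rewrite {1}[u]row2P {1}[v]col2P /pairing mul_row2_col2.
Qed.

Lemma dird_mulform v u p : dird v (mulform u p) = mulform u (dird v p) + pairing u v *: p.
Proof.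
apply: seriesP => i j; rewrite !(dirdE, mulformE, seriesE) /dx /dy !mulformE /=.
rewrite pairingE.
by case: i => [|i]; case: j => [|j]; rewrite /= ?dirdE /dx /dy /=; ring.
Qed.

Lemma mulform_divform u p : value u != 0 -> mulform u (divform u p) = p.
Proof.
move=> u0; apply: seriesP => i j; rewrite mulformE divform.unlock.
by case: i => [|i]; case: j => [|j] /=; field.
Qed.

Lemma mulform_inj u p q : value u != 0 -> mulform u p = mulform u q -> p = q.
Proof.
move=> u0 pq; apply: seriesP; elim=> [|i IHi]; elim=> [|j IHj];
  have := congr1 (fun r : series => r _ _) pq => E; apply: (mulfI u0).
- by have := E 0%N 0%N; rewrite !mulformE /= !mulr0 !addr0.
- by have := E 0%N j.+1; rewrite !mulformE /= IHj !mulr0 !addr0 => /addIr.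
- by have := E i.+1 0%N; rewrite !mulformE /= IHi !mulr0 !addr0 => /addIr.
- by have := E i.+1 j.+1; rewrite !mulformE /= IHi IHj => /addIr/addIr.
Qed.

Lemma divform_mulform u p : value u != 0 -> divform u (mulform u p) = p.
Proof. by move=> u0; apply: (mulform_inj u0); rewrite mulform_divform. Qed.

End PowerSeriesTheory.

(** * Reflections permute the roots *)

Section ReflectionIndices.
Variables (R : realType) (m : nat) (m_gt0 : (0 < m)%N).

(** The index of s_k s_j s_k, which is 2k - j modulo m. Starting the indices
    from 0 instead of 1 does not change the formula, since 2(k + 1) - (j +
    1) = (2k - j) + 1. *)
Definition refl_idx (k j : 'I_m) : 'I_m :=
  Ordinal (ltn_pmod (2 * k + (m - j)) m_gt0).

Lemma refl_idxK k : involutive (refl_idx k).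
Proof.
move=> j; apply: val_inj => /=.
set r := ((2 * k + (m - j)) %% m)%N; set q := ((2 * k + (m - j)) %/ m)%N.
have E : (2 * k + (m - j) = q * m + r)%N := divn_eq _ _.
have lt_r : (r < m)%N by rewrite ltn_pmod.
have lt_j := ltn_ord j.
have -> : (2 * k + (m - r) = q * m + j)%N by lia.
by rewrite modnMDl modn_small.
Qed.

(** The indices are reduced modulo m, hence the angles modulo pi and the
    roots up to sign. *)
Lemma angle_refl_idx (k j : 'I_m) : exists n,
  angle R k *+ 2 - angle R j + pi = angle R (refl_idx k j) + pi *+ n.
Proof.
exists ((2 * k + (m - j)) %/ m)%N.
set r := refl_idx k j; set q := (_ %/ _)%N.
have E : (2 * k + (m - j) = q * m + r)%N := divn_eq _ _.
have E' : 2 * k%:R + (m%:R - j%:R) = q%:R * m%:R + r%:R :> R.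
  by rewrite -natrB ?(ltnW (ltn_ord j)) // -!natrM -!natrD E.
have m0 : m%:R != 0 :> R by rewrite pnatr_eq0 -lt0n.
have rE : r%:R = 2 * k%:R + (m%:R - j%:R) - q%:R * m%:R :> R by rewrite E'; ring.
rewrite /angle -(natr1 r) rE -(mulr_natr pi q) -(mulr_natr _ 2) -!natr1.
by field.
Qed.

Lemma reflect_root (k j : 'I_m) : exists2 eps : R, eps * eps = 1 &
  reflection R k *m alpha_ R j = eps *: alpha_ R (refl_idx k j) /\
  a_ R j *m reflection R k = eps *: a_ R (refl_idx k j).
Proof.
have [n nE] := angle_refl_idx k j.
set t := angle R k *+ 2 - angle R j in nE.
have sE : sin t = - ((-1) ^+ n * sin (angle R (refl_idx k j))).
  by rewrite -(alternatingn (@sinDpi R)) -nE sinDpi opprK.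
have cE : cos t = - ((-1) ^+ n * cos (angle R (refl_idx k j))).
  by rewrite -(alternatingn (@cosDpi R)) -nE cosDpi opprK.
move: sE cE; rewrite /t sinB cosB => sE cE.
exists ((-1) ^+ n); first by rewrite -expr2 sqrr_sign.
rewrite !alphaE !aE reflectionE mul_mat2_col2 mul_row2_mat2 scale_row2 scale_col2.
move: sE cE; set e := (-1) ^+ n; set s := sin (angle R (refl_idx k j)).
set c := cos (angle R (refl_idx k j)) => sE cE.
have es : e * s = - (sin (angle R k *+ 2) * cos (angle R j) -
                     cos (angle R k *+ 2) * sin (angle R j)) by rewrite sE opprK.
have ec : e * - c = cos (angle R k *+ 2) * cos (angle R j) +
                     sin (angle R k *+ 2) * sin (angle R j) by rewrite cE mulrN.
by split; [congr col2|congr row2]; rewrite ?es ?ec; ring.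
Qed.

Definition permutes_roots (g : 'M[R]_2) : Prop :=
  g \in unitmx /\ exists2 f : 'I_m -> 'I_m, injective f & forall j,
  exists2 eps : R, eps * eps = 1 &
    g *m alpha_ R j = eps *: alpha_ R (f j) /\
    a_ R j *m invmx g = eps *: a_ R (f j).

Lemma reflection_unitK (j : 'I_m) : reflection R j *m reflection R j = 1%:M.
Proof.
have := cos2Dsin2 (angle R j *+ 2); rewrite reflectionE mul_mat2 scalar_mat2.
by move=> <-; congr mat2; ring.
Qed.

Lemma invmx_reflection (j : 'I_m) : invmx (reflection R j) = reflection R j.
Proof. exact/invmx_unique/reflection_unitK. Qed.

Lemma dihedral_permutes_roots g : dihedral m g -> permutes_roots g.
Proof.
apply: smallest_sub => {g}; last first.
  move=> _ [k _ <-]; split; first by have [] := mulmx1_unit (reflection_unitK k).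
  exists (refl_idx k); first exact: can_inj (refl_idxK k).
  by move=> j; rewrite invmx_reflection; apply: reflect_root.
split=> [|g h [ug [f fI fE]] [uh [f' fI' fE']]|g [ug [f fI fE]]].
- split; first exact: unitmx1.
  exists id => // j; exists 1; first by rewrite mul1r.
  by rewrite invmx1 mul1mx mulmx1 !scale1r.
- split; first by rewrite unitmx_mul ug.
  exists (f \o f') => [|j]; first exact: inj_comp.
  have [e' e'1 [E1' E2']] := fE' j; have [e e1 [E1 E2]] := fE (f' j).
  exists (e * e'); first by rewrite mulrACA e1 e'1 mulr1.
  rewrite -mulmxA E1' -scalemxAr E1 scalerA mulrC; split=> //.
  have -> : invmx (g *m h) = invmx h *m invmx g.
    by apply: invmx_unique; rewrite mulmxA -(mulmxA g) mulmxV // mulmx1 mulmxV.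
  by rewrite mulmxA E2' -scalemxAl E2 scalerA mulrC.
- split; first by rewrite unitmx_inv.
  have [f' fK f'K] := injF_bij fI.
  exists f' => [|j]; first exact: can_inj f'K.
  have [e e1 [E1 E2]] := fE (f' j); rewrite f'K in E1 E2.
  exists e => //; split.
    by rewrite -[alpha_ R j]scale1r -e1 -scalerA -E1 -scalemxAr mulKmx.
  rewrite invmxK -[a_ R j]scale1r -e1 -scalerA -E2 -scalemxAl.
  by rewrite -mulmxA mulVmx // mulmx1.
Qed.

End ReflectionIndices.

(** * The Dunkl representation *)

Section DunklRepresentation.
Variables (R : realType) (m : nat) (c : 'M[R]_2 -> R[i]).
Hypotheses (m_gt0 : (0 < m)%N) (c_inv : conj_invariant m c).
Local Notation C := R[i].
Local Notation G := (@dihedral R m).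
Local Notation cr j := (c (reflection R j)).
Local Notation refl_idx := (refl_idx m_gt0).

(** The component at h is to be read as the germ at the point h(1, 2i) of a
    function on the regular orbit, pulled back by h. A single germ is not
    stable under the reflections that occur in the Dunkl operators. *)
Definition dunkl_space : Type := G -> series R.
HB.instance Definition _ := GRing.Lmodule.on dunkl_space.

Implicit Types (g h k : G) (F : dunkl_space) (v w : 'cV[C]_2) (u : 'rV[C]_2).

Lemma g_unit g : val g \in unitmx.
Proof. by have [] := dihedral_permutes_roots m_gt0 (set_mem (valP g)). Qed.

Lemma value_real (a : 'rV[R]_2) : a != 0 -> value (cplx a) != 0.
Proof.
apply: contra_neq => /eqP; rewrite /value !mxE eq_complex /= => /andP[/eqP + /eqP].
rewrite [a]row2P !mxE /= => E0 E1.
have a0 : a 0 0 = 0 by lra.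
have a1 : a 0 1 = 0 by lra.
by apply/matrixP => i; rewrite (ord1 i); elim/ord2_ind; rewrite !mxE /= ?a0 ?a1.
Qed.

Lemma root_value h (j : 'I_m) : value (cplx (a_ R j *m val h)) != 0.
Proof.
apply: value_real; apply/eqP => ah0.
have : a_ R j = 0 by rewrite -[a_ R j](mulmxK (g_unit h)) ah0 mul0mx.
rewrite aE => /matrixP E; have := E 0 0; have := E 0 1; rewrite !mxE /=.
move=> /eqP; rewrite oppr_eq0 => /eqP c0 s0.
have := cos2Dsin2 (angle R j); rewrite c0 s0 expr0n addr0 => /eqP.
by rewrite eq_sym oner_eq0.
Qed.

(** The Dunkl operator of v is the derivative plus the sum of c_j <a_j, v>
    s_j / a_j. Usually - (1 - s_j) takes the place of s_j; the two versions
    differ by conjugation with the product of the |a_j|^(c_j), and this one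
    has no terms without reflections besides the derivative. All forms and
    vectors are transported by h^-1 to the common base point. *)
Definition op (x : cherednik_gen R m) (F : dunkl_space) : dunkl_space :=
  match x with
  | Vec v => fun h => dird (cplx (invmx (val h)) *m v) (F h) +
      \sum_j (cr j * pairing (cplx (a_ R j)) v) *:
        divform (cplx (a_ R j *m val h)) (F (gmul (s_ R j) h))
  | Cov u => fun h => mulform (u *m cplx (val h)) (F h)
  | Grp g => fun h => F (gmul (ginv g) h)
  end.

Lemma divform_linear u : value u != 0 -> linear (divform u).
Proof.
move=> u0 k p q; apply: (mulform_inj u0).
by rewrite mulform_linear !mulform_divform.
Qed.

Lemma op_linear x : linear (op x).
Proof.
move=> k F F'; apply/funext => h; case: x => [v|u|g] //=; last exact: mulform_linear.
rewrite -![(_ + _) h]/(_ h + _ h) -![(_ *: _) h]/(_ *: _ h) dird_linear.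
rewrite scalerDr addrACA; congr (_ + _); rewrite scaler_sumr -big_split.
apply: eq_bigr => j _ /=.
by rewrite (divform_linear (root_value h j)) scalerDr !scalerA mulrC.
Qed.

Lemma refl_mul_idx (j k : 'I_m) :
  reflection R (refl_idx j k) = reflection R j *m reflection R k *m reflection R j.
Proof.
have [e e1 [E1 E2]] := reflect_root R m_gt0 j k.
have := reflection_unitK R j.
move: (reflection R j) E1 E2 => s E1 E2 ss.
rewrite /reflection [in RHS]mulmxBr [in RHS]mulmxBl mulmx1 ss.
congr (_ - _); rewrite -scalemxAr -scalemxAl; congr (_ *: _).
rewrite !mulmxA E1 -mulmxA E2 -scalemxAl -scalemxAr scalerA.
by rewrite e1 scale1r.
Qed.

Lemma value_c (j k : 'I_m) : cr (refl_idx k j) = cr j.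
Proof.
have Dk : dihedral m (reflection R k) by apply/set_mem/reflection_dihedral.
have Rj : reflections m (reflection R j) by exists j.
by rewrite refl_mul_idx -(c_inv Dk Rj) invmx_reflection.
Qed.

Lemma cplx_scale p q (k : R) (A : 'M[R]_(p, q)) : cplx (k *: A) = k%:C%C *: cplx A.
Proof. by apply/matrixP => i j; rewrite !mxE rmorphM. Qed.

Lemma mulformZ (k : C) u (p : series R) : mulform (k *: u) p = k *: mulform u p.
Proof.
have mul0 : mulform 0 p = 0.
  by have := mulform_linl (-1) 0 0 p; rewrite !scaleN1r !addNr.
by rewrite -[k *: u]addr0 mulform_linl mul0 addr0.
Qed.

Lemma lin0 (V W : lmodType C) (f : V -> W) : linear f -> f 0 = 0.
Proof. by move=> /(_ (-1) 0 0); rewrite !scaleN1r !addNr. Qed.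
Lemma linZ (V W : lmodType C) (f : V -> W) (k : C) x : linear f -> f (k *: x) = k *: f x.
Proof. by move=> fL; rewrite -[k *: x]addr0 fL (lin0 fL) addr0. Qed.
Lemma linD (V W : lmodType C) (f : V -> W) x y : linear f -> f (x + y) = f x + f y.
Proof. by move=> fL; rewrite -[x]scale1r fL !scale1r. Qed.
Lemma lin_sum (V W : lmodType C) (f : V -> W) (I : Type) (r : seq I) (F : I -> V) :
  linear f -> f (\sum_(i <- r) F i) = \sum_(i <- r) f (F i).
Proof.
move=> fL; apply: (big_morph f); last exact: lin0.
by move=> x y; apply: linD.
Qed.

Lemma divform_scale (e : C) u p : e * e = 1 -> value u != 0 ->
  divform (e *: u) p = e *: divform u p.
Proof.
move=> e1 u0; have eu0 : value (e *: u) != 0.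
  have e0 : e != 0 by apply: contra_eq_neq e1 => ->; rewrite mul0r eq_sym oner_neq0.
  rewrite (_ : value _ = e * value u) ?mulf_neq0 //.
  by rewrite /value !mxE; ring.
apply: (mulform_inj eu0); rewrite mulform_divform // mulformZ.
by rewrite (linZ _ _ (mulform_linear _)) scalerA e1 scale1r mulform_divform.
Qed.

Lemma mulform_divC u u' p : value u != 0 ->
  mulform u' (divform u p) = divform u (mulform u' p).
Proof.
by move=> u0; apply: (mulform_inj u0); rewrite mulformC !mulform_divform.
Qed.

Lemma dird_div v u p : value u != 0 ->
  dird v (divform u p) =
  divform u (dird v p) - pairing u v *: divform u (divform u p).
Proof.
move=> u0; apply: (mulform_inj u0); rewrite -scaleNr.
rewrite (linD _ _ (mulform_linear _)) (linZ _ _ (mulform_linear _)).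
rewrite !mulform_divform // scaleNr -{2}[p](mulform_divform p u0) dird_mulform.
by rewrite addrK.
Qed.

Implicit Types (p : series R).

(** The identity behind the commutativity of the Dunkl operators: rotating
    either of u, u' by a right angle in the product u u' gives products that
    differ by the cross product of u and u' times the invariant quadratic
    form rho2 = z zbar (perp_mulform). *)
Definition perp u : 'rV[C]_2 := row2 (- u 0 1) (u 0 0).
Definition cross u u' : C := u 0 0 * u' 0 1 - u 0 1 * u' 0 0.
Definition rho2 p := mulform (row2 1 'i%C) (mulform (row2 1 (- 'i%C)) p).

Lemma mulform_coords u p :
  mulform u p = u 0 0 *: mulform (row2 1 0) p + u 0 1 *: mulform (row2 0 1) p.
Proof.
rewrite -[X in _ + X]mulformZ -mulform_linl !scale_row2 add_row2 {1}[u]row2P.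
by congr (mulform (row2 _ _) _); ring.
Qed.

Lemma perp_identity (V : lmodType C) (X Y : V -> V) (a b a' b' : C) (p : V) :
    linear X -> linear Y -> (forall q, Y (X q) = X (Y q)) ->
  (- b *: X (a' *: X p + b' *: Y p) + a *: Y (a' *: X p + b' *: Y p)) -
  (a *: X (- b' *: X p + a' *: Y p) + b *: Y (- b' *: X p + a' *: Y p)) =
  (a * b' - b * a') *: (1 *: X (1 *: X p + - 'i%C *: Y p) +
                        'i%C *: Y (1 *: X p + - 'i%C *: Y p)).
Proof.
move=> XL YL XY.
rewrite !(linD _ _ XL) !(linD _ _ YL) !(linZ _ _ XL) !(linZ _ _ YL) !XY.
by lin C V; ring: (ii R).
Qed.

Lemma perp_mulform u u' p :
  mulform (perp u) (mulform u' p) - mulform u (mulform (perp u') p) =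
  cross u u' *: rho2 p.
Proof.
have := @perp_identity (series R) (mulform (row2 1 0)) (mulform (row2 0 1))
  (u 0 0) (u 0 1) (u' 0 0) (u' 0 1) p (mulform_linear _) (mulform_linear _)
  (mulformC _ _).
rewrite /rho2 !(mulform_coords (perp _)) !(mulform_coords u) !(mulform_coords u').
rewrite (mulform_coords (row2 1 'i%C)) !(mulform_coords (row2 1 (- 'i%C))).
by rewrite !mxE.
Qed.

Lemma rho2_inj p q : rho2 p = rho2 q -> p = q.
Proof.
have v1 : value (row2 1 'i%C : 'rV[C]_2) = -1.
  by rewrite /value !mxE /=; ring: (ii R).
have v2 : value (row2 1 (- 'i%C) : 'rV[C]_2) = 3.
  by rewrite /value !mxE /=; ring: (ii R).
move=> E; apply: (@mulform_inj _ (row2 1 (- 'i%C))); first by rewrite v2 pnatr_eq0.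
by apply: mulform_inj E; rewrite v1 oppr_eq0 oner_eq0.
Qed.

Lemma rho2_linear : linear (@rho2).
Proof. by move=> k p q; rewrite /rho2 !mulform_linear. Qed.

(** Multiplication by the quotient perp u / u: a cotangent, so that
    rho2_divdiv is an addition formula. *)
Definition slope u p := mulform (perp u) (divform u p).

Lemma slope_scale (e : C) u p : e * e = 1 -> value u != 0 ->
  slope (e *: u) p = slope u p.
Proof.
move=> e1 u0; rewrite /slope divform_scale // (_ : perp _ = e *: perp u).
  by rewrite mulformZ (linZ _ _ (mulform_linear _)) scalerA e1 scale1r.
by rewrite /perp scale_row2 !mxE; congr row2; ring.
Qed.

Lemma rho2_divdiv u u' p : value u != 0 -> value u' != 0 ->
  cross u u' *: rho2 (divform u (divform u' p)) = slope u p - slope u' p.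
Proof.
move=> u0 u'0; rewrite -perp_mulform; congr (_ - _).
  by rewrite mulform_divC // mulform_divform.
by rewrite mulformC mulform_divform.
Qed.

Definition det2 (A : 'M[C]_2) : C := A 0 0 * A 1 1 - A 0 1 * A 1 0.

Lemma cross_mul (A : 'M[C]_2) u u' : cross (u *m A) (u' *m A) =
  cross u u' * det2 A.
Proof.
rewrite /det2 [u]row2P [u']row2P [A]mat2P !mul_row2_mat2 /cross !mxE /=; ring.
Qed.

Lemma dihedral_det (h : G) : det2 (cplx (val h)) != 0.
Proof.
rewrite /det2.
have unit_det (p q : R) : p * p + q * q = 1 ->
    p%:C%C * p%:C%C + q%:C%C * q%:C%C = 1.
  by move=> /(congr1 (real_complex R)); rewrite rmorphD !rmorphM.
have [p q pq1 ->|p q pq1 ->] := dihedral_isometry (set_mem (valP h)).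
  by rewrite cplx_mat2 !mxE /= rmorphN mulNr opprK unit_det // oner_eq0.
rewrite cplx_mat2 !mxE /= rmorphN mulrN -opprD unit_det //.
by rewrite oppr_eq0 oner_eq0.
Qed.

Lemma cross_roots (j k : 'I_m) :
  cross (cplx (a_ R j)) (cplx (a_ R k *m reflection R j)) =
  cross (cplx (a_ R j)) (cplx (a_ R k)).
Proof.
rewrite !aE reflectionE mul_row2_mat2 !cplx_row2 /cross !mxE /=.
rewrite cos_mulr2n sin_mulr2n.
have := cos2Dsin2 (angle R j); set si := sin (angle R j); set co := cos (angle R j).
move=> cs; have ss : si * si = 1 - co * co by rewrite -cs; ring.
rewrite -!rmorphM -!rmorphB /=; congr (_%:C)%C.
by ring: ss.
Qed.

Lemma gmul_reindex (j k : 'I_m) (h : G) :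
  gmul (s_ R j) (gmul (s_ R (refl_idx j k)) h) = gmul (s_ R k) (gmul (s_ R j) h).
Proof.
apply: val_inj; rewrite /= refl_mul_idx !mulmxA.
by rewrite reflection_unitK mul1mx.
Qed.

Definition cross_term F (h : G) (jk : 'I_m * 'I_m) : series R :=
  divform (cplx (a_ R jk.1 *m val h))
    (divform (cplx (a_ R jk.2 *m val (gmul (s_ R jk.1) h)))
      (F (gmul (s_ R jk.2) (gmul (s_ R jk.1) h)))).

(** The terms with two reflections in [D_v, D_w] vanish. Multiplied by rho2,
    the term at (j, k) becomes, by rho2_divdiv, the difference of two
    slopes, of a_j and of the root of s_j s_k s_j, applied to the same
    component of F. The second slope is the first one at the pair (s_j s_k
    s_j, s_j), which has the same product s_j s_k. This pairing is a
    bijection and preserves c, so that the sum telescopes. *)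
Lemma cross_terms_cancel F (h : G) :
  \sum_jk (cr jk.1 * cr jk.2 * cross (cplx (a_ R jk.1)) (cplx (a_ R jk.2))) *:
    cross_term F h jk = 0.
Proof.
set S := \sum_jk _; suff: det2 (cplx (val h)) *: rho2 S = 0.
  move=> /(congr1 (fun s => (det2 (cplx (val h)))^-1 *: s)).
  rewrite scalerA mulVf ?dihedral_det // scale1r scaler0 => rS0.
  by apply: rho2_inj; rewrite rS0 (lin0 rho2_linear).
pose Psi jk := F (gmul (s_ R jk.2) (gmul (s_ R jk.1) h)).
pose L (jk : 'I_m * 'I_m) :=
  (cr jk.1 * cr jk.2) *: slope (cplx (a_ R jk.1 *m val h)) (Psi jk).
pose flip (jk : 'I_m * 'I_m) := (refl_idx jk.1 jk.2, jk.1).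
have flip_inj : injective flip.
  move=> [j k] [j' k'] E; have jj' : j = j' := congr1 snd E.
  have : refl_idx j k = refl_idx j' k' := congr1 fst E.
  by rewrite jj' => kk'; rewrite (can_inj (refl_idxK m_gt0 j') kk').
have -> : det2 (cplx (val h)) *: rho2 S = \sum_jk (L jk - L (flip jk)).
  rewrite /S (lin_sum _ _ rho2_linear) scaler_sumr; apply: eq_bigr => [[j k] _].
  rewrite (linZ _ _ rho2_linear) /L /flip /Psi /cross_term /= gmul_reindex value_c //.
  set Q := F _; rewrite scalerA -cross_roots.
  have [e e1 [_ E2]] := reflect_root R m_gt0 j k.
  have eC : e%:C%C * e%:C%C = 1 by rewrite -rmorphM e1.
  have -> : slope (cplx (a_ R (refl_idx j k) *m val h)) Q =
            slope (cplx (a_ R k *m (reflection R j *m val h))) Q.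
    rewrite mulmxA E2 -scalemxAl cplx_scale slope_scale //.
    exact: root_value.
  rewrite [cr k * cr j]mulrC -scalerBr -rho2_divdiv; last 2 first.
  - exact: root_value.
  - exact: (root_value (gmul (s_ R j) h)).
  rewrite mulmxA !cplxM cross_mul -!scalerA scalerA.
  by rewrite !scalerA; congr (_ *: _); ring.
rewrite sumrB [X in X - _](reindex_inj flip_inj) subrr //.
Qed.

End DunklRepresentation.

#[local] Arguments op : simpl never.

Section DunklRelations.
Variables (R : realType) (m : nat) (c : 'M[R]_2 -> R[i]).
Hypotheses (m_gt0 : (0 < m)%N) (c_inv : conj_invariant m c).
Local Notation C := R[i].
Local Notation G := (@dihedral R m).
Local Notation cr j := (c (reflection R j)).
Local Notation space := (@dunkl_space R m).
Local Notation op := (@op R m c).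

Implicit Types (F : space) (v w : 'cV[C]_2) (u : 'rV[C]_2) (g h : G).

Lemma spaceD F F' h : (F + F') h = F h + F' h. Proof. by []. Qed.
Lemma spaceN F h : (- F) h = - F h. Proof. by []. Qed.
Lemma spaceZ (k : C) F h : (k *: F) h = k *: F h. Proof. by []. Qed.
Lemma space_sum (I : Type) (r : seq I) (F : I -> space) h :
  (\sum_(i <- r) F i) h = \sum_(i <- r) F i h.
Proof. by apply: (big_morph (fun F : space => F h)). Qed.

Lemma op_vecE v F h : op (Vec m v) F h =
  dird (cplx (invmx (val h)) *m v) (F h) +
    \sum_j (cr j * pairing (cplx (a_ R j)) v) *:
      divform (cplx (a_ R j *m val h)) (F (gmul (s_ R j) h)).
Proof. by []. Qed.
Lemma op_covE u F h : op (Cov m u) F h = mulform (u *m cplx (val h)) (F h).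
Proof. by []. Qed.
Lemma op_grpE g F h : op (Grp g) F h = F (gmul (ginv g) h).
Proof. by []. Qed.

Lemma pairing_lin u k v w : pairing u (k *: v + w) = k * pairing u v + pairing u w.
Proof. by rewrite !pairingE !mxE; ring. Qed.

Lemma pairingZl u (k : C) v : pairing (k *: u) v = k * pairing u v.
Proof. by rewrite !pairingE !mxE; ring. Qed.

Lemma cplx_invK h : cplx (val h) *m cplx (invmx (val h)) = 1%:M :> 'M[C]_2.
Proof. by rewrite -cplxM mulmxV ?(g_unit m_gt0) // /cplx map_mx1. Qed.

Lemma pairing_inv u v h :
  pairing (u *m cplx (val h)) (cplx (invmx (val h)) *m v) = pairing u v.
Proof. by rewrite /pairing mulmxA -(mulmxA u) cplx_invK mulmx1. Qed.

Lemma divZ h (j : 'I_m) (k : C) p :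
  divform (cplx (a_ R j *m val h)) (k *: p) =
  k *: divform (cplx (a_ R j *m val h)) p.
Proof. exact: (linZ _ _ (divform_linear (root_value m_gt0 h j))). Qed.
Lemma divD h (j : 'I_m) p q :
  divform (cplx (a_ R j *m val h)) (p + q) =
  divform (cplx (a_ R j *m val h)) p + divform (cplx (a_ R j *m val h)) q.
Proof. exact: (linD _ _ (divform_linear (root_value m_gt0 h j))). Qed.

Lemma cplx_reflection (j : 'I_m) : cplx (reflection R j) =
  1%:M - 2 *: (cplx (alpha_ R j) *m cplx (a_ R j)) :> 'M[C]_2.
Proof.
rewrite /cplx /reflection map_mxB map_mxZ map_mx1 map_mxM.
by congr (_ - _ *: _); rewrite -[RHS](rmorph_nat (real_complex R)).
Qed.

Lemma inv_reflect (j : 'I_m) h w : cplx (invmx (reflection R j *m val h)) *m w =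
  - (2 * pairing (cplx (a_ R j)) w) *:
    (cplx (invmx (val h)) *m cplx (alpha_ R j)) + cplx (invmx (val h)) *m w.
Proof.
have -> : invmx (reflection R j *m val h) = invmx (val h) *m reflection R j.
  apply: invmx_unique; rewrite mulmxA -(mulmxA (reflection R j)).
  by rewrite mulmxV ?(g_unit m_gt0) // mulmx1 reflection_unitK.
rewrite cplxM -mulmxA; set B := cplx (invmx _).
rewrite cplx_reflection mulmxBl mul1mx mulmxBr addrC; congr (_ + _).
rewrite -scalemxAl -mulmxA [_ *m w]mx11_scalar -/(pairing _ _).
by rewrite mul_mx_scalar scalerA -scalemxAr scaleNr.
Qed.

(** The terms with one reflection in the composite of the Dunkl operators of
    v and w: a symmetric function of v and w, which therefore does not
    contribute to the commutator. *)
Definition sym_term F h v w (j : 'I_m) : series R :=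
  let D (u : 'cV[C]_2) := divform (cplx (a_ R j *m val h))
       (dird (cplx (invmx (val h)) *m u) (F (gmul (s_ R j) h))) in
  (cr j * pairing (cplx (a_ R j)) w) *: D v +
  (cr j * pairing (cplx (a_ R j)) v) *: D w -
  (cr j * pairing (cplx (a_ R j)) v * pairing (cplx (a_ R j)) w) *:
     (divform (cplx (a_ R j *m val h))
       (divform (cplx (a_ R j *m val h)) (F (gmul (s_ R j) h))) +
      2 *: D (cplx (alpha_ R j))).

Lemma sym_term_identity (V : lmodType C) (k a b : C) (x y d t : V) :
  (k * b) *: (x - a *: d) + (k * a) *: (- (2 * b) *: t + y) =
  (k * b) *: x + (k * a) *: y - (k * a * b) *: (d + 2 *: t).
Proof. by lin C V. Qed.

(** In dird (divform p), the derivative of the denominator gives the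
    quadratic pole, and the derivative of F after the reflection s_j is
    along s_j w, that is w - 2 <a_j, w> alpha_j. *)
Lemma op_vec_vec v w F h : op (Vec m v) (op (Vec m w) F) h =
  dird (cplx (invmx (val h)) *m v) (dird (cplx (invmx (val h)) *m w) (F h)) +
  \sum_j sym_term F h v w j +
  \sum_jk (cr jk.1 * cr jk.2 * (pairing (cplx (a_ R jk.1)) v *
     pairing (cplx (a_ R jk.2)) w)) *: cross_term F h jk.
Proof.
rewrite op_vecE op_vecE (linD _ _ (dird_linear _)) -!addrA; congr (_ + _).
rewrite (lin_sum _ _ (dird_linear _)).
have -> : \sum_jk (cr jk.1 * cr jk.2 * (pairing (cplx (a_ R jk.1)) v *
     pairing (cplx (a_ R jk.2)) w)) *: cross_term F h jk =
  \sum_j \sum_k (cr j * cr k * (pairing (cplx (a_ R j)) v *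
     pairing (cplx (a_ R k)) w)) *: cross_term F h (j, k).
  by rewrite pair_bigA; apply: eq_bigr => [[j k] _].
rewrite -!big_split; apply: eq_bigr => j _ /=.
rewrite op_vecE divD scalerDr addrA; congr (_ + _).
  rewrite (linZ _ _ (dird_linear _)) dird_div; last exact: root_value.
  have -> : pairing (cplx (a_ R j *m val h)) (cplx (invmx (val h)) *m v) =
      pairing (cplx (a_ R j)) v by rewrite cplxM pairing_inv.
  have -> : cplx (invmx (val (gmul (s_ R j) h))) *m w = _ := inv_reflect j h w.
  rewrite dird_linl divD divZ.
  exact: sym_term_identity.
rewrite (lin_sum _ _ (divform_linear (root_value m_gt0 h j))) scaler_sumr.
by apply: eq_bigr => k _; rewrite divZ scalerA /cross_term /=; congr (_ *: _); ring.
Qed.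

Lemma sym_term_sym F h v w j : sym_term F h v w j = sym_term F h w v j.
Proof.
rewrite /sym_term [X in X - _ = _]addrC; congr (_ - _ *: _).
by rewrite -!mulrA; congr (_ * _); rewrite mulrC.
Qed.

Lemma op_vecC v w F : op (Vec m v) (op (Vec m w) F) = op (Vec m w) (op (Vec m v) F).
Proof.
apply/funext => h; rewrite !op_vec_vec dirdC.
under eq_bigr do rewrite sym_term_sym; congr (_ + _).
apply/eqP; rewrite -subr_eq0 -sumrB; apply/eqP.
apply: etrans (etrans (congr1 (fun p => cross v^T w^T *: p)
  (cross_terms_cancel m_gt0 c_inv F h)) (scaler0 _ _)).
rewrite scaler_sumr; apply: eq_bigr => [[j k] _]; rewrite -scalerBl scalerA.
by congr (_ *: _); rewrite !pairingE /cross !mxE /=; ring.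
Qed.

Lemma ev_sum (I : Type) (r : seq I) (s : I -> expr C (cherednik_gen R m)) F :
  ev op (\big[@Add _ _/Zero]_(i <- r) s i) F = \sum_(i <- r) ev op (s i) F.
Proof. exact: (big_morph (fun s => ev op s F)). Qed.

Lemma reflect_form (j : 'I_m) h u : u *m cplx (reflection R j *m val h) =
  - (2 * pairing u (cplx (alpha_ R j))) *: cplx (a_ R j *m val h) +
  u *m cplx (val h).
Proof.
rewrite cplxM cplx_reflection mulmxBl mul1mx mulmxBr addrC; congr (_ + _).
rewrite -scalemxAl -scalemxAr -(mulmxA (cplx (alpha_ R j))) (mulmxA u).
rewrite [u *m cplx (alpha_ R j)]mx11_scalar.
by rewrite -/(pairing _ _) mul_scalar_mx scalerA scaleNr cplxM.
Qed.

Lemma ginv_s (j : 'I_m) : ginv (s_ R j) = s_ R j.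
Proof. by apply: val_inj; rewrite /= invmx_reflection. Qed.

Lemma commutator_identity (V : lmodType C) (A B D E S : V) (p : C) :
  D - B = - (2 *: S) ->
  A + p *: E + D - (A + B) = p *: E - 2 *: S.
Proof.
move=> DB; rewrite (_ : _ - _ = p *: E + (D - B)); first by rewrite DB.
by lin C V.
Qed.

(** The derivative gives <u, v>. Since s_j u - u = - 2 <u, alpha_j> a_j, the
    pole of the Dunkl operator cancels and leaves s_j. *)
Lemma op_comm v u F : op (Vec m v) (op (Cov m u) F) - op (Cov m u) (op (Vec m v) F) =
  pairing u v *: F - 2 *: \sum_(j < m)
    (cr j * pairing u (cplx (alpha_ R j)) * pairing (cplx (a_ R j)) v) *:
      op (Grp (s_ R j)) F.
Proof.
apply/funext => h; rewrite !(spaceD, spaceN, spaceZ) space_sum.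
rewrite op_covE !op_vecE op_covE dird_mulform pairing_inv.
rewrite (linD _ _ (mulform_linear _)) (lin_sum _ _ (mulform_linear _)).
apply: commutator_identity; rewrite -sumrB scaler_sumr -sumrN.
apply: eq_bigr => j _; rewrite op_covE spaceZ op_grpE ginv_s.
have -> : u *m cplx (val (gmul (s_ R j) h)) = _ := reflect_form j h u.
rewrite mulform_linl divD divZ divform_mulform; last exact: root_value.
rewrite (linZ _ _ (mulform_linear _)) mulform_divC; last exact: root_value.
rewrite scalerDr addrK !scalerA -[RHS]scaleNr.
by congr (_ *: _); ring.
Qed.

Lemma conj_reflection (g : G) (f : 'I_m -> 'I_m) :
    (forall j, exists2 eps : R, eps * eps = 1 &
      val g *m alpha_ R j = eps *: alpha_ R (f j) /\
      a_ R j *m invmx (val g) = eps *: a_ R (f j)) ->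
  forall j, reflection R (f j) = val g *m reflection R j *m invmx (val g).
Proof.
move=> fE j; have [e e1 [E1 E2]] := fE j.
rewrite /reflection [in RHS]mulmxBr [in RHS]mulmxBl mulmx1 mulmxV ?(g_unit m_gt0) //.
congr (_ - _); rewrite -scalemxAr -scalemxAl; congr (_ *: _).
by rewrite !mulmxA E1 -mulmxA E2 -scalemxAl -scalemxAr scalerA e1 scale1r.
Qed.

Lemma op_grp_vec g v F : op (Grp g) (op (Vec m v) F) =
  op (Vec m (cplx (val g) *m v)) (op (Grp g) F).
Proof.
have [_ [f fI fE]] := dihedral_permutes_roots m_gt0 (set_mem (valP g)).
have fr := conj_reflection fE; have ug := g_unit m_gt0 g.
have ginvM h : invmx (val (gmul (ginv g) h)) = invmx (val h) *m val g.
  apply: invmx_unique; rewrite /= mulmxA -(mulmxA (invmx _)).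
  by rewrite mulmxV ?(g_unit m_gt0) // mulmx1 mulVmx.
apply/funext => h; rewrite op_grpE !op_vecE op_grpE ginvM cplxM mulmxA.
congr (_ + _); rewrite [RHS](reindex_inj fI); apply: eq_bigr => j _.
have [e e1 [E1 E2]] := fE j; rewrite op_grpE.
have aE : a_ R (f j) = e *: (a_ R j *m invmx (val g)).
  by rewrite E2 scalerA e1 scale1r.
have eC : e%:C%C * e%:C%C = 1 by rewrite -rmorphM e1.
have -> : gmul (ginv g) (gmul (s_ R (f j)) h) = gmul (s_ R j) (gmul (ginv g) h).
  by apply: val_inj; rewrite /= fr !mulmxA mulVmx // mul1mx.
have -> : cr (f j) = cr j.
  rewrite fr; apply: c_inv; first exact/set_mem/(valP g).
  by exists j.
have -> : cplx (a_ R (f j) *m val h) = e%:C%C *: cplx (a_ R j *m val (gmul (ginv g) h)).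
  by rewrite aE -scalemxAl cplx_scale mulmxA.
rewrite divform_scale //; last exact: root_value.
rewrite scalerA; congr (_ *: _); rewrite aE cplx_scale cplxM.
rewrite pairingZl /pairing.
have -> : cplx (a_ R j) *m cplx (invmx (val g)) *m (cplx (val g) *m v) =
    cplx (a_ R j) *m v.
  rewrite -mulmxA (mulmxA _ _ v) -cplxM mulVmx //.
  by rewrite /cplx map_mx1 mul1mx.
by rewrite -[LHS]mulr1 -eC; ring.
Qed.

Lemma op_rel s t : cherednik_rel c s t -> forall F, ev op s F = ev op t F.
Proof.
case=> {s t} [k v w|k u u'|g g1|g k l lE|g v|g u|v w|u u'|v u] F /=.
- apply/funext => h; rewrite !(spaceD, spaceZ) !op_vecE.
  rewrite mulmxDr -scalemxAr dird_linl scalerDr addrACA; congr (_ + _).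
  rewrite scaler_sumr -big_split; apply: eq_bigr => j _ /=.
  by rewrite pairing_lin scalerA -scalerDl; congr (_ *: _); ring.
- apply/funext => h; rewrite !(spaceD, spaceZ) !op_covE.
  by rewrite mulmxDl -scalemxAl mulform_linl.
- apply/funext => h; rewrite op_grpE; congr F; apply: val_inj.
  by rewrite /= g1 invmx1 mul1mx.
- apply/funext => h; rewrite !op_grpE; congr F; apply: val_inj.
  rewrite /= lE mulmxA; congr (_ *m _); apply/esym/invmx_unique.
  rewrite mulmxA -(mulmxA (val g)) mulmxV ?(g_unit m_gt0) // mulmx1.
  by rewrite mulmxV ?(g_unit m_gt0).
- exact: op_grp_vec.
- apply/funext => h; rewrite op_grpE !op_covE op_grpE /=.
  by rewrite -mulmxA -cplxM.
- exact: op_vecC.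
- by apply/funext => h; rewrite !op_covE mulformC.
- rewrite op_comm ev_sum; congr (_ - _ *: _).
Qed.

End DunklRelations.

(** * Top coefficients *)

Section Symbols.
Variables (R : realType) (m : nat) (c : 'M[R]_2 -> R[i]).
Hypotheses (m_gt0 : (0 < m)%N) (c_inv : conj_invariant m c).
Local Notation C := R[i].
Local Notation G := (@dihedral R m).
Local Notation H := (cherednik m c).
Local Notation space := (@dunkl_space R m).
Local Notation op := (@op R m c).
Local Notation grp := (@hgrp R m c).
Local Notation M := (angular m c).
Local Notation zb := (zbar m c).

Implicit Types (F : space) (v w : 'cV[C]_2) (u : 'rV[C]_2) (g h : G) (x y : H).

Definition rep (x : H) (F : space) : space := act op x F.

Lemma rep_vec v F : rep (hvec m c v) F = op (Vec m v) F.
Proof. exact: (act_pres (op_linear c m_gt0) (op_rel m_gt0 c_inv)). Qed.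
Lemma rep_cov u F : rep (hcov m c u) F = op (Cov m u) F.
Proof. exact: (act_pres (op_linear c m_gt0) (op_rel m_gt0 c_inv)). Qed.
Lemma rep_grp g F : rep (grp g) F = op (Grp g) F.
Proof. exact: (act_pres (op_linear c m_gt0) (op_rel m_gt0 c_inv)). Qed.
Lemma rep_mul x y F : rep (x * y) F = rep x (rep y F).
Proof. exact: (actM (op_linear c m_gt0) (op_rel m_gt0 c_inv)). Qed.
Lemma rep_one F : rep 1 F = F.
Proof. exact: (act1 (op_linear c m_gt0) (op_rel m_gt0 c_inv)). Qed.
Lemma rep_lin k x y F : rep (k *: x + y) F = k *: rep x F + rep y F.
Proof.
rewrite /rep (actD (op_linear c m_gt0) (op_rel m_gt0 c_inv)).
by rewrite (actZ (op_linear c m_gt0) (op_rel m_gt0 c_inv)).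
Qed.
Lemma rep0 F : rep 0 F = 0.
Proof. exact: (act0 (op_linear c m_gt0) (op_rel m_gt0 c_inv)). Qed.
Lemma repD x y F : rep (x + y) F = rep x F + rep y F.
Proof. by rewrite -[x]scale1r rep_lin !scale1r. Qed.
Lemma repB x y F : rep (x - y) F = rep x F - rep y F.
Proof. by rewrite addrC -scaleN1r rep_lin scaleN1r addrC. Qed.
Lemma rep_add x F F' : rep x (F + F') = rep x F + rep x F'.
Proof. exact: act_addr (op_linear c m_gt0) _ _ _. Qed.
Lemma rep_scale x (k : C) F : rep x (k *: F) = k *: rep x F.
Proof. exact: act_scaler (op_linear c m_gt0) _ _ _. Qed.

(** The linear form zbar on the component at the base point. Multiplying
    every component by it is not the action of zbar, which transports the
    form by h: it commutes with G as well as with E^*, and delta, the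
    commutator with it, therefore only sees the differential part of an
    operator and lowers its order. *)
Definition zrow : 'rV[C]_2 := row2 1 (- 'i%C).
Definition mulzb (F : space) : space := fun h => mulform zrow (F h).

Lemma value_zrow : value zrow != 0.
Proof.
rewrite /value !mxE /=.
have -> : 1 + 2 * 'i%C * - 'i%C = 3%:R :> C by ring: (ii R).
by rewrite pnatr_eq0.
Qed.

Lemma mulzb_lin k F F' : mulzb (k *: F + F') = k *: mulzb F + mulzb F'.
Proof. by apply/funext => h; apply: mulform_linear. Qed.
Lemma mulzbD F F' : mulzb (F + F') = mulzb F + mulzb F'.
Proof. by rewrite -[F]scale1r mulzb_lin !scale1r. Qed.
Lemma mulzb0 : mulzb 0 = 0.
Proof. by have := mulzb_lin (-1) 0 0; rewrite !scaleN1r !addNr. Qed.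

Definition delta (S : space -> space) : space -> space :=
  fun F => S (mulzb F) - mulzb (S F).

Definition additive_op (S : space -> space) := forall F F', S (F + F') = S F + S F'.

Lemma additive_op_sub S F F' : additive_op S -> S (F - F') = S F - S F'.
Proof.
by move=> SD; apply/eqP; rewrite eq_sym subr_eq -SD subrK.
Qed.

Lemma delta_additive S : additive_op S -> additive_op (delta S).
Proof. by move=> SD F F'; rewrite /delta !(mulzbD, SD) opprD addrACA. Qed.

Lemma delta_comp S S' : additive_op S ->
  delta (S \o S') = fun F => delta S (S' F) + S (delta S' F).
Proof.
move=> SD; apply/funext => F; rewrite /delta /= (additive_op_sub _ _ SD).
by rewrite [RHS]addrC addrA subrK.
Qed.

Lemma iter_delta_compl n S S' : delta S' = (fun=> 0) ->
  iter n delta (S \o S') = iter n delta S \o S'.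
Proof.
move=> S'0; elim: n => //= n ->; apply/funext => F; rewrite /delta /=.
have := congr1 (fun T => T F) S'0; rewrite /delta /= => /eqP.
by rewrite subr_eq0 => /eqP ->.
Qed.

Lemma iter_delta_compr n S S' : additive_op S -> delta S = (fun=> 0) ->
  iter n delta (S \o S') = S \o iter n delta S'.
Proof.
move=> SD S0; elim: n => //= n ->; rewrite delta_comp //; apply/funext => F /=.
by rewrite S0 add0r.
Qed.

Lemma iter_delta_lin n (k : C) S S' : iter n delta (fun F => k *: S F + S' F) =
  fun F => k *: iter n delta S F + iter n delta S' F.
Proof.
elim: n => //= n ->; apply/funext => F; rewrite /delta mulzb_lin scalerBr.
by rewrite opprD addrACA.
Qed.

Lemma iter_delta0 n : iter n delta (fun=> 0) = fun=> 0.
Proof.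
by elim: n => //= n ->; apply/funext => F; rewrite /delta mulzb0 subrr.
Qed.

Lemma delta_cov u : delta (rep (hcov m c u)) = fun=> 0.
Proof.
apply/funext => F; apply/funext => h; rewrite /delta !rep_cov.
by apply/eqP; rewrite subr_eq0 /mulzb !op_covE mulformC.
Qed.

Lemma delta_grp g : delta (rep (grp g)) = fun=> 0.
Proof.
by apply/funext => F; apply/eqP; rewrite /delta !rep_grp subr_eq0.
Qed.

Lemma delta_vec v F h : delta (rep (hvec m c v)) F h =
  pairing zrow (cplx (invmx (val h)) *m v) *: F h.
Proof.
rewrite /delta !rep_vec spaceD spaceN {2}/mulzb !op_vecE {1}/mulzb dird_mulform.
rewrite (linD _ _ (mulform_linear _)) (lin_sum _ _ (mulform_linear _)).
set S := \sum_j _; set S' := \sum_j _; have -> : S = S'.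
  apply: eq_bigr => j _; rewrite (linZ _ _ (mulform_linear _)).
  by rewrite mulform_divC //; apply: root_value.
by rewrite opprD addrACA subrr addr0 addrC addKr.
Qed.

Lemma delta_lin (k : C) S S' : delta (fun F => k *: S F + S' F) =
  fun F => k *: delta S F + delta S' F.
Proof. exact: (iter_delta_lin 1). Qed.

Lemma complex_unit (p q : R) : p * p + q * q = 1 ->
  (p%:C%C - 'i%C * q%:C%C) * (p%:C%C + 'i%C * q%:C%C) = 1.
Proof.
move=> /(congr1 (real_complex R)); rewrite rmorphD !rmorphM rmorph1 /= => <-.
by ring: (ii R).
Qed.

(** The commutator of M with mulzb is a multiplication operator: the
    principal symbol of M, evaluated at the covector zbar. *)
Definition symbol : space -> space := delta (rep M).

(** On the component at h, one of zeta and zetabar, transported to the base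
    point, pairs to zero with zrow, and the other term is plus or minus
    zrow: M is invariant under rotations and changes sign under reflections. *)
Lemma symbolE h : exists e : C,
  e * e = 1 /\ forall F, symbol F h = e *: mulform zrow (F h).
Proof.
have NE F : symbol F h =
    mulform (row2 1 (- 'i%C) *m cplx (val h))
      (pairing zrow (cplx (invmx (val h)) *m col2 2^-1 ('i%C / 2)) *: F h) -
    mulform (row2 1 'i%C *m cplx (val h))
      (pairing zrow (cplx (invmx (val h)) *m col2 2^-1 (- 'i%C / 2)) *: F h).
  have -> : symbol F = (-1) *: delta (rep (z_ m c * zeta m c)) F +
                   delta (rep (zb * zetabar m c)) F.
    rewrite -[RHS]/((fun F => _ *: _ F + _ F) F) -delta_lin /symbol; congr (delta _ F).
    by apply/funext => F'; rewrite /angular repB addrC scaleN1r.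
  have delta_mul x y : delta (rep (x * y)) F = delta (rep x) (rep y F) + rep x (delta (rep y) F).
    have -> : rep (x * y) = rep x \o rep y by apply/funext => F'; apply: rep_mul.
    by rewrite delta_comp //; apply: rep_add.
  rewrite spaceD spaceZ scaleN1r addrC (delta_mul zb) (delta_mul (z_ m c)).
  rewrite z_E zbarE zetaE zetabarE !delta_cov !add0r !rep_cov !op_covE.
  by rewrite !delta_vec.
pose B := cplx (invmx (val h)).
have [p q pq1 hE|p q pq1 hE] := dihedral_isometry (set_mem (valP h)).
  have rowE : row2 1 (- 'i%C) *m cplx (val h) = (p%:C%C - 'i%C * q%:C%C) *: zrow.
    rewrite hE cplx_mat2 mul_row2_mat2 scale_row2 rmorphN /=.
    by congr row2; ring: (ii R).
  have zeb1 : pairing zrow (B *m col2 2^-1 ('i%C / 2)) = p%:C%C + 'i%C * q%:C%C.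
    rewrite /B hE invmx_rot // cplx_mat2 mul_mat2_col2 /pairing mul_row2_col2.
    by rewrite opprK rmorphN /=; field: (ii R).
  have ze0 : pairing zrow (B *m col2 2^-1 (- 'i%C / 2)) = 0.
    rewrite /B hE invmx_rot // cplx_mat2 mul_mat2_col2 /pairing mul_row2_col2.
    by rewrite opprK rmorphN /=; field: (ii R).
  exists 1; split; first by rewrite mul1r.
  move=> F; rewrite NE rowE zeb1 ze0 mulformZ (linZ _ _ (mulform_linear _)) scale0r.
  by rewrite (lin0 (mulform_linear _)) subr0 scalerA complex_unit.
have rowE : row2 1 'i%C *m cplx (val h) = (p%:C%C + 'i%C * q%:C%C) *: zrow.
  rewrite hE cplx_mat2 mul_row2_mat2 scale_row2 rmorphN /=.
  by congr row2; ring: (ii R).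
have zeb0 : pairing zrow (B *m col2 2^-1 ('i%C / 2)) = 0.
  rewrite /B hE invmx_ref // cplx_mat2 mul_mat2_col2 /pairing mul_row2_col2.
  by rewrite rmorphN /=; field: (ii R).
have ze1 : pairing zrow (B *m col2 2^-1 (- 'i%C / 2)) = p%:C%C - 'i%C * q%:C%C.
  rewrite /B hE invmx_ref // cplx_mat2 mul_mat2_col2 /pairing mul_row2_col2.
  by rewrite rmorphN /=; field: (ii R).
exists (- 1); split; first by rewrite mulrNN mul1r.
move=> F; rewrite NE rowE zeb0 ze1 mulformZ !(linZ _ _ (mulform_linear _)) scale0r.
rewrite sub0r scalerA mulrC complex_unit //.
by rewrite scale1r scaleN1r.
Qed.

Lemma symbol_inj F : symbol F = 0 -> F = 0.
Proof.
move=> NF0; apply/funext => h; have [e [e1 E]] := symbolE h.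
have e0 : e != 0 by apply: contra_eq_neq e1 => ->; rewrite mul0r eq_sym oner_neq0.
apply: (mulform_inj value_zrow); rewrite (lin0 (mulform_linear _)).
have : e^-1 *: (e *: mulform zrow (F h)) = 0 by rewrite -E NF0 scaler0.
by rewrite scalerA mulVf // scale1r.
Qed.

Lemma delta_symbol : delta symbol = fun=> 0.
Proof.
apply/funext => F; apply/funext => h; have [e [_ E]] := symbolE h.
rewrite /delta spaceD spaceN E /mulzb E (linZ _ _ (mulform_linear _)).
by rewrite subrr.
Qed.

Lemma symbol_cov u F : symbol (rep (hcov m c u) F) = rep (hcov m c u) (symbol F).
Proof.
apply/funext => h; have [e [_ E]] := symbolE h.
rewrite E !rep_cov !op_covE E (linZ _ _ (mulform_linear _)).
by rewrite mulformC.
Qed.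

Lemma symbol_additive : additive_op symbol.
Proof. exact: delta_additive (rep_add _). Qed.

Lemma delta_step (k : nat) P : additive_op P ->
  delta (fun F => k%:R *: P (symbol F) + delta P (rep M F)) =
  fun F => k.+1%:R *: delta P (symbol F) + delta (delta P) (rep M F).
Proof.
move=> PD; have QD := delta_additive PD.
have P0 : P 0 = 0 by apply: (addrI (P 0)); rewrite -PD !addr0.
move: (delta P) QD (delta_comp symbol PD) => Q QD PN.
apply: etrans (delta_lin k%:R (P \o symbol) (Q \o rep M)) _.
rewrite PN (delta_comp (rep M) QD) delta_symbol -/symbol; apply/funext => F.
by rewrite P0 addr0 -natr1 scalerDl scale1r [delta Q _ + _]addrC addrA.
Qed.

(** Leibniz rule for the powers of delta on a product: all terms in which
    delta falls at least twice on M vanish, because the symbol of M commutes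
    with mulzb. *)
Lemma iter_delta_M n S : additive_op S -> iter n.+1 delta (S \o rep M) =
  fun F => n.+1%:R *: iter n delta S (symbol F) + iter n.+1 delta S (rep M F).
Proof.
move=> SD; have SnD k : additive_op (iter k delta S).
  by elim: k => //= k IH; apply: delta_additive.
elim: n => [|n IH].
  apply: etrans (delta_comp (rep M) SD) _; apply/funext => F.
  by rewrite scale1r addrC.
by rewrite iterS IH; apply: delta_step.
Qed.

Lemma comp_rep x y : rep (x * y) = rep x \o rep y.
Proof. by apply/funext => F; apply: rep_mul. Qed.

Lemma iter_delta_expr_lt n k : (k < n)%N -> iter n delta (rep (M ^+ k)) = fun=> 0.
Proof.
elim: k n => [|k IH] [//|n] kn.
  rewrite iterSr (_ : delta _ = fun=> 0) ?iter_delta0 //.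
  by apply/funext => F; rewrite /delta !rep_one subrr.
rewrite exprSr comp_rep iter_delta_M; last exact: rep_add.
apply/funext => F; rewrite !IH ?scaler0 ?addr0 //.
by rewrite (leq_trans _ kn) // ltnW.
Qed.

Lemma iter_delta_expr n F : iter n delta (rep (M ^+ n)) F = n`!%:R *: iter n symbol F.
Proof.
elim: n F => [|n IH] F; first by rewrite scale1r; apply: rep_one.
rewrite exprSr comp_rep iter_delta_M; last exact: rep_add.
rewrite [X in _ + X](_ : _ = 0); last by rewrite iter_delta_expr_lt.
by rewrite addr0 IH scalerA -natrM -factS iterSr.
Qed.

(** A filtration by the degree in M; it is a span, so that the coefficients
    of M ^+ k * g are only meaningful once read off in the Dunkl
    representation. *)
Definition below (n : nat) : H -> Prop :=
  lspan (fun x => exists k g, (k < n)%N /\ x = M ^+ k * grp g).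

Definition group_span : H -> Prop := lspan (fun x => exists g, x = grp g).

Lemma iter_delta_below n x : below n x -> iter n delta (rep x) = fun=> 0.
Proof.
have repL k a b : rep (k *: a + b) = fun F => k *: rep a F + rep b F.
  by apply/funext => F; apply: rep_lin.
move: x; apply: lspan_least => [|k a b Ea Eb|_ [k [g [kn ->]]]].
- by rewrite (_ : rep 0 = fun=> 0) ?iter_delta0 //; apply/funext => F; apply: rep0.
- by rewrite repL iter_delta_lin Ea Eb; apply/funext => F; rewrite scaler0 addr0.
by rewrite comp_rep iter_delta_compl ?delta_grp // iter_delta_expr_lt.
Qed.

Lemma delta_group_span x : group_span x -> delta (rep x) = fun=> 0.
Proof.
have repL k a b : rep (k *: a + b) = fun F => k *: rep a F + rep b F.
  by apply/funext => F; apply: rep_lin.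
move: x; apply: lspan_least => [|k a b Ea Eb|_ [g ->]]; last exact: delta_grp.
- rewrite (_ : rep 0 = fun=> 0) ?iter_delta0 //; first exact: (iter_delta0 1).
  by apply/funext => F; apply: rep0.
- by rewrite repL delta_lin Ea Eb; apply/funext => F; rewrite scaler0 addr0.
Qed.

Lemma iter_delta_top n x y F : group_span x -> below n y ->
  iter n delta (rep (M ^+ n * x + y)) F = n`!%:R *: iter n symbol (rep x F).
Proof.
move=> Gx By.
have -> : rep (M ^+ n * x + y) = fun F => 1 *: rep (M ^+ n * x) F + rep y F.
  by apply/funext => F'; rewrite repD scale1r.
rewrite iter_delta_lin (iter_delta_below By) scale1r addr0 comp_rep.
by rewrite iter_delta_compl ?delta_group_span //= iter_delta_expr.
Qed.

(** Applying n times the commutator with mulzb keeps n! times the n-th power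
    of the symbol of M times the coefficient of M ^+ n; the symbol is
    injective and commutes with zbar. *)
Lemma top_coefficients n x y x' y' :
    group_span x -> group_span y -> below n x' -> below n y' ->
    (M ^+ n * x + x') * zb = zb * (M ^+ n * y + y') ->
  forall F, rep x (rep zb F) = rep zb (rep y F).
Proof.
move=> Gx Gy Bx By E F.
have dlzb : delta (rep zb) = fun=> 0 by rewrite zbarE delta_cov.
have := congr1 (fun a => iter n delta (rep a) F) E.
rewrite !comp_rep iter_delta_compl // iter_delta_compr //; last exact: rep_add.
rewrite /= !iter_delta_top // rep_scale.
have fact0 : n`!%:R != 0 :> C by rewrite pnatr_eq0 -lt0n fact_gt0.
move=> /(scalerI fact0).
have -> : rep zb (iter n symbol (rep y F)) = iter n symbol (rep zb (rep y F)).
  by elim: n {E Bx By fact0} => //= n <-; rewrite zbarE symbol_cov.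
move=> /eqP; rewrite -subr_eq0 => /eqP.
have -> F1 F2 : iter n symbol F1 - iter n symbol F2 = iter n symbol (F1 - F2).
  by elim: n {E Bx By fact0} => //= n <-; rewrite (additive_op_sub _ _ symbol_additive).
move=> E0; apply/eqP; rewrite -subr_eq0; apply/eqP.
by elim: n E0 {E Bx By fact0} => //= n IH /symbol_inj.
Qed.

(** Coordinates on the span of the group elements, supported on a list
    because G is a set of real matrices, without a finite enumeration
    attached. *)
Definition combination (s : seq G) (al : G -> C) : H :=
  \sum_(g <- s) al g *: grp g.

Lemma combination_widen (s s' : seq G) al : uniq s -> uniq s' ->
    {subset s <= s'} -> (forall g, g \notin s -> al g = 0) ->
  combination s al = combination s' al.
Proof.
move=> us us' ss' al0; rewrite /combination [RHS](bigID (mem s)) /=.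
rewrite [X in _ = _ + X]big1 ?addr0; last by move=> g /al0 ->; rewrite scale0r.
rewrite -[RHS]big_filter; apply: perm_big; apply: uniq_perm => //.
  exact: filter_uniq.
by move=> g; rewrite mem_filter; case sg: (g \in s) => //=; rewrite ss'.
Qed.

Lemma group_span_combination (x : H) : group_span x -> exists s al,
  [/\ uniq s, forall g, g \notin s -> al g = 0 & x = combination s al].
Proof.
elim=> {x} [|k x y [g ->] _ [s [al [us al0 ->]]]].
  by exists [::], (fun=> 0); split; rewrite // /combination big_nil.
pose s' := if g \in s then s else g :: s.
have us' : uniq s' by rewrite /s'; case: ifP => // /negbT gs /=; rewrite gs.
have gs' : g \in s' by rewrite /s'; case: ifP => //; rewrite mem_head.
have ss' : {subset s <= s'}.
  by move=> h hs; rewrite /s'; case: ifP => //; rewrite inE hs orbT.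
exists s', (fun h => (if h == g then k else 0) + al h); split=> //.
  move=> h hs'; rewrite al0 ?addr0; last by apply: contra hs' => /ss'.
  by case: eqP hs' => // ->; rewrite gs'.
rewrite (combination_widen us us') // /combination.
under [RHS]eq_bigr do rewrite scalerDl.
rewrite big_split /=; congr (_ + _); rewrite (bigD1_seq g) //= eqxx big1 ?addr0 //.
by move=> h /negPf ->; rewrite scale0r.
Qed.

Lemma ginv_eq g h : (gmul (ginv g) h == gid R m) = (h == g).
Proof.
apply/eqP/eqP => [E|->].
  apply: val_inj; have := congr1 val E => /= {}E.
  by rewrite -[LHS]mul1mx -(mulmxV (g_unit m_gt0 g)) -mulmxA E mulmx1.
by apply: val_inj; rewrite /= mulVmx ?(g_unit m_gt0).
Qed.

(** Evaluating at these functions isolates the coefficient of each group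
    element, which proves that G acts by linearly independent operators. *)
Definition point (p : series R) : space := fun h => if h == gid R m then p else 0.

Lemma rep_combination (s : seq G) al F h :
  rep (combination s al) F h = \sum_(g <- s) al g *: F (gmul (ginv g) h).
Proof.
rewrite /combination; elim: s => [|g s IH].
  by rewrite !big_nil rep0.
rewrite !big_cons rep_lin // spaceD spaceZ IH rep_grp //.
Qed.

Lemma rep_point (s : seq G) al p h : uniq s ->
    (forall g, g \notin s -> al g = 0) ->
  rep (combination s al) (point p) h = al h *: p.
Proof.
move=> us al0; rewrite rep_combination.
have term g : al g *: point p (gmul (ginv g) h) = if h == g then al h *: p else 0.
  by rewrite /point ginv_eq; case: eqP => [->|_] //; rewrite scaler0.
under eq_bigr do rewrite term.
have [hs|hs] := boolP (h \in s).
  by rewrite (bigD1_seq h) //= eqxx big1 ?addr0 // => g; rewrite eq_sym => /negPf ->.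
rewrite big_seq big1 ?al0 ?scale0r // => g gs; case: eqP => // hg.
Qed.

Lemma rep_zb_point p : rep zb (point p) = point (mulform zrow p).
Proof.
apply/funext => h; rewrite zbarE rep_cov // op_covE /point.
case: eqP => [->|_]; last exact: lin0 (mulform_linear _).
by rewrite /= [cplx _]map_mx1 mulmx1.
Qed.

Definition one_series : series R := fun i j => ((i == 0%N) && (j == 0%N))%:R.

Lemma mulform_one u : [/\ mulform u one_series 0%N 0%N = value u,
  mulform u one_series 1%N 0%N = u 0 0 & mulform u one_series 0%N 1%N = u 0 1].
Proof. by split; rewrite mulformE /one_series /=; ring. Qed.

(** Both sides are evaluated at the constant series 1 supported at the
    identity of G. At h this gives two multiples of linear forms, zbar and
    its transport by h, as power series; their linear parts are compared. *)
Lemma top_combination (s : seq G) al be h : uniq s ->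
    (forall g, g \notin s -> al g = 0) -> (forall g, g \notin s -> be g = 0) ->
    (forall F, rep (combination s al) (rep zb F) =
               rep zb (rep (combination s be) F)) ->
  al h *: zrow = be h *: (zrow *m cplx (val h)).
Proof.
move=> us al0 be0 E.
have := congr1 (fun F : space => F h) (E (point one_series)).
rewrite rep_zb_point rep_point // zbarE rep_cov // op_covE rep_point //.
rewrite (linZ _ _ (mulform_linear _)) -!mulformZ -/zrow => Eh.
have [_ E1 E2] := mulform_one (al h *: zrow).
have [_ E1' E2'] := mulform_one (be h *: (zrow *m cplx (val h))).
rewrite [LHS]row2P [RHS]row2P -E1 -E2 -E1' -E2' Eh //.
Qed.

Lemma top_rotation (s : seq G) al be h p q : uniq s ->
    (forall g, g \notin s -> al g = 0) -> (forall g, g \notin s -> be g = 0) ->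
    (forall F, rep (combination s al) (rep zb F) =
               rep zb (rep (combination s be) F)) ->
    val h = rot_mx p q ->
  al h = (p%:C%C - 'i%C * q%:C%C) * be h.
Proof.
move=> us al0 be0 E hE; have := top_combination h us al0 be0 E.
rewrite hE cplx_mat2 mul_row2_mat2 /zrow !scale_row2 => /matrixP /(_ 0 0).
by rewrite !mxE /= mulr1 => ->; ring.
Qed.

(** A reflection maps the line of zbar to that of z, so that the two sides
    of top_combination are independent. *)
Lemma top_reflection (s : seq G) al be h p q : uniq s ->
    (forall g, g \notin s -> al g = 0) -> (forall g, g \notin s -> be g = 0) ->
    (forall F, rep (combination s al) (rep zb F) =
               rep zb (rep (combination s be) F)) ->
    p * p + q * q = 1 -> val h = ref_mx p q ->
  al h = 0 /\ be h = 0.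
Proof.
move=> us al0 be0 E pq1 hE; have := top_combination h us al0 be0 E.
rewrite hE cplx_mat2 mul_row2_mat2 /zrow !scale_row2 => /matrixP Eh.
have := Eh 0 0; have := Eh 0 1; rewrite !mxE /= rmorphN /= => E1 E0.
have two : 2 * al h = 0.
  transitivity (al h * 1 - (al h * - 'i%C) * 'i%C * -1); first by ring: (ii R).
  by rewrite E0 E1; ring: (ii R).
have al_h : al h = 0.
  by move/eqP: two; rewrite mulf_eq0 pnatr_eq0 => /eqP.
split=> //; move: E0; rewrite al_h mul0r => /esym/eqP; rewrite mulf_eq0.
case/orP=> /eqP // w0; have := complex_unit pq1.
rewrite (_ : p%:C%C - 'i%C * q%:C%C = 1 * p%:C%C + - 'i%C * q%:C%C); last by ring.
by rewrite w0 mul0r => /eqP; rewrite eq_sym oner_eq0.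
Qed.

End Symbols.

(** * The Clifford algebra as a matrix algebra *)

Section Clifford.
Variable R : realType.
Local Notation C := R[i].
Local Notation Cl := (clifford R).
Local Notation f := (f_ R).
Local Notation fd := (fdag R).

Lemma clAl k (a b : Cl) : (k *: a) * b = k *: (a * b).
Proof. exact/esym/pres_scalerAl. Qed.
Lemma clAr k (a b : Cl) : a * (k *: b) = k *: (a * b).
Proof. exact/esym/pres_scalerAr. Qed.

Lemma e_anticomm j k : e_ R j * e_ R k + e_ R k * e_ R j = (2 * (j == k)%:R) *: (1 : Cl).
Proof. by rewrite -!presM -presD -presZ; apply/pres_relE/clifford_anticomm. Qed.

Definition clE := (mulrDl, mulrDr, mulrN, mulNr, clAl, clAr, mulrA, mulr1, mul1r).

Lemma e_sq j : e_ R j * e_ R j = 1.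
Proof.
have := e_anticomm j j; rewrite eqxx mulr1 -mulr2n -scaler_nat => /scalerI; apply.
by rewrite pnatr_eq0.
Qed.
Lemma e10 : e_ R 1 * e_ R 0 = - (e_ R 0 * e_ R 1).
Proof.
have := e_anticomm 0 1; rewrite mulr0 scale0r => /eqP.
by rewrite addrC addr_eq0 => /eqP.
Qed.

Lemma ff : f * f = 0.
Proof.
by rewrite /f_ !clE !e_sq e10; lin C Cl; field: (ii R).
Qed.
Lemma fdfd : fd * fd = 0.
Proof. by rewrite /fdag !clE !e_sq e10; lin C Cl; field: (ii R). Qed.
Lemma f_fd : f * fd = 1 - fd * f.
Proof. by rewrite /f_ /fdag !clE !e_sq e10; lin C Cl; field: (ii R). Qed.
Lemma f_fd_f : f * fd * f = f.
Proof. by rewrite f_fd mulrBl mul1r -mulrA ff mulr0 subr0. Qed.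
Lemma fd_f_fd : fd * f * fd = fd.
Proof. by rewrite -mulrA f_fd mulrBr mulr1 mulrA fdfd mul0r subr0. Qed.

Lemma e0E : e_ R 0 = f + fd.
Proof. by rewrite /f_ /fdag; lin C Cl; field. Qed.
Lemma e1E : e_ R 1 = 'i%C *: (f - fd).
Proof. by rewrite /f_ /fdag; lin C Cl; field: (ii R). Qed.

(** The four elements are the matrix units of 2 x 2 matrices: P = E_11, Q =
    E_22, F = E_21 and D = E_12. *)
Definition matrix_units (P Q F D : Cl) : Prop :=
  [/\ [/\ P * P = P, P * Q = 0, P * F = 0 & P * D = D],
      [/\ Q * P = 0, Q * Q = Q, Q * F = F & Q * D = 0],
      [/\ F * P = F, F * Q = 0, F * F = 0 & F * D = Q] &
      [/\ D * P = 0, D * Q = D, D * F = P & D * D = 0]].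

Lemma clifford_units : matrix_units (fd * f) (f * fd) f fd.
Proof.
have A x : f * (f * x) = 0 by rewrite mulrA ff mul0r.
have B x : fd * (fd * x) = 0 by rewrite mulrA fdfd mul0r.
have A' : f * (fd * f) = f by rewrite mulrA f_fd_f.
have B' : fd * (f * fd) = fd by rewrite mulrA fd_f_fd.
by split; split; rewrite -?mulrA ?A ?B ?A' ?B' ?ff ?fdfd ?mulr0.
Qed.

Lemma matrix_units_mul P Q F D (k1 k2 k3 k4 l1 l2 l3 l4 : C) :
    matrix_units P Q F D ->
  (k1 *: P + k2 *: Q + k3 *: F + k4 *: D) *
  (l1 *: P + l2 *: Q + l3 *: F + l4 *: D) =
  (k1 * l1 + k4 * l3) *: P + (k2 * l2 + k3 * l4) *: Q +
  (k3 * l1 + k2 * l3) *: F + (k1 * l4 + k4 * l2) *: D.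
Proof.
move=> [[PP PQ PF PD] [QP QQ QF QD] [FP FQ FF FD] [DP DQ DF DD]].
rewrite !(mulrDl, mulrDr, clAl, clAr) PP PQ PF PD QP QQ QF QD FP FQ FF FD DP DQ DF DD.
by lin C Cl.
Qed.

Lemma clifford_span (b : Cl) : exists k1 k2 k3 k4 : C,
  b = k1 *: (fd * f) + k2 *: (f * fd) + k3 *: f + k4 *: fd.
Proof.
elim/pres_span: b => [j||k _ _ [k1 [k2 [k3 [k4 ->]]]] [l1 [l2 [l3 [l4 ->]]]]|
    _ _ [k1 [k2 [k3 [k4 ->]]]] [l1 [l2 [l3 [l4 ->]]]]].
- elim/ord2_ind: j; rewrite -[pres _ _]/(e_ R _).
    by exists 0, 0, 1, 1; rewrite e0E; lin C Cl.
  by exists 0, 0, 'i%C, (- 'i%C); rewrite e1E; lin C Cl.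
- by exists 1, 1, 0, 0; rewrite f_fd; lin C Cl.
- exists (k * k1 + l1), (k * k2 + l2), (k * k3 + l3), (k * k4 + l4).
  by lin C Cl.
- rewrite (matrix_units_mul _ _ _ _ _ _ _ _ clifford_units).
  by do 4!eexists.
Qed.

End Clifford.

Section CliffordAction.
Variable R : realType.
Local Notation C := R[i].
Local Notation Cl := (clifford R).
Local Notation f := (f_ R).
Local Notation fd := (fdag R).

(** The Clifford algebra acts on its two-dimensional spin module; this shows
    that the matrix units are independent, and gives matrix entries. *)
Definition spin_op (j : 'I_2) (u : C^o * C^o) : C^o * C^o :=
  if j == 0 then (u.2, u.1) else (- 'i%C * u.2, 'i%C * u.1).

Lemma regE (k x : C) : k *: (x : C^o) = k * x. Proof. by []. Qed.

Lemma spin_op_linear j : linear (spin_op j).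
Proof.
move=> k [a b] [a' b']; rewrite /spin_op; case: eqP => //= _.
by congr pair; rewrite /= !regE /=; ring.
Qed.

Lemma spin_op_rel s t : clifford_rel s t -> forall u, ev spin_op s u = ev spin_op t u.
Proof.
have d01 : ((0 : 'I_2) == 1) = false by [].
have d10 : ((1 : 'I_2) == 0) = false by [].
case=> {s t} j k [a b]; elim/ord2_ind: j; elim/ord2_ind: k => /=;
  rewrite /spin_op /= ?eqxx ?d01 ?d10 /=; congr pair;
  by rewrite /= ?regE /=; ring: (ii R).
Qed.

Definition spin (b : Cl) (u : C^o * C^o) : C^o * C^o := act spin_op b u.

Definition entry11 (b : Cl) : C := (spin b (1, 0)).1.
Definition entry21 (b : Cl) : C := (spin b (1, 0)).2.
Definition entry12 (b : Cl) : C := (spin b (0, 1)).1.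
Definition entry22 (b : Cl) : C := (spin b (0, 1)).2.

Lemma spinE b u : spin b u = (entry11 b * u.1 + entry12 b * u.2,
                              entry21 b * u.1 + entry22 b * u.2).
Proof.
have -> : spin b u = u.1 *: spin b (1, 0) + u.2 *: spin b (0, 1).
  rewrite -!(act_scaler spin_op_linear) -(act_addr spin_op_linear).
  congr (act _ _ _); case: u => x y; congr pair; rewrite /= ?regE /=; ring.
by congr pair; rewrite /entry11 /entry12 /entry21 /entry22 /= ?regE /=; ring.
Qed.

Lemma spin_lin k b b' u : spin (k *: b + b') u = k *: spin b u + spin b' u.
Proof.
rewrite /spin (actD spin_op_linear spin_op_rel).
by rewrite (actZ spin_op_linear spin_op_rel).
Qed.
Lemma spin1 u : spin 1 u = u.
Proof. exact: (act1 spin_op_linear spin_op_rel). Qed.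
Lemma spinM b b' u : spin (b * b') u = spin b (spin b' u).
Proof. exact: (actM spin_op_linear spin_op_rel). Qed.
Lemma spin_e j u : spin (e_ R j) u = spin_op j u.
Proof. exact: (act_pres spin_op_linear spin_op_rel). Qed.

Lemma spin_f (u : C^o * C^o) : spin f u = (0, u.1).
Proof.
have -> : f = 2^-1 *: e_ R 0 + (- 'i%C / 2 *: e_ R 1 + 0).
  by rewrite /f_; lin C Cl.
rewrite !spin_lin !spin_e /spin_op /=.
have -> : spin 0 u = 0 by apply: (act0 spin_op_linear spin_op_rel).
by case: u => x y; congr pair; rewrite /= ?regE /=; field: (ii R).
Qed.
Lemma spin_fd (u : C^o * C^o) : spin fd u = (u.2, 0).
Proof.
have -> : fd = 2^-1 *: e_ R 0 + ('i%C / 2 *: e_ R 1 + 0).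
  by rewrite /fdag; lin C Cl.
rewrite !spin_lin !spin_e /spin_op /=.
have -> : spin 0 u = 0 by apply: (act0 spin_op_linear spin_op_rel).
by case: u => x y; congr pair; rewrite /= ?regE /=; field: (ii R).
Qed.

End CliffordAction.

(** * The tensor product as 2 x 2 matrices over the Cherednik algebra *)

Section Tensor.
Variables (R : realType) (m : nat) (c : 'M[R]_2 -> R[i]).
Local Notation C := R[i].
Local Notation Cl := (clifford R).
Local Notation H := (cherednik m c).
Local Notation HC := (HC m c).
Local Notation f := (f_ R).
Local Notation fd := (fdag R).

Implicit Types (a : H) (b : Cl).

Lemma tensM a a' b b' : (a ⊗ b) * (a' ⊗ b') = (a * a') ⊗ (b * b') :> HC.
Proof. by rewrite -presM; apply/pres_relE/tensor_mul. Qed.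
Lemma tens_linl k a a' b : (k *: a + a') ⊗ b = k *: (a ⊗ b) + a' ⊗ b :> HC.
Proof. by rewrite -presZ -presD; apply/pres_relE/tensor_linl. Qed.
Lemma tens_linr k a b b' : a ⊗ (k *: b + b') = k *: (a ⊗ b) + a ⊗ b' :> HC.
Proof. by rewrite -presZ -presD; apply/pres_relE/tensor_linr. Qed.
Lemma tens1 : (1 : H) ⊗ (1 : Cl) = 1 :> HC.
Proof. exact/pres_relE/tensor_one. Qed.
Lemma tens0l b : (0 : H) ⊗ b = 0 :> HC.
Proof. by have := tens_linl (-1) 0 0 b; rewrite !scaleN1r !addNr. Qed.
Lemma tens0r a : a ⊗ (0 : Cl) = 0 :> HC.
Proof. by have := tens_linr (-1) a 0 0; rewrite !scaleN1r !addNr. Qed.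
Lemma tensZl k a b : (k *: a) ⊗ b = k *: (a ⊗ b) :> HC.
Proof. by rewrite -[k *: a]addr0 tens_linl tens0l addr0. Qed.
Lemma tensZr k a b : a ⊗ (k *: b) = k *: (a ⊗ b) :> HC.
Proof. by rewrite -[k *: b]addr0 tens_linr tens0r addr0. Qed.
Lemma tensDl a a' b : (a + a') ⊗ b = a ⊗ b + a' ⊗ b :> HC.
Proof. by rewrite -[a]scale1r tens_linl !scale1r. Qed.
Lemma tensDr a b b' : a ⊗ (b + b') = a ⊗ b + a ⊗ b' :> HC.
Proof. by rewrite -[b]scale1r tens_linr !scale1r. Qed.

Lemma hcAl k (x y : HC) : (k *: x) * y = k *: (x * y).
Proof. exact/esym/pres_scalerAl. Qed.
Lemma hcAr k (x y : HC) : x * (k *: y) = k *: (x * y).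
Proof. exact/esym/pres_scalerAr. Qed.

(** An element of the tensor product acts on pairs as a matrix with entries
    in H, evaluated on the unit vectors in tensor_units. *)
Definition tensor_op (t : H * Cl) (u : H * H) : H * H :=
  (entry11 t.2 *: (t.1 * u.1) + entry12 t.2 *: (t.1 * u.2),
   entry21 t.2 *: (t.1 * u.1) + entry22 t.2 *: (t.1 * u.2)).

Lemma tensor_op_linear t : linear (tensor_op t).
Proof.
move=> k [x y] [x' y']; rewrite /tensor_op /=.
by congr pair; rewrite /= !mulrDr !scaleAr_H; lin C H.
Qed.

Lemma entries_lin k b b' : [/\ entry11 (k *: b + b') = k * entry11 b + entry11 b',
  entry12 (k *: b + b') = k * entry12 b + entry12 b',
  entry21 (k *: b + b') = k * entry21 b + entry21 b' &
  entry22 (k *: b + b') = k * entry22 b + entry22 b'].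
Proof. by split; rewrite /entry11 /entry12 /entry21 /entry22 spin_lin. Qed.

Lemma entries1 : [/\ entry11 (1 : Cl) = 1, entry12 (1 : Cl) = 0,
  entry21 (1 : Cl) = 0 & entry22 (1 : Cl) = 1].
Proof. by split; rewrite /entry11 /entry12 /entry21 /entry22 spin1. Qed.

Lemma entries_mul b b' : [/\
  entry11 (b * b') = entry11 b * entry11 b' + entry12 b * entry21 b',
  entry12 (b * b') = entry11 b * entry12 b' + entry12 b * entry22 b',
  entry21 (b * b') = entry21 b * entry11 b' + entry22 b * entry21 b' &
  entry22 (b * b') = entry21 b * entry12 b' + entry22 b * entry22 b'].
Proof.
by split; [rewrite {1}/entry11 | rewrite {1}/entry12 | rewrite {1}/entry21
  | rewrite {1}/entry22]; rewrite spinM spinE.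
Qed.

Lemma tensor_op_rel s t : tensor_rel s t -> forall u, ev tensor_op s u = ev tensor_op t u.
Proof.
case=> {s t} [k a a' b|k a b b'||a a' b b'] [x y] /=; rewrite /tensor_op /=.
- by congr pair; rewrite /= !mulrDl !scaleAl_H; lin C H.
- have [-> -> -> ->] := entries_lin k b b'.
  by congr pair; rewrite /=; lin C H.
- have [-> -> -> ->] := entries1; rewrite !mul1r.
  by congr pair; lin C H.
- have [-> -> -> ->] := entries_mul b b'.
  by congr pair; rewrite !mulrDr !scaleAr_H !mulrA; lin C H.
Qed.

Definition tensor_act (x : HC) (u : H * H) : H * H := act tensor_op x u.

Lemma tensor_act_tens a b u : tensor_act (a ⊗ b) u = tensor_op (a, b) u.
Proof. exact: (act_pres tensor_op_linear tensor_op_rel). Qed.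

(** The matrix with diagonal entries a and a'. *)
Definition diagonal a a' : HC := a ⊗ (fd * f) + a' ⊗ (f * fd).

Lemma tensor_units (a1 a2 a3 a4 : H) :
  diagonal a1 a2 + (a3 ⊗ f + a4 ⊗ fd) = 0 -> [/\ a1 = 0, a2 = 0, a3 = 0 & a4 = 0].
Proof.
move=> E; have actD x y u : tensor_act (x + y) u = tensor_act x u + tensor_act y u.
  exact: (actD tensor_op_linear tensor_op_rel).
have act0 u : tensor_act 0 u = 0 by apply: (act0 tensor_op_linear tensor_op_rel).
have entries_f : [/\ entry11 f = 0, entry12 f = 0, entry21 f = 1 & entry22 f = 0].
  by rewrite /entry11 /entry12 /entry21 /entry22 !spin_f.
have entries_fd :
    [/\ entry11 fd = 0, entry12 fd = 1, entry21 fd = 0 & entry22 fd = 0].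
  by rewrite /entry11 /entry12 /entry21 /entry22 !spin_fd.
have entries_P : [/\ entry11 (fd * f) = 1, entry12 (fd * f) = 0,
    entry21 (fd * f) = 0 & entry22 (fd * f) = 0].
  by rewrite /entry11 /entry12 /entry21 /entry22 !spinM !spin_f !spin_fd.
have entries_Q : [/\ entry11 (f * fd) = 0, entry12 (f * fd) = 0,
    entry21 (f * fd) = 0 & entry22 (f * fd) = 1].
  by rewrite /entry11 /entry12 /entry21 /entry22 !spinM !spin_fd !spin_f.
have Eu u : tensor_act (diagonal a1 a2 + (a3 ⊗ f + a4 ⊗ fd)) u =
    (a1 * u.1 + a4 * u.2, a3 * u.1 + a2 * u.2).
  rewrite !actD !tensor_act_tens /tensor_op /=.
  have [-> -> -> ->] := entries_P; have [-> -> -> ->] := entries_Q.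
  have [-> -> -> ->] := entries_f; have [-> -> -> ->] := entries_fd.
  rewrite !scale0r !scale1r; congr pair => /=.
    by rewrite !(addr0, add0r).
  by rewrite !(addr0, add0r) addrC.
have := Eu (1, 0); have := Eu (0, 1); rewrite E !act0 /=.
by rewrite !mulr1 !mulr0 !addr0 !add0r => -[<- <-] [<- <-].
Qed.

Lemma tensor_span (X : HC) : exists a1 a2 a3 a4,
  X = diagonal a1 a2 + (a3 ⊗ f + a4 ⊗ fd).
Proof.
elim/pres_span: X => [[a b]||k _ _ [a1 [a2 [a3 [a4 ->]]]] [b1 [b2 [b3 [b4 ->]]]]|
    _ _ [a1 [a2 [a3 [a4 ->]]]] [b1 [b2 [b3 [b4 ->]]]]].
- rewrite -[pres _ _]/(a ⊗ b); have [k1 [k2 [k3 [k4 ->]]]] := clifford_span b.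
  exists (k1 *: a), (k2 *: a), (k3 *: a), (k4 *: a).
  by rewrite /diagonal !tensZl !tensDr !tensZr !addrA.
- by exists 1, 1, 0, 0; rewrite /diagonal !tens0l !addr0 -tensDr f_fd addrC subrK tens1.
- exists (k *: a1 + b1), (k *: a2 + b2), (k *: a3 + b3), (k *: a4 + b4).
  by rewrite /diagonal !tensDl !tensZl; lin C HC.
- exists (a1 * b1 + a4 * b3), (a2 * b2 + a3 * b4), (a3 * b1 + a2 * b3), (a1 * b4 + a4 * b2).
  have [[PP PQ PF PD] [QP QQ QF QD] [FP FQ FF FD] [DP DQ DF DD]] := clifford_units R.
  rewrite /diagonal !(mulrDl, mulrDr) !tensM.
  rewrite PP PQ PF PD QP QQ QF QD FP FQ FF DP DQ DD !tens0r !tensDl.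
  by lin C HC.
Qed.

End Tensor.

(** * The centraliser as pairs of intertwined elements *)

Section Commutant.
Variables (R : realType) (m : nat) (c : 'M[R]_2 -> R[i]).
Local Notation C := R[i].
Local Notation Cl := (clifford R).
Local Notation H := (cherednik m c).
Local Notation HC := (HC m c).
Local Notation f := (f_ R).
Local Notation fd := (fdag R).
Local Notation z := (z_ m c).
Local Notation zb := (zbar m c).
Local Notation ze := (zeta m c).
Local Notation zeb := (zetabar m c).
Local Notation sg := (sigma m c).
Local Notation grp := (@hgrp R m c).
Local Notation M := (angular m c).
Local Notation diag := (@diagonal R m c).

Local Notation half := (2^-1 *: (1 : H)).

Implicit Types (a b x : H).

Lemma diag_lin k a b a' b' :
  diag (k *: a + a') (k *: b + b') = k *: diag a b + diag a' b'.
Proof. by rewrite /diagonal !tens_linl; lin C HC. Qed.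

Lemma diag_mul a b a' b' : diag a b * diag a' b' = diag (a * a') (b * b').
Proof.
have [[PP PQ _ _] [QP QQ _ _] _ _] := clifford_units R.
rewrite /diagonal mulrDl !mulrDr !tensM PP PQ QP QQ !tens0r.
by rewrite addr0 add0r.
Qed.

Lemma tens_one x : x ⊗ (1 : Cl) = diag x x :> HC.
Proof. by rewrite /diagonal -tensDr f_fd addrC subrK. Qed.

Lemma diag1 : diag 1 1 = 1.
Proof. by rewrite -tens_one tens1. Qed.

Lemma diag_sub a b a' b' : diag (a - a') (b - b') = diag a b - diag a' b'.
Proof.
have -> : diag (a - a') (b - b') = (-1) *: diag a' b' + diag a b.
  by rewrite -diag_lin !scaleN1r; congr diag; apply: addrC.
by rewrite scaleN1r addrC.
Qed.

Lemma diag_inj a b a' b' : diag a b = diag a' b' -> a = a' /\ b = b'.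
Proof.
move=> E; have : diag (a - a') (b - b') + (0 ⊗ f + 0 ⊗ fd) = 0.
  by rewrite !tens0l !addr0 diag_sub E subrr.
by case/tensor_units => /eqP + /eqP + _ _; rewrite !subr_eq0 => /eqP -> /eqP ->.
Qed.

Lemma diag_f a b x :
  diag a b * (x ⊗ f) = (b * x) ⊗ f /\ (x ⊗ f) * diag a b = (x * a) ⊗ f :> HC.
Proof.
have [[_ _ PF _] [_ _ QF _] [FP FQ _ _] _] := clifford_units R.
rewrite /diagonal mulrDl mulrDr !tensM PF QF FP FQ !tens0r.
by rewrite addr0 add0r.
Qed.

Lemma diag_fd a b x :
  diag a b * (x ⊗ fd) = (a * x) ⊗ fd /\ (x ⊗ fd) * diag a b = (x * b) ⊗ fd :> HC.
Proof.
have [[_ _ _ PD] [_ _ _ QD] _ [DP DQ _ _]] := clifford_units R.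
rewrite /diagonal mulrDl mulrDr !tensM PD QD DP DQ !tens0r.
by rewrite addr0 add0r.
Qed.

Lemma Z2E : Z2 m c = diag half (- half).
Proof.
rewrite /Z2 /diagonal.
have -> : fd * f - 2^-1 *: (1 : Cl) = 2^-1 *: (fd * f) + - 2^-1 *: (f * fd).
  by rewrite f_fd; lin C Cl; field.
by rewrite tensDr !tensZr -!tensZl scaleNr.
Qed.

Lemma Z1E : Z1 m c = diag (M + sg) (M - sg).
Proof.
rewrite /Z1 Z2E !tens_one diag_mul.
have -> : M + sg = 2 *: (sg * half) + (zb * zeb - z * ze).
  by rewrite /angular scaleAr_H mulr1; lin C H; field.
have -> : M - sg = 2 *: (sg * - half) + (zb * zeb - z * ze).
  by rewrite /angular mulrN scaleAr_H mulr1; lin C H; field.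
by rewrite diag_lin addrC.
Qed.

Lemma Z1_Z2E : Z1 m c - Z2 m c = diag (M + (sg - half)) (M - (sg - half)).
Proof.
have -> : M + (sg - half) = (-1) *: half + (M + sg) by lin C H.
have -> : M - (sg - half) = (-1) *: (- half) + (M - sg) by lin C H.
by rewrite diag_lin -Z2E -Z1E scaleN1r addrC.
Qed.

(** The four odd generators are off-diagonal matrices with one entry zb, z,
    2 ze or 2 zeb; these are the entries of the commutation relations
    between diag a b and each of them. *)
Definition intertwine a b : Prop :=
  [/\ a * zb = zb * b, b * z = z * a, a * ze = ze * b & b * zeb = zeb * a].

Lemma lin_span_gen (V : lmodType C) (s : seq V) (j : nat) :
  (j < size s)%N -> lin_span s s`_j.
Proof.
move=> js; exists (fun k => (val k == j)%:R); rewrite (bigD1 (Ordinal js)) //=.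
rewrite eqxx scale1r big1 ?addr0 // => k; rewrite -val_eqE /= => /negPf ->.
by rewrite scale0r.
Qed.

Lemma lin_span0 (V : lmodType C) (s : seq V) : lin_span s 0.
Proof. by exists (fun=> 0); rewrite big1 // => k _; rewrite scale0r. Qed.

Lemma u21_odd_gen (j : nat) (s := [:: Fp m c; Fbarp m c; Fm m c; Fbarm m c]) :
  (j < size s)%N -> u21 m c s`_j.
Proof.
move=> js; exists 0; first exact: lin_span0.
by exists s`_j; [apply: lin_span_gen | rewrite add0r].
Qed.

Lemma u21_Z2 : u21 m c (Z2 m c).
Proof.
exists (Z2 m c); first exact: (@lin_span_gen _ [:: Ep m c; Em m c; Hsl2 m c; Z2 m c; Z1 m c] 3).
by exists 0; [apply: lin_span0 | rewrite addr0].
Qed.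

Lemma commutes_u21 (X : HC) :
  (forall Y, Y \in [:: Ep m c; Em m c; Hsl2 m c; Z2 m c; Z1 m c;
                    Fp m c; Fbarp m c; Fm m c; Fbarm m c] -> X * Y = Y * X) ->
  centraliser (u21 m c) X.
Proof.
move=> XY _ [_ [k ->] [_ [l ->] <-]].
rewrite mulrDr mulrDl !mulr_sumr !mulr_suml; congr (_ + _);
  apply: eq_bigr => j _; rewrite hcAl hcAr XY //.
  rewrite (@mem_cat _ _ [:: Ep m c; Em m c; Hsl2 m c; Z2 m c; Z1 m c]).
  by rewrite mem_nth.
rewrite (@mem_cat _ _ [:: Ep m c; Em m c; Hsl2 m c; Z2 m c; Z1 m c]
  [:: Fp m c; Fbarp m c; Fm m c; Fbarm m c]).
by rewrite orbC mem_nth.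
Qed.

(** An element that commutes with Z_2, a diagonal matrix with distinct
    scalar entries, is diagonal. *)
Lemma centraliser_intertwine (X : HC) : centraliser (u21 m c) X ->
  exists a b, X = diag a b /\ intertwine a b.
Proof.
move=> CX; have [a1 [a2 [a3 [a4 XE]]]] := tensor_span X.
have [[PP PQ PF PD] [QP QQ QF QD] [FP FQ FF FD] [DP DQ DF DD]] := clifford_units R.
have E := CX _ u21_Z2.
have Z2' : Z2 m c = (1 : H) ⊗ (fd * f) + (- 2^-1) *: (1 : HC).
  by rewrite /Z2 -tens1 -tensZr -tensDr scaleNr.
have E2 : X * ((1 : H) ⊗ (fd * f)) = ((1 : H) ⊗ (fd * f)) * X.
  by move: E; rewrite Z2' mulrDr mulrDl hcAl hcAr mulr1 mul1r => /addIr.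
have [_ _ a30 a40] : [/\ (0 : H) = 0, (0 : H) = 0, a3 = 0 & - a4 = 0].
  apply: tensor_units; move: E2; rewrite XE /diagonal !(mulrDl, mulrDr) !tensM.
  rewrite !mulr1 !mul1r PP QP FP DP PQ PF PD !tens0r !tens0l !addr0 !add0r.
  move=> /addrI ->.
  by rewrite -scaleN1r tensZl scaleN1r subrr.
have a4' : a4 = 0 by apply/eqP; rewrite -oppr_eq0 a40.
have {}XE : X = diag a1 a2 by rewrite XE a30 a4' !tens0l !addr0.
exists a1, a2; split=> //.
have tens_inj x y : (x ⊗ f = y ⊗ f :> HC) \/ (x ⊗ fd = y ⊗ fd :> HC) -> x = y.
  have minus (b : Cl) : (x - y) ⊗ b = x ⊗ b - y ⊗ b :> HC.
    by rewrite tensDl -[- y]scaleN1r tensZl scaleN1r.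
  case=> xy; apply/eqP; rewrite -subr_eq0; apply/eqP.
    have [_ _ -> _] : [/\ (0 : H) = 0, (0 : H) = 0, x - y = 0 & (0 : H) = 0].
      apply: tensor_units; rewrite /diagonal minus xy !tens0l subrr.
      by rewrite !addr0.
    by [].
  have [_ _ _ ->] : [/\ (0 : H) = 0, (0 : H) = 0, (0 : H) = 0 & x - y = 0].
    apply: tensor_units; rewrite /diagonal minus xy !tens0l subrr.
    by rewrite !addr0.
  by [].
have two0 : (2 : C) != 0 by rewrite pnatr_eq0.
have odd j js := CX _ (@u21_odd_gen j js); rewrite XE in odd.
split.
- have /= := odd 0%N isT; rewrite /Fp.
  have [-> ->] := diag_fd a1 a2 zb => E0.
  by apply: tens_inj; right.
- have /= := odd 1%N isT; rewrite /Fbarp.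
  have [-> ->] := diag_f a1 a2 z => E0.
  by apply: tens_inj; left.
- have /= := odd 2%N isT; rewrite /Fm.
  have [-> ->] := diag_fd a1 a2 (2 *: ze); rewrite scaleAl_H scaleAr_H => E0.
  apply: (scalerI two0); apply: tens_inj; right.
  exact: E0.
- have /= := odd 3%N isT; rewrite /Fbarm.
  have [-> ->] := diag_f a1 a2 (2 *: zeb); rewrite scaleAl_H scaleAr_H => E0.
  by apply: (scalerI two0); apply: tens_inj; left.
Qed.

Lemma intertwine_pairs a b : intertwine a b ->
  [/\ a * (zb * zeb) = zb * zeb * a, a * (ze * z) = ze * z * a,
      b * (z * ze) = z * ze * b & b * (zeb * zb) = zeb * zb * b].
Proof.
move=> [azb bz aze bzeb]; split.
- by rewrite mulrA azb -mulrA bzeb mulrA.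
- by rewrite mulrA aze -mulrA bz mulrA.
- by rewrite mulrA bz -mulrA aze mulrA.
- by rewrite mulrA bzeb -mulrA azb mulrA.
Qed.

(** Passing two odd coordinates in turn leads from a to b and back to a. *)
Lemma intertwine_AB a b : intertwine a b ->
  [/\ a * (z * zb) = z * zb * a, a * (ze * zeb) = ze * zeb * a,
      b * (z * zb) = z * zb * b & b * (ze * zeb) = ze * zeb * b].
Proof.
have zzb : z * zb = zb * z := letterC m c true false true.
have zezeb : ze * zeb = zeb * ze := letterC m c false false true.
move=> [azb bz aze bzeb]; split.
- by rewrite zzb mulrA azb -mulrA bz mulrA.
- by rewrite mulrA aze -mulrA bzeb mulrA.
- by rewrite mulrA bz -mulrA azb mulrA.
- by rewrite zezeb mulrA bzeb -mulrA aze mulrA.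
Qed.

Lemma ze_z : ze * z = z * ze + (1 - sg).
Proof. exact: (letter_comm m c false false). Qed.
Lemma zeb_zb : zeb * zb = zb * zeb + (1 - sg).
Proof. exact: (letter_comm m c true true). Qed.

(** The diagonal entries of the even generators are combinations of 1 and of
    products of two coordinates that lead from a to b and back, or from b to
    a and back. The order of the factors has to be chosen for each entry,
    which absorbs sigma. *)
Lemma intertwine_centraliser a b : intertwine a b ->
  centraliser (u21 m c) (diag a b).
Proof.
move=> ab; have [azb bz aze bzeb] := ab.
have [p1 p2 p3 p4] := intertwine_pairs ab; have [q1 q2 q3 q4] := intertwine_AB ab.
have commD x y : a * x = x * a -> b * y = y * b ->
  diag a b * diag x y = diag x y * diag a b by rewrite !diag_mul => -> ->.
have lin_comm (d x y : H) k : d * x = x * d -> d * y = y * d ->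
    d * (k *: x + y) = (k *: x + y) * d.
  by move=> dx dy; rewrite mulrDr mulrDl scaleAr_H scaleAl_H dx dy.
have comm1 (d : H) : d * 1 = 1 * d by rewrite mulr1 mul1r.
have commZ (d x : H) k : d * x = x * d -> d * (k *: x) = (k *: x) * d.
  by move=> dx; rewrite scaleAr_H scaleAl_H dx.
have commB (d x y : H) : d * x = x * d -> d * y = y * d -> d * (x - y) = (x - y) * d.
  by move=> dx dy; rewrite mulrBr mulrBl dx dy.
have hE : z * ze + zb * zeb + 1 - sg = ze * z + zb * zeb.
  by rewrite ze_z; lin C H.
have hE' : z * ze + zb * zeb + 1 - sg = z * ze + zeb * zb.
  by rewrite zeb_zb; lin C H.
apply: commutes_u21 => Y; rewrite !inE.
case/or3P=> [/eqP-> | /eqP-> | ]; last case/or3P=> [/eqP-> | /eqP-> | ];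
  last case/or3P=> [/eqP-> | /eqP-> | /or3P[/eqP-> | /eqP-> | /eqP->]].
- by rewrite /Ep tens_one; apply: commD; apply: commZ.
- by rewrite /Em tens_one; apply: commD; apply: commZ.
- rewrite /Hsl2 tens_one; apply: commD.
    by rewrite hE mulrDr mulrDl p1 p2.
  by rewrite hE' mulrDr mulrDl p3 p4.
- by rewrite Z2E; apply: commD; rewrite -?scaleNr; apply: commZ.
- rewrite Z1E; apply: commD.
    have -> : M + sg = zb * zeb - (ze * z - 1) by rewrite ze_z /angular; lin C H.
    by apply: (commB) => //; apply: (commB).
  have -> : M - sg = zeb * zb - 1 - z * ze by rewrite zeb_zb /angular; lin C H.
  by apply: (commB) => //; apply: (commB).
- by rewrite /Fp; have [-> ->] := diag_fd a b zb; rewrite azb.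
- by rewrite /Fbarp; have [-> ->] := diag_f a b z; rewrite bz.
- rewrite /Fm; have [-> ->] := diag_fd a b (2 *: ze).
  by rewrite scaleAl_H scaleAr_H aze.
- rewrite /Fbarm; have [-> ->] := diag_f a b (2 *: zeb).
  by rewrite scaleAl_H scaleAr_H bzeb.
Qed.

Lemma Z_intertwine (s := sg - half) : intertwine (M + s) (M - s).
Proof.
have zzb : z * zb = zb * z := letterC m c true false true.
have zezeb : ze * zeb = zeb * ze := letterC m c false false true.
have ze_zb : ze * zb = zb * ze + taub m c := letter_comm m c false true.
have zeb_z : zeb * z = z * zeb + tau m c := letter_comm m c true false.
have s1 : sg * zb = z * taub m c := sg_letter m c true true.
have s2 : sg * z = zb * tau m c := sg_letter m c true false.
have s3 : ze * sg = taub m c * zeb := letter_sg m c false false.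
have s4 : zeb * sg = tau m c * ze := letter_sg m c false true.
rewrite /intertwine /s /angular.
move: zzb zezeb ze_z zeb_zb ze_zb zeb_z s1 s2 s3 s4.
move: (z_ m c) (zbar m c) (zeta m c) (zetabar m c) (sigma m c) (tau m c) (taub m c).
move=> Z Zb D Db S T Tb zzb zezeb d_z db_zb d_zb db_z s1 s2 s3 s4.
have M1 : (Zb * Db - Z * D) * Zb = Zb * (Zb * Db - Z * D) + Zb - Zb * S - S * Zb.
  rewrite mulrBl mulrBr -(mulrA Zb Db) db_zb -(mulrA Z D) d_zb !mulrA.
  by rewrite !mulrDr !mulrA -s1 zzb mulrN mulr1; lin C H.
have M2 : (Zb * Db - Z * D) * Z = Z * (Zb * Db - Z * D) - Z + Z * S + S * Z.
  rewrite mulrBl mulrBr -(mulrA Zb Db) db_z -(mulrA Z D Z) d_z !mulrA.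
  by rewrite !mulrDr !mulrA -s2 zzb mulrN mulr1; lin C H.
have M3 : D * (Zb * Db - Z * D) = (Zb * Db - Z * D) * D + D * S - D + S * D.
  rewrite mulrBl mulrBr !mulrA d_zb d_z !mulrDl mulNr mul1r -s3.
  by rewrite -(mulrA Zb D) zezeb !mulrA; lin C H.
have M4 : Db * (Zb * Db - Z * D) = (Zb * Db - Z * D) * Db + Db - S * Db - Db * S.
  rewrite mulrBl mulrBr !mulrA db_zb db_z !mulrDl mulNr mul1r -s4.
  by rewrite -(mulrA Z D) zezeb !mulrA; lin C H.
move: (Zb * Db - Z * D) M1 M2 M3 M4 => N M1 M2 M3 M4.
by split; rewrite !(mulrDl, mulrDr, mulrBl, mulrBr, mulNr, mulrN) !scaleAl_H
  !scaleAr_H mulr1 mul1r ?M1 ?M2 ?M3 ?M4; lin C H; field.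
Qed.

(** * The double cover of G^J *)

(** Elements of the double cover that lie over rotations are even, and those
    over reflections odd. The scalar k is left free: only the ratio of the
    two matrix entries matters, and it is determined by the group element. *)
Definition even_pin (k w : C) : Cl := k *: (fd * f + w *: (f * fd)).
Definition odd_pin (k w : C) : Cl := k *: (fd - w *: f).

(** The unit complex number by which the rotation rot_mx p q acts on zbar
    and zeta. *)
Definition cis (p q : R) : C := p%:C%C + 'i%C * q%:C%C.

Lemma cis_conj p q : cis p (- q) = p%:C%C - 'i%C * q%:C%C.
Proof. by rewrite /cis rmorphN mulrN. Qed.

(** An odd element exchanges the two diagonal entries, hence inverts w' in
    passing; v stands for this inverse, so that no division enters. *)
Lemma pin_mul k w k' w' : [/\
  even_pin k w * even_pin k' w' = even_pin (k * k') (w * w'),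
  even_pin k w * odd_pin k' w' = odd_pin (k * k') (w * w'),
  forall v, w' * v = 1 ->
    odd_pin k w * even_pin k' w' = odd_pin (k * k' * w') (w * v) &
  forall v, w' * v = 1 ->
    odd_pin k w * odd_pin k' w' = even_pin (- (k * k' * w')) (w * v)].
Proof.
have E k1 k2 k3 k4 l1 l2 l3 l4 :=
  matrix_units_mul k1 k2 k3 k4 l1 l2 l3 l4 (clifford_units R).
have evE (x y : C) : even_pin x y = x *: (fd * f) + (x * y) *: (f * fd) + 0 *: f + 0 *: fd.
  by rewrite /even_pin; lin C Cl.
have odE (x y : C) : odd_pin x y = 0 *: (fd * f) + 0 *: (f * fd) + - (x * y) *: f + x *: fd.
  by rewrite /odd_pin; lin C Cl.
have same (x y u v x' y' u' v' : C) : x = x' -> y = y' -> u = u' -> v = v' ->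
    x *: (fd * f) + y *: (f * fd) + u *: f + v *: fd =
    x' *: (fd * f) + y' *: (f * fd) + u' *: f + v' *: fd.
  by move=> -> -> -> ->.
split=> [||v wv|v wv]; rewrite ?evE ?odE E ?evE ?odE; apply: same; try ring.
- by transitivity (- (k * w * k' * (w' * v))); [rewrite wv|]; ring.
- by transitivity (- (k * w * k' * (w' * v))); [rewrite wv|]; ring.
Qed.

Inductive pin_spec (a : Cl) (g : 'M[R]_2) : Prop :=
  | PinEven p q k of p * p + q * q = 1 & k != 0 &
      g = rot_mx p q & a = even_pin k (cis p q)
  | PinOdd p q k of p * p + q * q = 1 & k != 0 &
      g = ref_mx p q & a = odd_pin k (cis p q).

Lemma cis_unit p q : p * p + q * q = 1 -> cis p q * cis p (- q) = 1.
Proof. by move=> pq1; rewrite cis_conj mulrC; apply: complex_unit. Qed.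

Lemma cis_neq0 p q : p * p + q * q = 1 -> cis p q != 0.
Proof.
move=> /cis_unit; apply: contra_eq_neq => ->.
by rewrite mul0r eq_sym oner_neq0.
Qed.

Lemma cis_mul p q p' q' : cis p q * cis p' q' = cis (p * p' - q * q') (p * q' + q * p').
Proof. by rewrite /cis !(rmorphD, rmorphB, rmorphM) /=; ring: (ii R). Qed.

Lemma even_pin1 : even_pin 1 1 = 1.
Proof. by rewrite /even_pin f_fd; lin C Cl. Qed.

Lemma iota_root (j : 'I_m)
    (co := (cos (angle R j))%:C%C) (si := (sin (angle R j))%:C%C) :
  co * co = 1 - si * si /\
  iota_cl (cplx (alpha_ R j)) = si *: e_ R 0 + - co *: e_ R 1.
Proof.
split.
  have := congr1 (real_complex R) (cos2Dsin2 (angle R j)).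
  by rewrite rmorphD !rmorphXn rmorph1 /= -/co -/si => <-; ring.
rewrite /iota_cl big_ord_recl big_ord1 alphaE cplx_col2 !mxE /= rmorphN.
by congr (_ + _ *: e_ R _); apply: val_inj.
Qed.
Lemma pin_iota (j : 'I_m) : exists2 k, k != 0 &
  iota_cl (cplx (alpha_ R j)) =
  odd_pin k (cis (cos (angle R j *+ 2)) (sin (angle R j *+ 2))).
Proof.
have [cs ->] := iota_root j.
set co := (cos _)%:C%C in cs *; set si := (sin _)%:C%C in cs *.
exists (si + 'i%C * co).
  have : (si + 'i%C * co) * (si - 'i%C * co) = 1 by ring: (ii R) cs.
  by apply: contra_eq_neq => ->; rewrite mul0r eq_sym oner_neq0.
have -> : cis (cos (angle R j *+ 2)) (sin (angle R j *+ 2)) =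
    (co + 'i%C * si) * (co + 'i%C * si).
  rewrite /cis cos_mulr2n sin_mulr2n rmorphB !rmorphMn /= rmorphXn rmorphM rmorph1.
  by rewrite -/co -/si; ring: (ii R) cs.
rewrite e0E e1E /odd_pin.
by lin C Cl; ring: (ii R) cs.
Qed.

(** The ratio of the two matrix entries follows the rotation angle in
    products and inverses, and for alpha_j it is - exp(2 i t), with t the
    angle of alpha_j. *)
Lemma pin_graph_spec (u : Cl) g : pin_graph m (u, g) -> pin_spec u g.
Proof.
move=> pug; suff: pin_graph m `<=` [set v | pin_spec v.1 v.2] by move/(_ _ pug).
apply: smallest_sub; last first.
  move=> _ [s [j ->]] /=; have [k k0 ->] := pin_iota j.
  apply: (@PinOdd _ _ _ _ ((-1) ^+ s * k) _ _ (reflectionE R j)).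
  - by rewrite -!expr2 cos2Dsin2.
  - by rewrite mulf_neq0 // signr_eq0.
  - by case: s; rewrite ?expr1 ?expr0 ?mulN1r ?mul1r /odd_pin ?scaleNr.
split=> [|a b {pug}g h|a b {pug}g] /=.
- apply: (@PinEven _ _ 1 0 1); rewrite ?oner_neq0 //; first by ring.
    by rewrite scalar_mat2 /rot_mx oppr0.
  by rewrite /cis mulr0 addr0 even_pin1.
- case=> p q k pq1 k0 -> -> [] p' q' k' pq1' k0' -> ->;
  have [E1 E2 E3 E4] := pin_mul k (cis p q) k' (cis p' q').
  + apply: (@PinEven _ _ (p * p' - q * q') (p * q' + q * p') (k * k')).
    * by rewrite -[RHS]mul1r -{1}pq1 -pq1'; ring.
    * by rewrite mulf_neq0.
    * by rewrite mul_mat2; congr mat2; ring.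
    * by rewrite E1 cis_mul.
  + apply: (@PinOdd _ _ (p * p' - q * q') (p * q' + q * p') (k * k')).
    * by rewrite -[RHS]mul1r -{1}pq1 -pq1'; ring.
    * by rewrite mulf_neq0.
    * by rewrite mul_mat2; congr mat2; ring.
    * by rewrite E2 cis_mul.
  + apply: (@PinOdd _ _ (p * p' + q * q') (q * p' - p * q') (k * k' * cis p' q')).
    * by rewrite -[RHS]mul1r -{1}pq1 -pq1'; ring.
    * by rewrite !mulf_neq0 ?cis_neq0.
    * by rewrite mul_mat2; congr mat2; ring.
    * by rewrite (E3 _ (cis_unit pq1')) cis_mul; congr (odd_pin _ (cis _ _)); ring.
  + apply: (@PinEven _ _ (p * p' + q * q') (q * p' - p * q') (- (k * k' * cis p' q'))).
    * by rewrite -[RHS]mul1r -{1}pq1 -pq1'; ring.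
    * by rewrite oppr_eq0 !mulf_neq0 ?cis_neq0.
    * by rewrite mul_mat2; congr mat2; ring.
    * by rewrite (E4 _ (cis_unit pq1')) cis_mul; congr (even_pin _ (cis _ _)); ring.
- move=> + ab ba; case=> p q k pq1 k0 -> aE.
    have bE (b' : Cl) : a * b' = 1 -> b = b'.
      by move=> ab'; rewrite -[b]mulr1 -ab' mulrA ba mul1r.
    apply: (@PinEven _ _ p (- q) k^-1); rewrite ?invr_neq0 //.
    * by rewrite -pq1; ring.
    * exact: invmx_rot.
    * apply: bE; have [E1 _ _ _] := pin_mul k (cis p q) k^-1 (cis p (- q)).
      by rewrite aE E1 mulfV // cis_unit // even_pin1.
  have bE (b' : Cl) : a * b' = 1 -> b = b'.
    by move=> ab'; rewrite -[b]mulr1 -ab' mulrA ba mul1r.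
  apply: (@PinOdd _ _ p q (- (k * cis p q)^-1)) => //.
  * by rewrite oppr_eq0 invr_neq0 // mulf_neq0 ?cis_neq0.
  * exact: invmx_ref.
  * apply: bE; have [_ _ _ E4] := pin_mul k (cis p q) (- (k * cis p q)^-1) (cis p q).
    have w0 := cis_neq0 pq1.
    rewrite aE (E4 _ (cis_unit pq1)) cis_unit // -even_pin1; congr even_pin.
    by field; rewrite k0 w0.
Qed.

(** * The centraliser is generated by Z_1 - Z_2 and the double cover *)

Hypotheses (m_gt0 : (0 < m)%N) (c_inv : conj_invariant m c).
Local Notation G := (@dihedral R m).
Local Notation below := (@below R m c).
Local Notation group_span := (@group_span R m c).
Local Notation s := (sg - half).

Definition generators : set HC := [set Z1 m c - Z2 m c] `|` rho_dihedralJ m c.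
Local Notation gen := (generated_subalgebra generators).

Lemma gen_subalgebra : is_subalgebra gen.
Proof.
split=> [S [[S1 _ _] _] //|k x y gx gy S SP|x y gx gy S SP].
  by have [[_ SL _] _] := SP; apply: SL; [apply: gx | apply: gy].
by have [[_ _ SM] _] := SP; apply: SM; [apply: gx | apply: gy].
Qed.

Lemma gen_sub : generators `<=` gen.
Proof. by move=> x xS S [_ ]; apply. Qed.

Lemma centraliser_subalgebra (S : set HC) : is_subalgebra (centraliser S).
Proof.
split=> [y _|k x y Sx Sy t St|x y Sx Sy t St]; first by rewrite mulr1 mul1r.
  by rewrite mulrDl mulrDr hcAl hcAr Sx // Sy.
by rewrite -mulrA Sy // mulrA Sx // mulrA.
Qed.

Lemma diagZ k a b : k *: diag a b = diag (k *: a) (k *: b).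
Proof. by rewrite /diagonal !tensZl scalerDr. Qed.

Lemma even_pin_diag (g : G) k w :
  hgrp c g ⊗ even_pin k w = diag (k *: grp g) ((k * w) *: grp g) :> HC.
Proof.
rewrite /even_pin /diagonal !tensZl -!tensZr -tensDr; congr (_ ⊗ _).
by rewrite scalerDr scalerA.
Qed.

Lemma rotation_intertwine (g : G) p q k :
  p * p + q * q = 1 -> val g = rot_mx p q ->
  intertwine (k *: grp g) ((k * cis p q) *: grp g).
Proof.
move=> pq1 gE; have ww := complex_unit pq1.
have rot up bar := rot_letter c up bar pq1 gE.
split; rewrite scaleAl_H scaleAr_H.
- by rewrite [grp g * _](rot true true) scalerA expr0 mul1r.
- rewrite [grp g * _](rot true false) scalerA expr1 mulN1r /cis -mulrA.
  by rewrite [_ * (_ - _)]mulrC ww mulr1.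
- by rewrite [grp g * _](rot false false) scalerA expr0 mul1r.
- rewrite [grp g * _](rot false true) scalerA expr1 mulN1r /cis -mulrA.
  by rewrite [_ * (_ - _)]mulrC ww mulr1.
Qed.

Lemma gen_centraliser : gen `<=` centraliser (u21 m c).
Proof.
apply: smallest_sub; first exact: centraliser_subalgebra.
move=> X [->|[g [a [pag Jg ->]]]].
  by rewrite Z1_Z2E; apply/intertwine_centraliser/Z_intertwine.
have [p q k pq1 k0 gE ->|p q k pq1 k0 gE _] := pin_graph_spec pag.
  rewrite even_pin_diag; apply: intertwine_centraliser.
  exact: rotation_intertwine.
by have [_] := Jg; rewrite gE => /(ref_mxJ pq1).
Qed.

Lemma iota_root_sq (j : 'I_m) :
  iota_cl (cplx (alpha_ R j)) * iota_cl (cplx (alpha_ R j)) = 1 :> Cl.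
Proof.
have [cs ->] := iota_root j.
rewrite mulrDl !mulrDr !clAl !clAr !e_sq e10.
by lin C Cl; ring: cs.
Qed.

Lemma pin_lift (g : 'M[R]_2) : dihedral m g ->
  exists a b : Cl, [/\ pin_graph m (a, g), a * b = 1 & b * a = 1].
Proof.
have pin : pin_group (pin_graph m : set (Cl * 'M[R]_2)).
  split=> [A [[A1 _ _] _] //|a b g1 h1 ga gb A AP|a b g1 ga ab ba A AP];
    have [[_ AM AV] _] := AP.
    exact: AM (ga A AP) (gb A AP).
  exact: AV (ga A AP) ab ba.
have [P1 PM PV] := pin.
move=> Dg; suff: dihedral m `<=` [set g | exists a b : Cl,
    [/\ pin_graph m (a, g), a * b = 1 & b * a = 1]] by move/(_ _ Dg).
apply: smallest_sub; last first.
  move=> _ [j _ <-]; have iota2 := iota_root_sq j.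
  exists (iota_cl (cplx (alpha_ R j))), (iota_cl (cplx (alpha_ R j))).
  by split=> //; apply: sub_gen_smallest; exists false, j; rewrite mul1r.
split=> /= [|{Dg}g h [a [b [ga ab ba]]] [a' [b' [ga' ab' ba']]]|{Dg}g [a [b [ga ab ba]]]].
- by exists 1, 1; rewrite mul1r.
- exists (a * a'), (b' * b); split; first exact: PM.
    by rewrite mulrA -(mulrA a) ab' mulr1.
  by rewrite mulrA -(mulrA b') ba mulr1.
- by exists b, a; split=> //; apply: PV ga ab ba.
Qed.

Lemma gen0 : gen 0.
Proof.
have [g1 gL _] := gen_subalgebra.
by rewrite -(addNr (1 : HC)) -scaleN1r; apply: gL.
Qed.

(** Scalars are available in a subalgebra, so that the unknown factor k of a
    lift can be removed. *)
Lemma rotation_gen (g : G) p q : p * p + q * q = 1 -> val g = rot_mx p q ->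
  gen (diag (grp g) (cis p q *: grp g)).
Proof.
move=> pq1 gE; have Dg : dihedral m (val g) := set_mem (valP g).
have [a [b [pag _ _]]] := pin_lift Dg.
have Jg : dihedralJ m (val g) by split=> //; rewrite gE; apply: rot_mxJ.
have ga : gen (grp g ⊗ a) by apply: gen_sub; right; exists g, a.
have [_ genL _] := gen_subalgebra.
have [p' q' k pq1' k0 gE' aE|p' q' k pq1' _ gE' _] := pin_graph_spec pag; last first.
  by have [_] := Jg; rewrite gE' => /(ref_mxJ pq1').
have [pp qq] : p' = p /\ q' = q.
  have := gE'; rewrite gE => /matrixP E.
  by have := E 0 0; have := E 1 0; rewrite !mxE /=.
have := genL k^-1 _ _ ga gen0; rewrite addr0 aE pp qq even_pin_diag.
have -> : k^-1 *: diag (k *: grp g) ((k * cis p q) *: grp g) =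
    diag (grp g) (cis p q *: grp g).
  by rewrite diagZ !scalerA mulKf // mulVf // scale1r.
by [].
Qed.

(** A rotation fixes both z zeta and zbar zetabar, and a reflection
    exchanges them. *)
Lemma grp_M (g : G) : exists e : C, grp g * M = e *: (M * grp g).
Proof.
have [p q pq1 gE|p q pq1 gE] := dihedral_isometry (set_mem (valP g)).
  exists 1; have rot up bar := rot_letter c up bar pq1 gE.
  have zbzeb : grp g * (zb * zeb) = zb * zeb * grp g.
    rewrite mulrA [grp g * _](rot true true) scaleAl_H -mulrA.
    rewrite [grp g * _](rot false true) scaleAr_H scalerA mulrA.
    by rewrite expr0 expr1 mul1r mulN1r mulrC complex_unit ?scale1r.
  have zze : grp g * (z * ze) = z * ze * grp g.
    rewrite mulrA [grp g * _](rot true false) scaleAl_H -mulrA.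
    rewrite [grp g * _](rot false false) scaleAr_H scalerA mulrA.
    by rewrite expr0 expr1 mul1r mulN1r complex_unit ?scale1r.
  by rewrite /angular mulrBr zbzeb zze -mulrBl scale1r.
exists (- 1); have ref up bar := ref_letter c up bar pq1 gE.
have zbzeb : grp g * (zb * zeb) = z * ze * grp g.
  rewrite mulrA [grp g * _](ref true true) scaleAl_H -mulrA.
  rewrite [grp g * _](ref false true) scaleAr_H scalerA mulrA.
  by rewrite expr0 expr1 mul1r mulN1r opprK complex_unit ?scale1r.
have zze : grp g * (z * ze) = zb * zeb * grp g.
  rewrite mulrA [grp g * _](ref true false) scaleAl_H -mulrA.
  rewrite [grp g * _](ref false false) scaleAr_H scalerA mulrA.
  by rewrite expr0 expr1 mul1r mulN1r opprK mulrC complex_unit ?scale1r.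
by rewrite /angular mulrBr zbzeb zze scaleN1r mulrBl opprB.
Qed.

Lemma grp_expM (g : G) k : exists e : C, grp g * M ^+ k = e *: (M ^+ k * grp g).
Proof.
elim: k => [|k [e IH]]; first by exists 1; rewrite expr0 mulr1 mul1r scale1r.
have [e' E] := grp_M g; exists (e * e').
by rewrite exprSr mulrA IH scaleAl_H -mulrA E scaleAr_H scalerA mulrA.
Qed.

Lemma below_leq n n' x : (n <= n')%N -> below n x -> below n' x.
Proof.
move=> nn'; apply: (lspan_map (f := id)) => // _ [k [g [kn ->]]].
by apply: lspan_gen; exists k, g; split=> //; apply: leq_trans nn'.
Qed.

Lemma M_below n x : below n x -> below n.+1 (M * x).
Proof.
move: x; apply: lspan_map => [k a b|_ [k [g [kn ->]]]].
  by rewrite mulrDr scaleAr_H.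
by apply: lspan_gen; exists k.+1, g; rewrite exprS mulrA.
Qed.

Lemma group_below n a x : group_span a -> below n x -> below n (a * x).
Proof.
move=> Ga Bx; move: a Ga; apply: lspan_map => [k a b|_ [g ->]].
  by rewrite mulrDl scaleAl_H.
move: x Bx; apply: lspan_map => [k a b|_ [k [g' [kn ->]]]].
  by rewrite mulrDr scaleAr_H.
have [e E] := grp_expM g k; have [l El] := grp_mul c g g'.
rewrite mulrA E scaleAl_H -mulrA El; apply/lspanZ/lspan_gen.
by exists k, l.
Qed.

Lemma expM_group n a : group_span a -> below n.+1 (M ^+ n * a).
Proof.
move: a; apply: lspan_map => [k a b|_ [g ->]]; first by rewrite mulrDr scaleAr_H.
by apply: lspan_gen; exists n, g.
Qed.

(** The diagonal entries of Z_1 - Z_2 are M plus or minus an element of the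
    group algebra, hence their powers have the same top term as those of M. *)
Lemma shifted_power n t a : group_span t -> group_span a ->
  below n ((M + t) ^+ n * a - M ^+ n * a).
Proof.
move=> Gt Ga; elim: n => [|n IH]; first by rewrite subrr; apply: lspan0.
have -> : (M + t) ^+ n.+1 * a - M ^+ n.+1 * a =
    M * ((M + t) ^+ n * a - M ^+ n * a) +
    (t * ((M + t) ^+ n * a - M ^+ n * a) + t * (M ^+ n * a)).
  rewrite !exprS; move: (angular m c) => N; rewrite !mulrA mulrDl mulrDl !mulrBr !mulrA.
  by lin C H.
apply: lspanD; first exact: M_below.
apply: lspanD; first by apply: below_leq (leqnSn n) _; apply: group_below.
by apply: group_below => //; apply: expM_group.
Qed.

Lemma split_top n x : below n.+1 x ->
  exists a y, [/\ group_span a, below n y & x = M ^+ n * a + y].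
Proof.
elim=> {x} [|k x y [j [g [jn ->]]] _ [a [r [Ga Br ->]]]].
  exists 0, 0; split; [exact: lspan0|exact: lspan0|].
  by rewrite mulr0 addr0.
move: jn; rewrite ltnS leq_eqVlt => /orP[/eqP ->|jn].
  exists (k *: grp g + a), r; split=> //.
    by apply: lspan_cons => //; exists g.
  by rewrite mulrDr scaleAr_H addrA.
exists a, (k *: (M ^+ j * grp g) + r); split=> //.
  by apply: lspan_cons => //; exists j, g.
by rewrite addrCA.
Qed.

Lemma inv_below x : sl2_inv x -> exists n, below n x.
Proof.
elim=> {x} [|k x y [j [g ->]] _ [n Bn]]; first by exists 0%N; apply: lspan0.
exists (maxn j.+1 n); apply: lspan_lin.
  by apply: lspan_gen; exists j, g; rewrite leq_max ltnSn.
by apply: below_leq Bn; rewrite leq_maxr.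
Qed.

Lemma group_span_s : group_span s.
Proof.
have [g E] := grp_one m c.
apply: lspanB; last by apply/lspanZ/lspan_gen; exists g.
by apply: lspan_sum => j; apply/lspanZ/lspan_gen; exists (s_ R j).
Qed.

Lemma gen_expr (x : HC) n : gen x -> gen (x ^+ n).
Proof.
have [g1 _ gM] := gen_subalgebra => gx.
by elim: n => // n IH; rewrite exprS; apply: gM.
Qed.

Lemma diag_expr (a b : H) n : diag a b ^+ n = diag (a ^+ n) (b ^+ n).
Proof. by elim: n => [|n IH]; rewrite ?diag1 // !exprS IH diag_mul. Qed.

(** The relation between the coefficients of a and b is the one between the
    two diagonal entries of the elements of the double cover lying over
    rotations, and there are no terms over reflections. *)
Lemma gen_top (a b : H) : group_span a -> group_span b ->
  (forall F, rep a (rep zb F) = rep zb (rep b F)) -> gen (diag a b).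
Proof.
move=> Ga Gb E; have [sa [al [ua al0 aE]]] := group_span_combination Ga.
have [sb [be [ub be0 bE]]] := group_span_combination Gb.
pose s' := undup (sa ++ sb); have us : uniq s' := undup_uniq _.
have sas : {subset sa <= s'} by move=> h; rewrite mem_undup mem_cat => ->.
have sbs : {subset sb <= s'} by move=> h; rewrite mem_undup mem_cat orbC => ->.
have al0' g : g \notin s' -> al g = 0 by move=> gs; apply: al0; apply: contra gs => /sas.
have be0' g : g \notin s' -> be g = 0 by move=> gs; apply: be0; apply: contra gs => /sbs.
rewrite (combination_widen c ua us sas al0) in aE.
rewrite (combination_widen c ub us sbs be0) in bE.
rewrite aE bE in E *.
have [_ genL _] := gen_subalgebra.
have terms g : gen (diag (al g *: grp g) (be g *: grp g)).
  have [p q pq1 gE|p q pq1 gE] := dihedral_isometry (set_mem (valP g)).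
    have alE := top_rotation m_gt0 c_inv us al0' be0' E gE.
    have -> : be g = al g * cis p q.
      by rewrite alE mulrAC complex_unit // mul1r.
    rewrite -scalerA -diagZ -[X in gen X]addr0.
    by apply: genL gen0; apply: rotation_gen.
  have [-> ->] := top_reflection m_gt0 c_inv us al0' be0' E pq1 gE.
  by rewrite !scale0r /diagonal !tens0l addr0; apply: gen0.
rewrite /combination; elim: s' {us sas sbs al0' be0' aE bE E} => [|g t IH].
  by rewrite !big_nil /diagonal !tens0l addr0; apply: gen0.
rewrite !big_cons -[al g *: _]scale1r -[be g *: _]scale1r diag_lin.
exact: genL.
Qed.

Lemma intertwine_sub a b a' b' :
  intertwine a b -> intertwine a' b' -> intertwine (a - a') (b - b').
Proof.
move=> [E1 E2 E3 E4] [F1 F2 F3 F4].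
by split; rewrite mulrBl mulrBr ?(E1, E2, E3, E4) ?(F1, F2, F3, F4).
Qed.

(** Induction on the degree in M: the top coefficients A and B form an
    element diag A B of the generated algebra, and subtracting (Z_1 - Z_2)
    ^+ n * diag A B, which is in the centraliser too, lowers the degree. *)
Lemma intertwine_gen n a b : intertwine a b -> below n a -> below n b ->
  gen (diag a b).
Proof.
elim: n a b => [|n IH] a b ab Ba Bb.
  have zero x : below 0 x -> x = 0.
    by elim=> // k y y' [j [g []]].
  by rewrite (zero a) // (zero b) // /diagonal !tens0l addr0; apply: gen0.
have [A [a' [GA Ba' aE]]] := split_top Ba; have [B [b' [GB Bb' bE]]] := split_top Bb.
have [_ genL genM] := gen_subalgebra.
have gAB : gen (diag A B).
  apply: gen_top => // F; have [azb _ _ _] := ab.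
  by apply: (top_coefficients m_gt0 c_inv GA GB Ba' Bb'); rewrite -aE -bE.
pose W := (Z1 m c - Z2 m c) ^+ n * diag A B.
have gW : gen W.
  by apply: genM gAB; apply: gen_expr; apply: gen_sub; left.
have WE : W = diag ((M + s) ^+ n * A) ((M - s) ^+ n * B).
  by rewrite /W Z1_Z2E diag_expr diag_mul.
have iW : intertwine ((M + s) ^+ n * A) ((M - s) ^+ n * B).
  have [u [v [uv iuv]]] := centraliser_intertwine (gen_centraliser gW).
  by rewrite WE in uv; have [-> ->] := diag_inj uv.
have subtract (x y N X : H) : x = N + y -> x - X = y - (X - N).
  by move=> ->; rewrite opprB addrA [y + N]addrC.
have rest : gen (diag (a - (M + s) ^+ n * A) (b - (M - s) ^+ n * B)).
  apply: IH; first exact: intertwine_sub.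
    have -> : a - (M + s) ^+ n * A = a' - ((M + s) ^+ n * A - M ^+ n * A).
      exact: subtract.
    by apply: lspanB => //; apply: shifted_power GA; apply: group_span_s.
  have -> : b - (M - s) ^+ n * B = b' - ((M - s) ^+ n * B - M ^+ n * B).
    exact: subtract.
  by apply: lspanB => //; apply: shifted_power GB; apply/lspanN/group_span_s.
have -> : diag a b = 1 *: W + diag (a - (M + s) ^+ n * A) (b - (M - s) ^+ n * B).
  by rewrite scale1r diag_sub -WE addrC subrK.
exact: genL.
Qed.

Lemma centraliser_gen : centraliser (u21 m c) `<=` gen.
Proof.
move=> X CX; have [a [b [-> ab]]] := centraliser_intertwine CX.
have [aA aB bA bB] := intertwine_AB ab.
have [n Ba] := inv_below (sl2_invariants (esym aA) (esym aB)).
have [n' Bb] := inv_below (sl2_invariants (esym bA) (esym bB)).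
apply: (@intertwine_gen (maxn n n')) => //.
  by apply: below_leq Ba; apply: leq_maxl.
by apply: below_leq Bb; apply: leq_maxr.
Qed.

End Commutant.

Theorem proposition6p2 (R : realType) (m : nat) (c : 'M[R]_2 -> R[i])
    (m_gt0 : (0 < m)%N) (c_inv : conj_invariant m c) :
  (forall g h : 'M[R]_2, dihedralJ m g -> dihedralJ m h -> g *m h = h *m g) /\
  centraliser (u21 m c) =
    generated_subalgebra ([set Z1 m c - Z2 m c] `|` rho_dihedralJ m c).
Proof.
split; first exact: dihedralJ_abelian.
rewrite eqEsubset; split; first exact: centraliser_gen.
exact: gen_centraliser.
Qed.
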